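(* Let $t_0<t_1\in\mathbb{R}$ and let $f:[t_0,t_1]\to\mathcal{M}$ be a differentiable function on a Riemannian manifold $\mathcal{M}$. Suppose that $$f(t_0)=p,\quad f(t_1)=q\in\mathcal{M},\qquad \dot f(t_0)=v_p\in T_p\mathcal{M},\quad \dot f(t_1)=v_q\in T_q\mathcal{M},$$ that $\operatorname{dist}(p,q)<r_{\mathcal{M}}(q)$, where $r_{\mathcal{M}}(q)$ is the injectivity radius of $\mathcal{M}$ at $q$, and that $p$ and $q$ are not conjugate along the geodesic $t\mapsto \operatorname{Exp}_q^{\mathcal{M}}(t\operatorname{Log}_q^{\mathcal{M}}(p))$ that connects $p$ and $q$. Set $\Delta_p=\operatorname{Log}_q^{\mathcal{M}}(p)\in T_q\mathcal{M}$ and $$\hat v_p = d(\operatorname{Log}_q^{\mathcal{M}})_p(v_p)\in T_q\mathcal{M},\qquad \hat v_q=v_q\in T_q\mathcal{M}.$$ Then, with the cubic Hermite coefficient functions $a_0,b_0,b_1$ on $[t_0,t_1]$ (defined in the context), $$c:[t_0,t_1]\to\mathcal{M},\qquad t\mapsto \operatorname{Exp}_q^{\mathcal{M}}\bigl(a_0(t)\Delta_p+b_0(t)\hat v_p+b_1(t)\hat v_q\bigr)$$ is a differentiable curve that solves the Hermite interpolation problem, i.e. $c$ is of class $C^1$ and $$c(t_0)=p,\quad \dot c(t_0)=v_p,\quad c(t_1)=q,\quad \dot c(t_1)=v_q.$$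
   Context: For a Riemannian manifold $\mathcal{M}$, $c_{q,v}$ denotes the geodesic starting at $q$ with velocity $v\in T_q\mathcal{M}$, and $\operatorname{Exp}_q^{\mathcal{M}}(v)=c_{q,v}(1)$ is the Riemannian exponential at $q$. It maps the open ball of radius $r_{\mathcal{M}}(q)$ (the injectivity radius at $q$) around $0\in T_q\mathcal{M}$ diffeomorphically onto a domain in $\mathcal{M}$ around $q$; the Riemannian logarithm $\operatorname{Log}_q^{\mathcal{M}}$ is the inverse of this diffeomorphism. $d(\operatorname{Log}_q^{\mathcal{M}})_p:T_p\mathcal{M}\to T_{\operatorname{Log}_q^{\mathcal{M}}(p)}(T_q\mathcal{M})\cong T_q\mathcal{M}$ is its differential at $p$, with the usual identification of a vector space with its tangent spaces. $\operatorname{dist}$ is the Riemannian distance. The cubic Hermite coefficient functions are $$a_0(t)=1-\frac{(t-t_0)^2}{(t_1-t_0)^2}+\frac{2(t-t_0)^2(t-t_1)}{(t_1-t_0)^3},$$ $$b_0(t)=(t-t_0)-\frac{(t-t_0)^2}{t_1-t_0}+\frac{(t-t_0)^2(t-t_1)}{(t_1-t_0)^2},\qquad b_1(t)=\frac{(t-t_0)^2(t-t_1)}{(t_1-t_0)^2}.$$ Equivalently, they are the unique polynomials of degree at most three with $a_0(t_0)=1$, $a_0'(t_0)=a_0(t_1)=a_0'(t_1)=0$; $b_0'(t_0)=1$, $b_0(t_0)=b_0(t_1)=b_0'(t_1)=0$; $b_1'(t_1)=1$, $b_1(t_0)=b_1'(t_0)=b_1(t_1)=0$.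
   Formalization: As completeness of M is not assumed, Exp_q may be undefined at the argument in the formula for c (e.g. M=(-1,1), q=0, p=1/2, large v_p); the formal statement assumes that this argument lies in the domain of Exp_q for every t in [t_0,t_1], which is automatic when M is complete. *)

(* Defs.v *)
From HB Require Import structures.
From mathcomp Require Import all_boot all_order all_algebra.
From mathcomp Require Import all_classical all_reals all_analysis.

Set Implicit Arguments.
Unset Strict Implicit.
Unset Printing Implicit Defensive.

Import Order.TTheory GRing.Theory Num.Theory.
Import numFieldNormedType.Exports.

Local Open Scope classical_set_scope.
Local Open Scope ring_scope.

Fixpoint Ck_on (R : realType) (V W : normedModType R) (k : nat) (U : set V)
    (f : V -> W) : Prop :=
  if k is k'.+1 then
    (forall x, U x -> differentiable f x) /\
    (forall v : V, Ck_on k' U (fun x => 'D_v f x))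
  else forall x, U x -> {for x, continuous f}.

Definition smooth_on (R : realType) (V W : normedModType R) (U : set V)
    (f : V -> W) : Prop :=
  open U /\ forall k, Ck_on k U f.

(* The derivative of [x] at [t] relative to [D]: one-sided at the endpoints when
   [D] is a closed interval. *)
Definition has_deriv (R : realType) (V : normedModType R) (D : set R)
    (x : R -> V) (t : R) (v : V) : Prop :=
  (fun s => (s - t)^-1 *: (x s - x t)) @ within D t^' --> v.

(* A smooth manifold without boundary, given by a (not necessarily maximal)
   smooth atlas [phi], with inverse charts [psi]; [psi a] is relevant only on
   the open set [phi a @` dom a].  [chart_at x] is a preferred chart around
   [x]. *)
Record smoothManifold (R : realType) (n : nat) := SmoothManifold {
  carrier :> topologicalType;
  chart_index : Type;
  dom : chart_index -> set carrier;
  phi : chart_index -> carrier -> 'rV[R]_n;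
  psi : chart_index -> 'rV[R]_n -> carrier;
  chart_at : carrier -> chart_index;
  manifold_hausdorff : hausdorff_space carrier;
  manifold_second_countable : @second_countable carrier;
  chart_at_dom : forall x, dom (chart_at x) x;
  dom_open : forall a, open (dom a);
  phi_open : forall a, open (phi a @` dom a);
  phiK : forall a x, dom a x -> psi a (phi a x) = x;
  phi_continuous : forall a x, dom a x -> {for x, continuous (phi a)};
  psi_continuous :
    forall a y, (phi a @` dom a) y -> {for y, continuous (psi a)};
  transition_smooth : forall a b,
    smooth_on (phi a @` (dom a `&` dom b)) (phi b \o psi a) }.

Arguments chart_index {R n} _.

(* T_x M, a tangent vector being represented by its components in the preferred
   chart at x. *)
Definition tangent (R : realType) (n : nat) (M : smoothManifold R n) (x : M) :
  normedModType R := 'rV[R]_n.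

Section Manifold.
Context (R : realType) (n : nat) (M : smoothManifold R n).
Implicit Types (x : M) (a b : chart_index M) (gam : R -> M) (D : set R).

Definition transition a b : 'rV[R]_n -> 'rV[R]_n := phi b \o psi a.

Definition components a x (v : tangent x) : 'rV[R]_n :=
  'd (transition (chart_at x) a) (phi (chart_at x) x) v.

Definition has_velocity D gam (t : R) (v : tangent (gam t)) : Prop :=
  gam @ within D (nbhs t) --> gam t /\
  has_deriv D (phi (chart_at (gam t)) \o gam) t v.

Definition curve_differentiable D gam : Prop :=
  forall t, D t -> exists v, @has_velocity D gam t v.

Definition curve_C1 D gam : Prop :=
  (forall t, D t -> gam @ within D (nbhs t) --> gam t) /\
  forall a, exists dx : R -> 'rV[R]_n, forall t, D t -> dom a (gam t) ->
    has_deriv D (phi a \o gam) t (dx t) /\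
    dx @ within (D `&` gam @^-1` dom a) (nbhs t) --> dx t.

Definition smooth_to (V : normedModType R) (U : set V) (F : V -> M) : Prop :=
  [/\ open U, forall y, U y -> {for y, continuous F} &
      forall a, smooth_on (U `&` F @^-1` dom a) (phi a \o F)].

Definition smooth_from (V : normedModType R) (W : set M) (L : M -> V) : Prop :=
  open W /\ forall a, smooth_on (phi a @` (W `&` dom a)) (L \o psi a).

Definition diffeo_on (V : normedModType R) (U : set V) (F : V -> M) : Prop :=
  smooth_to U F /\
  exists L : M -> V, smooth_from (F @` U) L /\ forall y, U y -> L (F y) = y.

(* The differential at [x] of a vector-valued function on M. *)
Definition mdiff (V : normedModType R) (L : M -> V) x (v : tangent x) : V :=
  'd (L \o psi (chart_at x)) (phi (chart_at x) x) v.

End Manifold.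

Arguments has_velocity {R n M} D gam t v.
Arguments mdiff {R n M V} L x v.

(* [gmx a y] is the Gram matrix of the metric at [psi a y] in the coordinate
   frame of the chart [a]. *)
Record riemannianMetric (R : realType) (n : nat) (M : smoothManifold R n) :=
  RiemannianMetric {
  gmx : chart_index M -> 'rV[R]_n -> 'M[R]_n;
  gmx_smooth : forall a, smooth_on (phi a @` dom a) (gmx a);
  gmx_sym : forall a y, (phi a @` dom a) y -> (gmx a y)^T = gmx a y;
  gmx_posdef : forall a y, (phi a @` dom a) y ->
    forall v : 'rV[R]_n, v != 0 -> 0 < (v *m gmx a y *m v^T) 0 0;
  gmx_compat : forall a b x, dom a x -> dom b x -> forall u v : 'rV[R]_n,
    let T := 'd (transition a b) (phi a x) in
    u *m gmx a (phi a x) *m v^T =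
    T u *m gmx b (phi b x) *m (T v)^T }.

Section Riemannian.
Context (R : realType) (n : nat) (M : smoothManifold R n)
  (g : riemannianMetric M).
Implicit Types (a : chart_index M) (y u v w : 'rV[R]_n) (gam : R -> M)
  (D : set R).

Definition gnorm (x : M) (v : tangent x) : R :=
  Num.sqrt ((v *m gmx g (chart_at x) (phi (chart_at x) x) *m v^T) 0 0).

(* The C^1 curves on compact intervals, closed under concatenation: [joined p q l]
   means that a piecewise C^1 curve of length [l] goes from p to q. *)
Inductive joined : M -> M -> R -> Prop :=
| joined_C1 (s t : R) gam (V : forall r, tangent (gam r)) :
    s < t -> curve_C1 `[s, t] gam ->
    (forall r, s <= r <= t -> has_velocity `[s, t] gam r (V r)) ->
    joined (gam s) (gam t)
      (\int[lebesgue_measure]_(r in `[s, t]) gnorm (V r))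
| joined_cat p q r l1 l2 :
    joined p q l1 -> joined q r l2 -> joined p r (l1 + l2).

(* +oo when p and q lie in different components. *)
Definition dist (p q : M) : \bar R :=
  ereal_inf [set l%:E | l in [set l | joined p q l]].

(* Gamma^k_ij u^i v^j in the chart [a], that is, the solution w of
   g(w, e_l) = (1/2) (D_u g(v, e_l) + D_v g(u, e_l) - D_(e_l) g(u, v)). *)
Definition christoffel a y u v : 'rV[R]_n :=
  (\row_(l < n) (2^-1 *
     ((v *m 'D_u (gmx g a) y) 0 l + (u *m 'D_v (gmx g a) y) 0 l
      - (u *m 'D_(delta_mx 0 l) (gmx g a) y *m v^T) 0 0)))
  *m invmx (gmx g a y).

(* The covariant derivative along [gam] of the field with components [X] in the
   chart [a]. *)
Definition covD a gam (X : R -> 'rV[R]_n) (t : R) : 'rV[R]_n :=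
  derive1 X t + christoffel a (phi a (gam t)) (derive1 (phi a \o gam) t) (X t).

(* R(u, v) w, with R(X, Y) Z = nabla_X nabla_Y Z - nabla_Y nabla_X Z
   - nabla_[X, Y] Z applied to the constant fields u, v, w of the chart [a]. *)
Definition curvature a y u v w : 'rV[R]_n :=
  'D_u (fun z => christoffel a z v w) y - 'D_v (fun z => christoffel a z u w) y
  + christoffel a y u (christoffel a y v w)
  - christoffel a y v (christoffel a y u w).

(* [D] is meant to be open. *)
Definition is_geodesic D gam : Prop :=
  forall t, D t -> {for t, continuous gam} /\
  forall a, dom a (gam t) ->
    let x := phi a \o gam in
    [/\ derivable x t 1, derivable (derive1 x) t 1 & covD a gam (derive1 x) t = 0].

Definition is_jacobi D gam (J : forall t, tangent (gam t)) : Prop :=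
  forall t, D t -> forall a, dom a (gam t) ->
    let x := phi a \o gam in
    let X := fun s => components a (J s) in
    [/\ derivable X t 1, derivable (covD a gam X) t 1 &
        covD a gam (covD a gam X) t
        + curvature a (x t) (X t) (derive1 x t) (derive1 x t) = 0].

(* gam(s) and gam(t) are conjugate along gam. *)
Definition conjugate_along gam (s t : R) : Prop :=
  exists (e : R) (J : forall r, tangent (gam r)),
    [/\ 0 < e, is_jacobi `]s - e, t + e[ J, J s = 0, J t = 0 &
        exists2 r, s <= r <= t & J r != 0].

Definition exp_rel (q : M) (v : tangent q) (y : M) : Prop :=
  exists (gam : R -> M) (e : R),
    [/\ 0 < e, is_geodesic `]- e, 1 + e[ gam, gam 0 = q,
        has_velocity `]- e, 1 + e[ gam 0 v & gam 1 = y].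

(* The geodesic c_(q,v) is defined up to time 1. *)
Definition exp_dom (q : M) (v : tangent q) : Prop := exists y : M, exp_rel v y.

Definition Exp (q : M) (v : tangent q) : M := xget q [set y : M | exp_rel v y].

Definition inj_radius (q : M) : \bar R :=
  ereal_sup [set r%:E | r in [set r : R |
    let B := [set v : tangent q | gnorm v < r] in
    [/\ 0 < r, B `<=` @exp_dom q & diffeo_on B (@Exp q)]]].

Definition Log (q p : M) : tangent q :=
  xget 0 [set v : tangent q | ((gnorm v)%:E < inj_radius q)%E /\ Exp v = p].

End Riemannian.

Arguments Exp {R n M} g q v.
Arguments exp_dom {R n M} g q v.

Section Hermite.
Context (R : realType) (t0 t1 : R).

Definition hermite_a0 (t : R) : R :=
  1 - (t - t0) ^+ 2 / (t1 - t0) ^+ 2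
  + 2 * (t - t0) ^+ 2 * (t - t1) / (t1 - t0) ^+ 3.

Definition hermite_b0 (t : R) : R :=
  (t - t0) - (t - t0) ^+ 2 / (t1 - t0)
  + (t - t0) ^+ 2 * (t - t1) / (t1 - t0) ^+ 2.

Definition hermite_b1 (t : R) : R :=
  (t - t0) ^+ 2 * (t - t1) / (t1 - t0) ^+ 2.

End Hermite.

(* Main.v *)
Require Import Defs.
From HB Require Import structures.
From mathcomp Require Import all_boot all_order all_algebra.
From mathcomp Require Import all_classical all_reals all_analysis.
From mathcomp Require Import ring lra.

Set Implicit Arguments.
Unset Strict Implicit.
Unset Printing Implicit Defensive.
Import Order.TTheory GRing.Theory Num.Theory.
Import numFieldNormedType.Exports.
Local Open Scope classical_set_scope.
Local Open Scope ring_scope.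

(** The curve [c] is the image under [Exp_q] of a polynomial curve [h] in the
    tangent space with [h t0 = Log_q p], [h' t0 = d(Log_q)_p (v_p)], [h t1 = 0] and
    [h' t1 = v_q].  The boundary conditions follow from the chain rule, since
    [d(Exp_q)] at [Log_q p] is inverse to [d(Log_q)_p] ([diff_Exp_Log]) and
    [d(Exp_q)] at [0] is the identity ([diff_Exp0]).  Two points need work.

    First, [c] is of class C^1 although [h] may leave the ball on which [Exp_q] is
    a diffeomorphism: it is only known that the exponential is defined along [h].
    The end point of a geodesic is shown to depend in a strictly differentiable
    way on its initial velocity.  For a differential equation [z' = F z] with a
    strictly differentiable field, the difference quotients of a family of
    solutions satisfy the linearized equation up to small errors, and Gronwall's
    inequality shows that they stay Cauchy ([flow_quotient]).  Geodesics are integral curves of such a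
    field in each chart, and continuous induction carries the Cauchy property from
    time 0 to time 1 across charts ([strict_propagates]).  Difference quotients
    that converge over pairs of points tending to the same point give a continuous
    derivative ([Exp_curve_C1]).  The same statement for constant families gives
    the uniqueness of geodesics, hence [Exp_q (t v)] runs along the geodesic with
    initial velocity [v] ([exp_geodesic]).

    Second, [Log_q p] is a genuine preimage of [p]: a point at distance less than
    [r] from [q] lies in the image of the normal ball of radius [r]
    ([joined_in_ball]).  By Gauss's lemma ([gauss_pullback]), obtained by
    differentiating the metric along the rays of the exponential map, the radial
    coordinate of a curve in the normal ball changes at most as fast as its length
    ([radial_CS], [lift_bound]); a curve of length less than [r] that ends at [q]
    therefore stays in the image of a smaller closed ball, which is compact, and
    cannot leave the normal ball ([curve_in_ball]). *)

(** * Continuous induction and differential inequalities *)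

(** Continuous induction on a segment.  It replaces every compactness or
    first-exit-time argument below: a property is carried from [a] to [b] as
    soon as it extends a little to the right and survives increasing limits. *)
Lemma real_induction (R : realType) (a b : R) (A : R -> Prop) :
  A a ->
  (forall t, a <= t < b -> A t ->
     exists2 d, 0 < d & forall s, t < s < t + d -> s <= b -> A s) ->
  (forall t, a < t <= b -> (forall s, a <= s < t -> A s) -> A t) ->
  forall t, a <= t <= b -> A t.
Proof.
move=> Aa Aopen Aclosed t0 /andP[at0 t0b].
pose S := [set t | a <= t <= b /\ forall s, a <= s <= t -> A s].
have ab := le_trans at0 t0b.
have Sa : S a.
  split; first by rewrite lexx.
  by move=> s /andP[as_ sa]; rewrite (_ : s = a) //; apply/le_anti/andP.
have supS : has_sup S.
  by split; [exists a|exists b => t [/andP[]]].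
set m := sup S.
have am : a <= m by apply: ub_le_sup => //; case: supS.
have mb : m <= b by apply: ge_sup; [exists a|move=> t [/andP[]]].
have below s : a <= s < m -> A s.
  move=> /andP[as_ sm].
  have [t [_ At] st] := sup_adherent (ltac:(by rewrite subr_gt0) : 0 < m - s) supS.
  rewrite opprB addrC subrK in st.
  by apply: At; rewrite as_ ltW.
have Am : A m.
  move: am; rewrite le_eqVlt => /predU1P[<- //|am].
  by apply: Aclosed => //; rewrite am.
have Am' s : a <= s <= m -> A s.
  move=> /andP[as_]; rewrite le_eqVlt => /predU1P[->//|sm].
  by apply: below; rewrite as_.
move: mb; rewrite le_eqVlt => /predU1P[mb|mb].
  by apply: Am'; rewrite at0 mb.
have [d d0 dA] := Aopen m (ltac:(by rewrite am mb)) Am.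
pose m' := Num.min b (m + d / 2).
have mm' : m < m' by rewrite lt_min mb /= ltrDl divr_gt0.
suff : m' <= m by rewrite leNgt mm'.
apply: ub_le_sup; first by case: supS.
split.
  rewrite (le_trans am (ltW mm'))/=; by rewrite ge_min lexx.
move=> s /andP[as_ sm']; case: (leP s m) => sm; first by apply: Am'; rewrite as_.
apply: dA; last by rewrite (le_trans sm')// ge_min lexx.
rewrite sm/= (le_lt_trans sm')// gt_min; apply/orP; right.
by rewrite ltrD2l; lra.
Qed.

Section growth.
Context (R : realType) (V : normedModType R).
Implicit Types (d : R -> V) (m : R -> R).

Lemma is_derive_near d (t : R) (v : V) : is_derive t (1 : R) d v -> forall e, 0 < e ->
  \forall s \near t, `|d s - d t - (s - t) *: v| <= e * `|s - t|.
Proof.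
move=> [dd dv] e e0.
have /cvgrPdist_le/(_ e e0) := dd; rewrite -/(derive d t 1) dv => H.
rewrite (near_shift 0); rewrite subr0.
move: H; rewrite near_withinE; apply: filterS => h hd /=.
have [->|h0] := eqVneq h 0.
  by rewrite /= add0r !subrr scale0r subrr !normr0 mulr0.
have {}hd := hd h0.
rewrite /= addrK.
have -> : d (h + t) - d t - h *: v
    = h *: (h^-1 *: (d (h *: (1 : R) + t) - d t) - v).
  by rewrite scalerBr scalerA mulfV// scale1r [h *: (1 : R)]mulr1.
by rewrite normrZ mulrC ler_pM2r ?normr_gt0// distrC.
Qed.

End growth.

Lemma is_derive_affine (R : realType) (c K a t : R) :
  is_derive t (1 : R) (fun t => c * (1 + K * (t - a))) (c * K).
Proof.
by apply: is_derive_eq; rewrite /GRing.scale/= subr0 add0r mulr1 mul1r.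
Qed.

Section comparison.
Context (R : realType) (V : normedModType R).
Implicit Types (d : R -> V) (m : R -> R).

(** A vector-valued function whose speed is smaller than that of a scalar
    majorant, wherever it is below that majorant, never crosses it.  No
    differentiability of the norm is involved: only the first order expansions
    of [d] and [m] to the right of a point are compared. *)
Lemma norm_le_growth d (d' : R -> V) m m' (a b : R) :
  (forall t, a <= t <= b -> is_derive t (1 : R) d (d' t)) ->
  (forall t, a <= t <= b -> is_derive t (1 : R) m (m' t)) ->
  `|d a| <= m a ->
  (forall t, a <= t < b -> `|d t| <= m t -> `|d' t| < m' t) ->
  forall t, a <= t <= b -> `|d t| <= m t.
Proof.
move=> dd dm da dlt; apply: real_induction => // t /andP[at_ tb].
  move=> dmt.
  have tab : a <= t <= b by rewrite at_ ltW.
  have lt := dlt t (ltac:(by rewrite at_)) dmt.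
  pose e := (m' t - `|d' t|) / 2.
  have e0 : 0 < e by rewrite /e divr_gt0// subr_gt0.
  have H1 := is_derive_near (dd t tab) e0.
  have H2 := is_derive_near (dm t tab) e0.
  have [r /= r0 Hr] := (nbhs_ballP _ _).1 (filterI H1 H2).
  exists r => // s /andP[ts str] _.
  have [/=] := Hr s (ltac:(by rewrite /ball/= distrC gtr0_norm ?subr_gt0// ltrBlDl)).
  have st0 : 0 < s - t by rewrite subr_gt0.
  rewrite !(gtr0_norm st0) => h1 h2.
  have h3 : `|d s| <= `|d t| + (s - t) * `|d' t| + e * (s - t).
    rewrite (_ : d s = d t + (s - t) *: d' t + (d s - d t - (s - t) *: d' t)); last first.
      by rewrite addrC -[_ - _ - _]addrA -opprD subrK.
    apply: le_trans (ler_normD _ _) _; apply: lerD => //.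
    apply: le_trans (ler_normD _ _) _; apply: lerD => //.
    by rewrite normrZ gtr0_norm.
  have h4 : m t + (s - t) * m' t - e * (s - t) <= m s.
    by have := h2; rewrite ler_norml => /andP[+ _]; rewrite -[_ *: _]/(_ * _); lra.
  have : (s - t) * `|d' t| + e * (s - t) = (s - t) * m' t - e * (s - t).
    by rewrite /e; field.
  lra.
move=> H.
have tab : a <= t <= b by rewrite ltW.
apply/ler_addgt0Pr => e e0; rewrite -(@subr_ge0 _ _ _) .
have cd : {for t, continuous d}.
  by apply/differentiable_continuous/derivable1_diffP; case: (dd t tab).
have cm : {for t, continuous m}.
  by apply/differentiable_continuous/derivable1_diffP; case: (dm t tab).
have e2 : 0 < e / 2 by rewrite divr_gt0.
move/cvgrPdist_lt : cd => /(_ _ e2) Hd.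
move/cvgrPdist_lt : cm => /(_ _ e2) Hm.
have [r /= r0 Hr] := (nbhs_ballP _ _).1 (filterI Hd Hm).
pose s := Num.max a (t - r / 2).
have st : s < t by rewrite gt_max at_/= ltrBlDr ltrDl divr_gt0.
have sr : t - r / 2 <= s by rewrite /s le_max lexx orbT.
have as' : a <= s by rewrite /s le_max lexx.
move: s st sr as' => s st sr as'.
have [/= h1 h2] := Hr s (ltac:(rewrite /ball/= gtr0_norm ?subr_gt0//; lra)).
have h3 := H s (ltac:(by rewrite st as')).
have : `|d t| <= `|d s| + `|d t - d s|.
  by rewrite -{1}(subrK (d s) (d t)) addrC ler_normD.
move: h2; rewrite ltr_norml => /andP[+ _]; lra.
Qed.

Lemma mean_value_norm d (d' : R -> V) (a b k : R) : a <= b ->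
  (forall t, a <= t <= b -> is_derive t (1 : R) d (d' t)) ->
  (forall t, a <= t <= b -> `|d' t| <= k) ->
  `|d b - d a| <= k * (b - a).
Proof.
move=> ab dd dk; apply/ler_addgt0Pr => e e0.
have [->|ab'] := eqVneq a b; first by rewrite !subrr normr0 mulr0 add0r ltW.
have {ab'}ab' : 0 < b - a by rewrite subr_gt0 lt_neqAle ab'.
pose K := k + e / (b - a).
have -> : k * (b - a) + e = K * (b - a) by rewrite /K mulrDl divfK// gt_eqF.
pose m := fun t => K * (t - a).
apply: (@norm_le_growth (fun t => d t - d a) d' m (fun _ => K) a b) => //.
- move=> t tab; rewrite -[d' t]subr0; have := dd t tab => H; exact: is_deriveB.
- move=> t _; by apply: is_derive_eq; rewrite /GRing.scale/= subr0 mulr1.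
- by rewrite /m !subrr normr0 mulr0.
- move=> t /andP[at_ tb] _; apply: le_lt_trans (dk t _) _; first by rewrite at_ ltW.
  by rewrite ltrDl divr_gt0.
- by rewrite ab lexx.
Qed.

(** Gronwall's inequality on a segment so short that an affine majorant can
    play the role of the exponential. *)
Lemma short_gronwall d (d' : R -> V) (a b L eta : R) : 0 <= L -> 0 <= eta ->
  2 * (L + 1) * (b - a) <= 1 ->
  (forall t, a <= t <= b -> is_derive t (1 : R) d (d' t)) ->
  (forall t, a <= t <= b -> `|d' t| <= L * `|d t| + eta) ->
  forall t, a <= t <= b -> `|d t| <= 2 * (`|d a| + eta).
Proof.
move=> L0 eta0 sh dd dL t tab; apply/ler_addgt0Pr => e e0.
pose c := `|d a| + eta + e / 2.
have c0 : 0 < c by rewrite /c ltr_wpDl ?divr_gt0// addr_ge0.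
have -> : 2 * (`|d a| + eta) + e = 2 * c by rewrite /c; field.
pose K := 2 * (L + 1).
have K0 : 0 < K by rewrite /K mulr_gt0// ltr_wpDl.
(* On [a, b] this majorant stays below 2 c, so its slope c K exceeds L m + eta. *)
pose m := fun t => c * (1 + K * (t - a)).
have Kt s : a <= s <= b -> K * (s - a) <= 1.
  move=> /andP[_ sb]; apply: le_trans sh; rewrite ler_pM2l//; lra.
apply: (@le_trans _ _ (m t)).
  apply: (@norm_le_growth d d' m (fun _ => c * K) a b) => //.
  - move=> s _; exact: is_derive_affine.
  - rewrite /m subrr mulr0 addr0 mulr1 /c; lra.
  - move=> s /andP[as_ sb] ms.
    have sab : a <= s <= b by rewrite as_ ltW.
    apply: le_lt_trans (dL s sab) _.
    have h1 : L * `|d s| <= L * m s by rewrite ler_wpM2l.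
    have h2 : m s <= 2 * c by rewrite /m; have := Kt s sab; nra.
    have h3 : L * m s <= L * (2 * c) by rewrite ler_wpM2l.
    have : eta <= c by rewrite /c; have := normr_ge0 (d a); lra.
    have -> : c * K = L * (2 * c) + 2 * c by rewrite /K; ring.
    lra.
rewrite /m; have := Kt t tab; nra.
Qed.

End comparison.

(** * Strict differentiability *)

(** Strict differentiability, with a raw function as derivative: the calculus
    rules below produce derivatives by formulas, and linearity and boundedness
    are then checked afterwards. *)
Definition is_sdiff (R : realType) (V W : normedModType R) (f : V -> W)
    (x : V) (A : V -> W) : Prop :=
  [/\ linear A, (exists2 C, 0 <= C & forall u, `|A u| <= C * `|u|) &
   forall e, 0 < e -> \forall p \near (x, x),
     `|f p.1 - f p.2 - A (p.1 - p.2)| <= e * `|p.1 - p.2|].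

Definition sdiff (R : realType) (V W : normedModType R) (f : V -> W) (x : V) :=
  exists A, is_sdiff f x A.

Lemma near_diagP (R : realType) (V : normedModType R) (x : V)
    (P : V * V -> Prop) :
  (\forall p \near (x, x), P p) <->
  exists2 r : R, 0 < r &
    forall z z', `|x - z| < r -> `|x - z'| < r -> P (z, z').
Proof.
split.
  move=> /nbhs_ballP[r /= r0 H]; exists r => // z z' xz xz'.
  by apply: H; split => /=; rewrite -ball_normE.
case=> r r0 H; apply/nbhs_ballP; exists r => // -[z z'] [/=].
by rewrite -ball_normE; exact: H.
Qed.

Lemma near_diag (R : realType) (V : normedModType R) (x : V) (P : V -> Prop) :
  (\forall y \near x, P y) -> \forall p \near (x, x), P p.1 /\ P p.2.
Proof.
move=> /nbhs_ballP[r /= r0 H]; apply/near_diagP; exists r => // z z' h h'.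
by split; apply: H; rewrite -ball_normE.
Qed.

Section linear_pred.
Context (R : realType) (V W : normedModType R) (A : V -> W).
Hypothesis linA : linear A.

Lemma linpredD u v : A (u + v) = A u + A v.
Proof. by have := linA 1 u v; rewrite !scale1r. Qed.

Lemma linpred0 : A 0 = 0.
Proof. by apply: (@addrI _ (A 0)); rewrite -linpredD !addr0. Qed.

Lemma linpredZ k u : A (k *: u) = k *: A u.
Proof. by have := linA k u 0; rewrite linpred0 !addr0. Qed.

Lemma linpredB u v : A (u - v) = A u - A v.
Proof. by rewrite -scaleN1r linpredD linpredZ scaleN1r. Qed.

End linear_pred.

Section sdiff_theory.
Context (R : realType).
Implicit Types (V W U : normedModType R).

Lemma is_sdiff_lip V W (f : V -> W) x A : is_sdiff f x A ->
  exists2 L, 0 < L & \forall p \near (x, x), `|f p.1 - f p.2| <= L * `|p.1 - p.2|.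
Proof.
move=> [linA [C C0 AC] H]; exists (C + 1); first by rewrite ltr_wpDl.
apply: filterS (H 1 ltr01) => p hp.
rewrite -(subrK (A (p.1 - p.2)) (f p.1 - f p.2)) addrC mulrDl.
by apply: le_trans (ler_normD _ _) _; exact: lerD.
Qed.

Lemma sdiff_continuous V W (f : V -> W) x : sdiff f x -> {for x, continuous f}.
Proof.
move=> [A /is_sdiff_lip[L L0 /near_diagP[r r0 H]]].
apply/cvgrPdist_lt => e e0.
have rL : 0 < Num.min r (e / L) by rewrite lt_min r0 divr_gt0.
near=> y.
have xy : `|x - y| < Num.min r (e / L) by near: y; apply: cvgr_dist_lt => //; exact: cvg_id.
have [xr xe] : `|x - y| < r /\ `|x - y| < e / L.
  by move: xy; rewrite lt_min => /andP.
apply: le_lt_trans (H x y (ltac:(by rewrite subrr normr0)) xr) _.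
by rewrite mulrC -ltr_pdivlMr.
Unshelve. all: by end_near. Qed.

Lemma sdiff_near V W (f g : V -> W) x :
  (\forall y \near x, f y = g y) -> sdiff f x -> sdiff g x.
Proof.
move=> fg [A [linA CA H]]; exists A; split => // e e0.
by apply: filterS2 (near_diag fg) (H e e0) => p [-> ->].
Qed.

(** The chain rule holds with both points moving: this is what makes strict
    differentiability a convenient substitute for continuous
    differentiability. *)
Lemma sdiff_comp V W U (f : V -> W) (g : W -> U) x :
  sdiff f x -> sdiff g (f x) -> sdiff (g \o f) x.
Proof.
move=> sf [B [linB [C C0 BC] gB]]; have cf := sdiff_continuous sf.
case: sf => A fA; have [L L0 fL] := is_sdiff_lip fA.
case: fA => linA [C' C'0 AC'] fA.
exists (B \o A); split.
- by move=> k u v /=; rewrite linA linB.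
- exists (C * C'); first exact: mulr_ge0.
  by move=> u /=; apply: le_trans (BC _) _; rewrite -mulrA ler_wpM2l.
move=> e e0.
have e1 : 0 < e / 2 / L by rewrite !divr_gt0.
have e2 : 0 < e / 2 / (C + 1) by rewrite !divr_gt0// ltr_wpDl.
have /near_diagP[r r0 {}gB] := gB _ e1; have {}fA := fA _ e2.
have nf : \forall y \near x, `|f x - f y| < r by exact: cvgr_dist_lt.
have {}nf := near_diag nf.
near=> p => /=.
have h1 : `|g (f p.1) - g (f p.2) - B (f p.1 - f p.2)| <= e / 2 / L * `|f p.1 - f p.2|.
  have : `|f x - f p.1| < r /\ `|f x - f p.2| < r by near: p.
  by move=> [/gB]; apply.
have h2 : `|f p.1 - f p.2| <= L * `|p.1 - p.2| by near: p.
have h3 : `|f p.1 - f p.2 - A (p.1 - p.2)| <= e / 2 / (C + 1) * `|p.1 - p.2|.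
  by near: p.
have -> : g (f p.1) - g (f p.2) - B (A (p.1 - p.2)) =
  (g (f p.1) - g (f p.2) - B (f p.1 - f p.2)) +
  B (f p.1 - f p.2 - A (p.1 - p.2)) by rewrite (linpredB linB (f p.1 - f p.2) _) addrA subrK.
apply: le_trans (ler_normD _ _) _.
rewrite (splitr e) mulrDl; apply: lerD.
  apply: le_trans h1 _; apply: (@le_trans _ _ (e / 2 / L * (L * `|p.1 - p.2|))).
    by rewrite ler_wpM2l// ltW.
  by rewrite mulrA divfK// gt_eqF.
apply: le_trans (BC _) _; apply: (@le_trans _ _ ((C + 1) * (e / 2 / (C + 1) * `|p.1 - p.2|))).
  by apply: ler_pM => //; rewrite lerDl.
by rewrite mulrA [(C + 1) * _]mulrC divfK// gt_eqF// ltr_wpDl.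
Unshelve. all: by end_near. Qed.

Lemma sdiff_pair V W U (f : V -> W) (g : V -> U) x :
  sdiff f x -> sdiff g x -> sdiff (fun z => (f z, g z)) x.
Proof.
move=> [A [linA [C C0 AC] fA]] [B [linB [C' C'0 BC] gB]].
exists (fun u => (A u, B u)); split.
- by move=> k u v; rewrite linA linB.
- exists (C + C'); first exact: addr_ge0.
  move=> u; rewrite prod_normE/= ge_max mulrDl.
  by rewrite (le_trans (AC u)) ?lerDl ?mulr_ge0// (le_trans (BC u))// lerDr mulr_ge0.
move=> e e0; have {}fA := fA _ e0; have {}gB := gB _ e0; near=> p.
rewrite prod_normE/= ge_max; apply/andP; split; near: p.
Unshelve. all: by end_near.
Qed.

Lemma sdiff_lin V W (A : V -> W) x : linear A ->
  (exists2 C, 0 <= C & forall u, `|A u| <= C * `|u|) -> sdiff A x.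
Proof.
move=> linA CA; exists A; split => // e e0; apply/near_diagP; exists 1 => // z z' _ _.
by rewrite (linpredB linA) subrr normr0 mulr_ge0// ltW.
Qed.

Lemma sdiff_cst V W (c : W) (x : V) : sdiff (fun=> c) x.
Proof.
exists (fun=> 0); split.
- by move=> k u v; rewrite scaler0 addr0.
- by exists 0 => // u; rewrite normr0 mul0r.
- by move=> e e0; apply/near_diagP; exists 1 => // z z' _ _; rewrite !subrr normr0 mulr_ge0// ltW.
Qed.

Lemma sdiff_id V (x : V) : sdiff id x.
Proof. by apply: sdiff_lin => //; exists 1 => // u; rewrite mul1r. Qed.

Lemma sdiff_fst V W (x : V * W) : sdiff fst x.
Proof.
apply: sdiff_lin => //; exists 1 => // u.
by rewrite mul1r prod_normE le_max lexx.
Qed.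

Lemma sdiff_snd V W (x : V * W) : sdiff snd x.
Proof.
apply: sdiff_lin => //; exists 1 => // u.
by rewrite mul1r prod_normE le_max lexx orbT.
Qed.

Lemma sdiffD V W (f g : V -> W) x :
  sdiff f x -> sdiff g x -> sdiff (fun z => f z + g z) x.
Proof.
move=> sf sg.
apply: (sdiff_comp (sdiff_pair sf sg) (g := fun p : W * W => p.1 + p.2)).
apply: sdiff_lin.
  by move=> k u v /=; rewrite scalerDr addrACA.
exists 2 => // u; apply: le_trans (ler_normD _ _) _.
rewrite prod_normE mulr2n mulrDl mul1r; apply: lerD; rewrite le_max lexx ?orbT//.
Qed.

Lemma sdiffZ V W (k : V -> R) (f : V -> W) x :
  sdiff k x -> sdiff f x -> sdiff (fun z => k z *: f z) x.
Proof.
move=> sk sf.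
apply: (sdiff_comp (sdiff_pair sk sf) (g := fun p : R * W => p.1 *: p.2)) => /=.
move: (k x) (f x) => {sk sf}{}k {}f.
exists (fun u : R * W => k *: u.2 + u.1 *: f); split.
- move=> a u v /=; rewrite !scalerDr scalerDl !scalerA [k * a]mulrC addrACA.
  by rewrite -[(a *: u.1)]/(a * u.1).
- exists (`|k| + `|f|); first exact: addr_ge0.
  move=> u; apply: le_trans (ler_normD _ _) _.
  rewrite mulrDl !normrZ [`|u.1| * _]mulrC prod_normE.
  by apply: lerD; rewrite ler_wpM2l// le_max lexx ?orbT.
move=> e e0; apply/near_diagP; exists (e / 2); first by rewrite divr_gt0.
move=> [a b] [a' b']; rewrite !prod_normE/= !gt_max => /andP[h1 h2] /andP[h3 h4].
have -> : a *: b - a' *: b' = a *: (b - b') + (a - a') *: b'.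
  by rewrite scalerBr scalerBl addrA subrK.
rewrite opprD addrACA -scalerBl -scalerBr.
apply: le_trans (ler_normD _ _) _; rewrite !normrZ (splitr e) mulrDl.
apply: lerD; first apply: ler_pM => //.
- by rewrite distrC ltW.
- by rewrite le_max lexx orbT.
rewrite mulrC; apply: ler_pM => //; first by rewrite distrC ltW.
by rewrite le_max lexx.
Qed.

Lemma sdiff_sum V W I (r : seq I) (P : pred I) (f : I -> V -> W) x :
  (forall i, P i -> sdiff (f i) x) -> sdiff (fun z => \sum_(i <- r | P i) f i z) x.
Proof.
move=> H; elim: r => [|i r IH].
  apply: (@sdiff_near _ _ (fun=> 0)); last exact: sdiff_cst.
  by apply: nearW => z; rewrite big_nil.
case Pi : (P i); last first.
  by apply: (sdiff_near _ IH); apply: nearW => z; rewrite big_cons Pi.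
apply: (sdiff_near _ (sdiffD (H i Pi) IH)).
by apply: nearW => z; rewrite big_cons Pi.
Qed.

Lemma sdiffM V (f g : V -> R) x :
  sdiff f x -> sdiff g x -> sdiff (fun z => f z * g z) x.
Proof. exact: sdiffZ. Qed.

Lemma sdiff_prod V I (r : seq I) (f : I -> V -> R) x :
  (forall i, sdiff (f i) x) -> sdiff (fun z => \prod_(i <- r) f i z) x.
Proof.
move=> H; elim: r => [|i r IH].
  apply: (@sdiff_near V R (fun=> 1)); last exact: sdiff_cst.
  by apply: nearW => z; rewrite big_nil.
apply: (@sdiff_near V R (fun z => f i z * \prod_(j <- r) f j z)); last exact: sdiffM.
by apply: nearW => z; rewrite big_cons.
Qed.

Lemma sdiffN V W (f : V -> W) x : sdiff f x -> sdiff (fun z => - f z) x.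
Proof.
move=> sf; apply: (sdiff_near _ (sdiffZ (sdiff_cst (-1 : R) x) sf)).
by apply: nearW => z; rewrite scaleN1r.
Qed.

Lemma sdiff_inv (x : R) : x != 0 -> sdiff (fun z : R => z^-1) x.
Proof.
move=> x0; exists (fun u => - (x^-1 ^+ 2) * u); split.
- by move=> k u v; rewrite /GRing.scale/=; ring.
- by exists (`|x^-1 ^+ 2|) => // u; rewrite normrM normrN.
move=> e e0.
have xx : x * x != 0 by rewrite mulf_neq0.
have c1 : (fun p : R * R => x^-1 ^+ 2 - (p.1 * p.2)^-1) @ (x, x) --> 0.
  rewrite -[X in _ --> X](subrr (x^-1 ^+ 2)) {3}expr2 -invfM.
  apply: cvgB; first exact: cvg_cst.
  apply: cvgV => //; apply: cvgM; [exact: cvg_fst|exact: cvg_snd].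
have near0 : \forall p \near (x, x), p.1 != 0 /\ p.2 != 0.
  by apply: (@near_diag _ _ _ (fun y => y != 0)); have := @cvgr_neq0 _ _ _ (nbhs x) _ id x; apply => //; exact: cvg_id.
near=> p.
have [p1 p2] : p.1 != 0 /\ p.2 != 0 by near: p.
have -> : p.1^-1 - p.2^-1 - - x^-1 ^+ 2 * (p.1 - p.2)
  = (x^-1 ^+ 2 - (p.1 * p.2)^-1) * (p.1 - p.2) by field; rewrite p1 p2.
rewrite normrM ler_wpM2r//; near: p.
by move/cvgrPdist_le : c1 => /(_ e e0); apply: filterS => p; rewrite sub0r normrN.
Unshelve. all: by end_near. Qed.

Lemma sdiffV V (f : V -> R) x : f x != 0 -> sdiff f x ->
  sdiff (fun z => (f z)^-1) x.
Proof. by move=> f0 sf; apply: (sdiff_comp sf (sdiff_inv f0)). Qed.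

Lemma sdiff_mx V m n (f : V -> 'M[R]_(m, n)) x :
  (forall i j, sdiff (fun z => f z i j) x) -> sdiff f x.
Proof.
move=> H.
rewrite (_ : f = fun z => \sum_i \sum_j f z i j *: delta_mx i j); last first.
  by apply/funext => z; rewrite -matrix_sum_delta.
by apply: sdiff_sum => i _; apply: sdiff_sum => j _; apply: sdiffZ => //; exact: sdiff_cst.
Qed.

Lemma sdiff_coord V m n (f : V -> 'M[R]_(m, n)) x i j :
  sdiff f x -> sdiff (fun z => f z i j) x.
Proof.
move=> sf; apply: (sdiff_comp sf (g := fun M : 'M[R]_(m, n) => M i j)).
apply: sdiff_lin; first by move=> k u v; rewrite !mxE.
exists 1 => // u; rewrite mul1r [leRHS]/Num.Def.normr/= mx_normrE.
exact: (le_bigmax _ _ (i, j)).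
Qed.

Lemma sdiff_mulmx V m n p (f : V -> 'M[R]_(m, n)) (g : V -> 'M[R]_(n, p)) x :
  sdiff f x -> sdiff g x -> sdiff (fun z => f z *m g z) x.
Proof.
move=> sf sg; apply: sdiff_mx => i j.
under eq_fun do rewrite mxE.
by apply: sdiff_sum => k _; apply: sdiffM; exact: sdiff_coord.
Qed.

Lemma sdiff_det V n (f : V -> 'M[R]_n) x :
  sdiff f x -> sdiff (fun z => \det (f z)) x.
Proof.
move=> sf; apply: sdiff_sum => s _; apply: sdiffM; first exact: sdiff_cst.
by apply: sdiff_prod => i; exact: sdiff_coord.
Qed.

(** Near an invertible matrix the inverse is the adjugate divided by the
    determinant, and these are polynomial in the entries. *)
Lemma sdiff_invmx V n (f : V -> 'M[R]_n) x :
  f x \in unitmx -> sdiff f x -> sdiff (fun z => invmx (f z)) x.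
Proof.
move=> ux sf; have sdet := sdiff_det sf.
have dx : \det (f x) != 0 by rewrite -unitfE -unitmxE.
apply: (@sdiff_near _ _ (fun z => (\det (f z))^-1 *: \adj (f z))).
  have := sdiff_continuous sdet; move/cvgr_neq0 => /(_ dx).
  by apply: filterS => z dz; rewrite /invmx unitmxE unitfE dz.
apply: sdiffZ; first exact: sdiffV.
apply: sdiff_mx => i j; under eq_fun do rewrite mxE.
apply: sdiffM; first exact: sdiff_cst.
apply: sdiff_det; apply: sdiff_mx => k l; under eq_fun do rewrite !mxE.
exact: sdiff_coord.
Qed.

Lemma is_derive_line V W (f : V -> W) y v (t : R) :
  derivable f (y + t *: v) v ->
  is_derive t (1 : R) (fun s => f (y + s *: v)) ('D_v f (y + t *: v)).
Proof.
have E : (fun h : R => h^-1 *: (f (y + (h *: (1 : R) + t) *: v) - f (y + t *: v)))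
  = (fun h => h^-1 *: (f (h *: v + (y + t *: v)) - f (y + t *: v))).
  apply/funext => h; congr (_ *: (f _ - _)).
  by rewrite scalerDl [h *: (1 : R)]mulr1 addrCA.
by move=> df; split; rewrite /derivable /derive /= E.
Qed.

Lemma is_derive_scalel W (c : W) (t : R) :
  is_derive t (1 : R) (fun s : R => s *: c) c.
Proof.
have H : is_diff t ( *:%R ^~ c) ( *:%R ^~ c) by exact: is_diff_scalel.
split; first by apply: diff_derivable; exact: ex_diff.
by rewrite deriveE ?diff_val ?scale1r//; exact: ex_diff.
Qed.

(** Mean value inequality along the segment from [z'] to [z], applied to [f]
    minus its differential at [x].  A finite coordinate system turns the
    continuity of each directional derivative into continuity of the
    differential in operator norm. *)
Lemma sdiff_C1_coord V W (I : finType) (b : I -> V) (c : I -> V -> R)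
    (f : V -> W) (U : set V) x :
  (forall u, u = \sum_j c j u *: b j) -> (forall j u, `|c j u| <= `|u|) ->
  open U -> Ck_on 1 U f -> U x -> sdiff f x.
Proof.
move=> bc cn oU [df cf] Ux.
have linA : linear ('d f x) by move=> k u v; rewrite linearP.
exists ('d f x); split => //.
  have [k k0 H] := linear_lipschitz (diff_continuous (df x Ux)).
  by exists k; [exact: ltW|].
move=> e e0.
have Dsum y u : U y -> 'd f y u = \sum_j c j u *: 'D_(b j) f y.
  move=> Uy; rewrite {1}(bc u) linear_sum; apply: eq_bigr => j _.
  by rewrite linearZ deriveE//; exact: df.
have e' : 0 < e / (#|I|%:R + 1) by rewrite divr_gt0// ltr_wpDl.
have near2 : \forall y \near x, forall j,
    `|'D_(b j) f x - 'D_(b j) f y| <= e / (#|I|%:R + 1).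
  apply: filter_forall => j; move/cvgrPdist_le: (cf (b j) x Ux).
  exact.
have [r /= r0 Hr] := (nbhs_ballP _ _).1
  (filterI (open_nbhs_nbhs (conj oU Ux)) near2).
apply/near_diagP; exists r => // z z' xz xz' /=.
pose w (t : R) := z' + t *: (z - z').
have inb (t : R) : 0 <= t <= 1 -> `|x - w t| < r.
  move=> /andP[t0 t1].
  have -> : x - w t = (1 - t) *: (x - z') + t *: (x - z).
    rewrite !scalerBr addrACA -opprD -scalerDl subrK scale1r; congr (_ - _).
    by rewrite /w scalerBr scalerBl scale1r addrA addrAC.
  apply: le_lt_trans (ler_normD _ _) _; rewrite !normrZ ger0_norm ?subr_ge0//.
  rewrite (ger0_norm t0).
  apply: (@le_lt_trans _ _ (Num.max `|x - z| `|x - z'|)); last by rewrite gt_max xz.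
  have h1 : `|x - z| <= Num.max `|x - z| `|x - z'| by rewrite le_max lexx.
  have h2 : `|x - z'| <= Num.max `|x - z| `|x - z'| by rewrite le_max lexx orbT.
  nra.
pose v := z - z'.
have wU t : 0 <= t <= 1 -> U (w t) /\ forall j,
    `|'D_(b j) f x - 'D_(b j) f (w t)| <= e / (#|I|%:R + 1).
  by move=> /inb wt; apply: Hr; rewrite -ball_normE.
have -> : f z - f z' - 'd f x v
    = (f (w 1) - (1 : R) *: 'd f x v) - (f (w 0) - (0 : R) *: 'd f x v).
  have -> : w 1 = z by rewrite /w scale1r addrC subrK.
  have -> : w 0 = z' by rewrite /w scale0r addr0.
  by rewrite scale1r scale0r subr0 addrAC.
rewrite -[leRHS]mulr1 -[X in _ * X](subr0 (1 : R)).
apply: (@mean_value_norm _ _ (fun t => f (w t) - t *: 'd f x v)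
   (fun t => 'd f (w t) v - 'd f x v)) => //.
  move=> t t01; have [Uw _] := wU t t01.
  have dw : differentiable f (w t) by exact: df.
  have H1 : is_derive t (1 : R) (fun s => f (w s)) ('D_v f (w t)).
    exact: (@is_derive_line _ _ f z' v t (diff_derivable dw)).
  rewrite deriveE// in H1.
  have H2 := is_derive_scalel ('d f x v) t.
  exact: is_deriveB H1 H2.
move=> t t01; have [Uw Hw] := wU t t01.
rewrite !Dsum// -sumrB.
apply: (@le_trans _ _ (\sum_(j : I) (`|v| * (e / (#|I|%:R + 1))))).
  apply: le_trans (ler_norm_sum _ _ _) _; apply: ler_sum => j _.
  rewrite -scalerBr normrZ; apply: ler_pM => //; last by rewrite distrC.
rewrite sumr_const -[leLHS]mulr_natl.
rewrite mulrCA [`|v| * _]mulrC ler_wpM2r// mulrCA ler_piMr//; first exact: ltW.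
by rewrite ler_pdivrMr ?mul1r ?lerDl// ltr_wpDl.
Qed.

Lemma sdiff_C1 n W (f : 'rV[R]_n -> W) (U : set 'rV[R]_n) x :
  open U -> Ck_on 1 U f -> U x -> sdiff f x.
Proof.
apply: (@sdiff_C1_coord _ W 'I_n (delta_mx 0) (fun j u => u 0 j)).
  by move=> u; rewrite {1}(row_sum_delta u).
move=> j u; rewrite [leRHS]/Num.Def.normr/= mx_normrE.
exact: (le_bigmax _ _ (0, j)).
Qed.

End sdiff_theory.

(** * Dependence of solutions of differential equations on parameters *)

(** The two-point quotients [(F y - F y') / h] depend on the quotients
    [(y - y') / h] in a nearly linear way, uniformly in the two pairs of points
    and in the two scalars.  The derivative of [F] at [w] does not occur, which
    allows [w] to move along a trajectory. *)
Definition quot_ineq (R : realType) (V W : normedModType R) (F : V -> W)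
    (L eta : R) (w : V) (rho : R) : Prop :=
  forall y1 y1' y2 y2' h1 h2,
    `|w - y1| < rho -> `|w - y1'| < rho -> `|w - y2| < rho -> `|w - y2'| < rho ->
    `|h1^-1 *: (F y1 - F y1') - h2^-1 *: (F y2 - F y2')|
      <= L * `|h1^-1 *: (y1 - y1') - h2^-1 *: (y2 - y2')|
       + eta * (`|h1^-1 *: (y1 - y1')| + `|h2^-1 *: (y2 - y2')|).

Section quotients.
Context (R : realType) (V W : normedModType R) (F : V -> W).

Lemma quot_ineq_shrink L eta w rho w' rho' :
  `|w - w'| + rho' <= rho -> quot_ineq F L eta w rho ->
  quot_ineq F L eta w' rho'.
Proof.
move=> le H y1 y1' y2 y2' h1 h2 a1 a1' a2 a2'.
have E y : `|w' - y| < rho' -> `|w - y| < rho.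
  move=> wy; apply: lt_le_trans le; rewrite -(subrK w' w) -addrA.
  apply: le_lt_trans (ler_normD _ _) _; rewrite ?subrK; last by rewrite ltrD2l.
by apply: H; exact: E.
Qed.

(** Compare [A u] with the increment of [F] along a small multiple of [u]. *)
Lemma is_sdiff_opnorm w A L r : is_sdiff F w A -> 0 < r ->
  (forall z z', `|w - z| < r -> `|w - z'| < r -> `|F z - F z'| <= L * `|z - z'|) ->
  forall u, `|A u| <= L * `|u|.
Proof.
move=> [linA CA H] r0 lipF u.
have [->|u0] := eqVneq u 0; first by rewrite (linpred0 linA) !normr0 mulr0.
have nu0 : 0 < `|u| by rewrite normr_gt0.
apply/ler_addgt0Pr => e e0.
have /near_diagP[r' r'0 {}H] := H (e / `|u|) (divr_gt0 e0 nu0).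
pose s := Num.min r r'.
have s0 : 0 < s by rewrite lt_min r0.
pose k := s / 2 / `|u|.
have k0 : 0 < k by rewrite !divr_gt0.
have ku : `|k *: u| = s / 2 by rewrite normrZ gtr0_norm// /k divfK// gt_eqF.
have d1 : `|w - (w + k *: u)| < s.
  by rewrite opprD addrA subrr sub0r normrN ku; lra.
have d2 : `|w - w| < s by rewrite subrr normr0.
have [lr lr'] : s <= r /\ s <= r' by rewrite /s !ge_min !lexx orbT.
have h1 := lipF _ _ (lt_le_trans d1 lr) (lt_le_trans d2 lr).
have h2 := H _ _ (lt_le_trans d1 lr') (lt_le_trans d2 lr').
rewrite /= in h2.
have E : w + k *: u - w = k *: u by rewrite addrC addKr.
rewrite E in h1 h2; rewrite (linpredZ linA) in h2.
have h3 : `|k *: A u| <= `|F (w + k *: u) - F w| +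
    `|F (w + k *: u) - F w - k *: A u|.
  rewrite -[X in `|X| <= _](subKr (F (w + k *: u) - F w)).
  exact: ler_normB.
rewrite -(@ler_pM2l _ k)// mulrDr mulrCA.
have nk (X : normedModType R) (v : X) : `|k *: v| = k * `|v|.
  by rewrite normrZ gtr0_norm.
move: h1 h2 h3; rewrite !nk.
have -> : e / `|u| * (k * `|u|) = k * e by field; rewrite gt_eqF.
lra.
Qed.

Lemma sdiff_lipschitz w : sdiff F w -> exists L r, [/\ 0 <= L, 0 < r &
  forall z z', `|w - z| < r -> `|w - z'| < r -> `|F z - F z'| <= L * `|z - z'|].
Proof.
move=> [A /is_sdiff_lip[L L0 /near_diagP[r r0 H]]].
by exists L, r; split => //; exact: ltW.
Qed.

Lemma sdiff_quot_ineq w L r : sdiff F w -> 0 < r ->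
  (forall z z', `|w - z| < r -> `|w - z'| < r -> `|F z - F z'| <= L * `|z - z'|) ->
  forall eta, 0 < eta -> exists2 rho, 0 < rho & quot_ineq F L eta w rho.
Proof.
move=> [A sA] r0 lipF eta eta0.
have An := is_sdiff_opnorm sA r0 lipF.
case: sA => linA _ /(_ eta eta0) /near_diagP[rho rho0 H].
exists rho => // y1 y1' y2 y2' h1 h2 a1 a1' a2 a2'.
set Q1 := h1^-1 *: (y1 - y1'); set Q2 := h2^-1 *: (y2 - y2').
have err y y' h : `|w - y| < rho -> `|w - y'| < rho ->
    `|h^-1 *: (F y - F y') - A (h^-1 *: (y - y'))| <= eta * `|h^-1 *: (y - y')|.
  move=> ay ay'; rewrite (linpredZ linA) -scalerBr !normrZ mulrCA ler_wpM2l//.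
  exact: H.
have -> : h1^-1 *: (F y1 - F y1') - h2^-1 *: (F y2 - F y2') =
    A (Q1 - Q2) + ((h1^-1 *: (F y1 - F y1') - A Q1)
                 - (h2^-1 *: (F y2 - F y2') - A Q2)).
  rewrite (linpredB linA) opprB addrACA.
  by rewrite [A Q1 + _]addrC subrK addKr.
apply: le_trans (ler_normD _ _) _; apply: lerD; first exact: An.
by apply: le_trans (ler_normB _ _) _; rewrite mulrDr; apply: lerD; exact: err.
Qed.

(** Compactness of the segment, by continuous induction on the part of it for
    which a single radius is known. *)
Lemma quot_ineq_uniform (z0 : R -> V) (a b L eta : R) :
  (forall t, a <= t <= b -> {for t, continuous z0}) ->
  (forall t, a <= t <= b -> exists2 rho, 0 < rho & quot_ineq F L eta (z0 t) rho) ->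
  exists2 rho, 0 < rho & forall t, a <= t <= b -> quot_ineq F L eta (z0 t) rho.
Proof.
move=> cz H.
have [ab|ba] := leP a b; last first.
  exists 1 => // t /andP[at_ tb]; have := le_lt_trans (le_trans at_ tb) ba.
  by rewrite ltxx.
have loc c : a <= c <= b -> exists2 rho, 0 < rho & exists2 d, 0 < d &
    forall s, `|c - s| < d -> quot_ineq F L eta (z0 s) rho.
  move=> cab; have [rho rho0 Hrho] := H c cab.
  have r2 : 0 < rho / 2 by rewrite divr_gt0.
  exists (rho / 2) => //.
  have /cvgrPdist_lt/(_ _ r2)/nbhs_ballP[d /= d0 Hd] := cz c cab.
  exists d => // s cs; apply: quot_ineq_shrink Hrho.
  by have := Hd s cs; rewrite /= => ?; lra.
have mono w rho rho' : rho' <= rho -> quot_ineq F L eta w rho ->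
    quot_ineq F L eta w rho'.
  by move=> le; apply: quot_ineq_shrink; rewrite subrr normr0 add0r.
pose A c := exists2 rho, 0 < rho & forall t, a <= t <= c -> quot_ineq F L eta (z0 t) rho.
suff : forall c, a <= c <= b -> A c by apply; rewrite ab lexx.
have comb rho1 rho2 c s : 0 < rho1 -> 0 < rho2 ->
    (forall t, a <= t <= c -> quot_ineq F L eta (z0 t) rho1) ->
    (forall t, c <= t <= s -> quot_ineq F L eta (z0 t) rho2) -> A s.
  move=> p1 p2 H1 H2; exists (Num.min rho1 rho2); first by rewrite lt_min p1.
  move=> t /andP[at_ ts]; have [tc|ct] := leP t c.
    by apply: (mono _ rho1); [rewrite ge_min lexx|apply: H1; rewrite at_ tc].
  by apply: (mono _ rho2); [rewrite ge_min lexx orbT|apply: H2; rewrite ts ltW].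
apply: real_induction => [|c /andP[ac cb] [rho1 p1 H1]|c /andP[ac cb] Hc].
- have [rho rho0 Hr] := H a (ltac:(by rewrite lexx ab)).
  exists rho => // t /andP[at_ ta]; rewrite (_ : t = a) //.
  by apply/le_anti; rewrite at_ ta.
- have [rho2 p2 [d d0 Hd]] := loc c (ltac:(by rewrite ac ltW)).
  exists d => // s /andP[cs sd] sb; apply: (comb rho1 rho2 c) => // t /andP[ct ts].
  by apply: Hd; rewrite distrC ger0_norm ?subr_ge0//; lra.
- have [rho2 p2 [d d0 Hd]] := loc c (ltac:(by rewrite cb ltW)).
  pose s := Num.max a (c - d / 2).
  have as_ : a <= s by rewrite le_max lexx.
  have sd : c - d / 2 <= s by rewrite le_max lexx orbT.
  have sc : s < c by rewrite gt_max ac ltrBlDr ltrDl divr_gt0.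
  have [rho1 p1 H1] := Hc s (ltac:(by rewrite as_)).
  apply: (comb rho1 rho2 s) => // t /andP[st tc].
  by apply: Hd; rewrite ger0_norm ?subr_ge0//; lra.
Qed.

End quotients.

Section flow.
Context (R : realType) (W : normedModType R) (F : W -> W) (z0 : R -> W).
Context (a b L : R).
Hypotheses (L0 : 0 <= L) (short : 2 * (L + 1) * (b - a) <= 1).
Hypothesis dz0 : forall t, a <= t <= b -> is_derive t (1 : R) z0 (F (z0 t)).

(** A solution that starts close to a reference solution [z0] stays close to
    it.  The set [T] of times at which [z] is known to satisfy the equation (in
    the application, those at which a curve lies in a given chart) is only known
    to be open, and closed under limits from the left inside the tube; that is
    enough to keep the solution in the tube on the whole segment. *)
Lemma flow_tube (z : R -> W) (T : R -> Prop) (rho : R) :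
  0 < rho ->
  (forall t, a <= t <= b -> T t -> is_derive t (1 : R) z (F (z t))) ->
  (forall t, a <= t <= b -> T t -> \forall s \near t, T s) ->
  (forall t, a < t <= b ->
    (forall s, a <= s < t -> T s /\ `|z0 s - z s| < rho) -> T t) ->
  (forall t, a <= t <= b -> forall y y', `|z0 t - y| < rho ->
    `|z0 t - y'| < rho -> `|F y - F y'| <= L * `|y - y'|) ->
  T a -> 4 * `|z0 a - z a| < rho ->
  forall t, a <= t <= b -> T t /\ `|z0 t - z t| <= 2 * `|z0 a - z a|.
Proof.
move=> rho0 dz oT cT lipF Ta za.
have gr c : c <= b -> (forall t, a <= t <= c -> T t /\ `|z0 t - z t| < rho) ->
    forall t, a <= t <= c -> `|z0 t - z t| <= 2 * `|z0 a - z a|.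
  move=> cb Hc t tac.
  have sub s : a <= s <= c -> a <= s <= b.
    by move=> /andP[-> sc]; exact: le_trans cb.
  rewrite -[`|z0 a - z a|]addr0.
  apply: (@short_gronwall _ _ (fun t => z0 t - z t)
    (fun t => F (z0 t) - F (z t)) a c L 0) => //.
  - apply: le_trans short; rewrite ler_wpM2l//; last by lra.
    by rewrite mulr_ge0// addr_ge0.
  - by move=> s sac; apply: is_deriveB; [exact/dz0/sub|apply: dz; [exact: sub|case: (Hc s sac)]].
  - move=> s sac; rewrite addr0; apply: (lipF s (sub s sac)).
      by rewrite subrr normr0.
    by case: (Hc s sac).
have cont (x : R -> W) t v : is_derive t (1 : R) x v -> {for t, continuous x}.
  by move=> [dx _]; apply/differentiable_continuous/derivable1_diffP.
have cd t : a <= t <= b -> T t -> (fun s => `|z0 s - z s|) @ t --> `|z0 t - z t|.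
  move=> tab Tt; apply: cvg_norm; apply: cvgB.
    exact: (cont _ _ _ (dz0 tab)).
  exact: (cont _ _ _ (dz t tab Tt)).
have tube : forall t, a <= t <= b -> T t /\ `|z0 t - z t| < rho.
  apply: real_induction => [|t /andP[at_ tb] [Tt zt]|t /andP[at_ tb] H].
  - by split => //; have := normr_ge0 (z0 a - z a); lra.
  - have tab : a <= t <= b by rewrite at_ ltW.
    have h1 : \forall s \near t, `|z0 s - z s| < rho.
      exact: (cvgr_lt _ (cd t tab Tt)).
    have [d /= d0 Hd] := (nbhs_ballP _ _).1 (filterI (oT t tab Tt) h1).
    exists d => // s /andP[ts sd] _; apply: Hd => /=.
    by rewrite /ball/= distrC gtr0_norm ?subr_gt0//; lra.
  - have tab : a <= t <= b by rewrite tb ltW.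
    have Tt : T t by apply: cT => //; rewrite at_.
    split => //.
    have le s : a <= s < t -> `|z0 s - z s| <= 2 * `|z0 a - z a|.
      move=> /andP[as_ st]; apply: (gr s); rewrite ?as_ ?lexx//.
        by rewrite (le_trans (ltW st)).
      by move=> r /andP[ar rs]; apply: H; rewrite ar (le_lt_trans rs).
    apply: (@le_lt_trans _ _ (2 * `|z0 a - z a|)); last first.
      by have := normr_ge0 (z0 a - z a); lra.
    rewrite leNgt; apply/negP => gt.
    have [d /= d0 Hd] := (nbhs_ballP _ _).1 (cvgr_gt _ (cd t tab Tt) _ gt).
    pose s := Num.max a (t - d / 2).
    have as_ : a <= s by rewrite le_max lexx.
    have sd : t - d / 2 <= s by rewrite le_max lexx orbT.
    have st : s < t by rewrite gt_max at_ ltrBlDr ltrDl divr_gt0.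
    have := le s (ltac:(by rewrite as_)); rewrite leNgt => /negP; apply.
    by apply: Hd; rewrite /ball/= gtr0_norm ?subr_gt0//; lra.
move=> t tab; split; first by case: (tube t tab).
by apply: (gr b).
Qed.

Lemma flow_quotient_bound (z z' : R -> W) (h rho : R) :
  (forall t, a <= t <= b -> forall y y', `|z0 t - y| < rho ->
    `|z0 t - y'| < rho -> `|F y - F y'| <= L * `|y - y'|) ->
  (forall t, a <= t <= b -> is_derive t (1 : R) z (F (z t)) /\ `|z0 t - z t| < rho) ->
  (forall t, a <= t <= b -> is_derive t (1 : R) z' (F (z' t)) /\ `|z0 t - z' t| < rho) ->
  forall t, a <= t <= b ->
    `|h^-1 *: (z t - z' t)| <= 2 * `|h^-1 *: (z a - z' a)|.
Proof.
move=> lipF Hz Hz' t tab; rewrite -[`|h^-1 *: (z a - z' a)|]addr0.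
apply: (@short_gronwall _ _ (fun t => h^-1 *: (z t - z' t))
    (fun t => h^-1 *: (F (z t) - F (z' t))) a b L 0) => //.
- move=> s /[dup] /Hz[dz _] /Hz'[dz' _].
  by apply: is_deriveZ; exact: is_deriveB.
- move=> s sab; rewrite addr0 !normrZ mulrCA ler_wpM2l//.
  by apply: (lipF s sab); [case: (Hz s sab)|case: (Hz' s sab)].
Qed.

(** The difference of two quotients satisfies the linearized equation up to
    [eta], hence is controlled by its initial value.  This yields Cauchy
    quotients, and so derivatives with respect to parameters, without solving the
    linearized equation. *)
Lemma flow_quotient_diff (z1 z1' z2 z2' : R -> W) (h1 h2 rho eta C : R) :
  0 <= eta ->
  (forall t, a <= t <= b -> quot_ineq F L eta (z0 t) rho) ->
  (forall t, a <= t <= b -> is_derive t (1 : R) z1 (F (z1 t)) /\ `|z0 t - z1 t| < rho) ->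
  (forall t, a <= t <= b -> is_derive t (1 : R) z1' (F (z1' t)) /\ `|z0 t - z1' t| < rho) ->
  (forall t, a <= t <= b -> is_derive t (1 : R) z2 (F (z2 t)) /\ `|z0 t - z2 t| < rho) ->
  (forall t, a <= t <= b -> is_derive t (1 : R) z2' (F (z2' t)) /\ `|z0 t - z2' t| < rho) ->
  (forall t, a <= t <= b -> `|h1^-1 *: (z1 t - z1' t)| <= C) ->
  (forall t, a <= t <= b -> `|h2^-1 *: (z2 t - z2' t)| <= C) ->
  forall t, a <= t <= b ->
    `|h1^-1 *: (z1 t - z1' t) - h2^-1 *: (z2 t - z2' t)| <=
    2 * (`|h1^-1 *: (z1 a - z1' a) - h2^-1 *: (z2 a - z2' a)| + eta * (C + C)).
Proof.
move=> eta0 qF H1 H1' H2 H2' C1 C2 t tab.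
have C0 : 0 <= C by apply: le_trans (C1 t tab).
apply: (@short_gronwall _ _
    (fun t => h1^-1 *: (z1 t - z1' t) - h2^-1 *: (z2 t - z2' t))
    (fun t => h1^-1 *: (F (z1 t) - F (z1' t)) - h2^-1 *: (F (z2 t) - F (z2' t)))
    a b L (eta * (C + C))) => //.
- by rewrite mulr_ge0// addr_ge0.
- move=> s sab; have [d1 _] := H1 s sab; have [d1' _] := H1' s sab.
  have [d2 _] := H2 s sab; have [d2' _] := H2' s sab.
  by apply: is_deriveB; apply: is_deriveZ; exact: is_deriveB.
- move=> s sab; apply: le_trans (qF s sab _ _ _ _ _ _ _ _ _ _) _.
  + by case: (H1 s sab).
  + by case: (H1' s sab).
  + by case: (H2 s sab).
  + by case: (H2' s sab).
  rewrite lerD2l ler_wpM2l//; apply: lerD; [exact: C1|exact: C2].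
Qed.

End flow.

Section cauchy_families.
Context (R : realType) (I : Type) (G : set_system I) {PG : ProperFilter G}.

(** The Cauchy property of a family along the filter [G], with an explicit
    set of indices: the estimates below always compare two indices at a time. *)
Definition cauchy_fam (V : normedModType R) (q : I -> V) : Prop :=
  forall e, 0 < e -> exists2 A, G A & forall i j, A i -> A j -> `|q i - q j| <= e.

Lemma cauchy_fam_bounded (V : normedModType R) (q : I -> V) :
  cauchy_fam q -> exists2 C, 0 <= C & \forall i \near G, `|q i| <= C.
Proof.
move=> /(_ 1 ltr01)[A GA H]; have [i0 Ai0] := filter_ex GA.
exists (1 + `|q i0|); first exact: addr_ge0.
apply: filterS GA => i Ai; rewrite -[q i](subrK (q i0)).
by apply: le_trans (ler_normD _ _) _; rewrite lerD2r; exact: H.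
Qed.

Lemma cauchy_fam_mx m n (q : I -> 'M[R]_(m, n)) : cauchy_fam q ->
  exists l : 'M[R]_(m, n), q @ G --> l.
Proof.
move=> H; have : [cvg (q @ G) in 'M[R]_(m, n)].
  apply: cauchy_cvg; apply: cauchy_exP => e e0.
  have e2 : 0 < e / 2 by rewrite divr_gt0.
  have [A GA {}H] := H _ e2; have [i0 Ai0] := filter_ex GA.
  exists (q i0); change (G (q @^-1` ball (q i0) e)).
  apply: filterS GA => i Ai.
  have h : `|q i0 - q i| < e by apply: le_lt_trans (H _ _ Ai0 Ai) _; lra.
  by have : ball_ Num.norm (q i0) e (q i) := h; rewrite ball_normE.
by move=> /cvg_ex.
Qed.

Lemma flow_family (W : normedModType R) (F : W -> W) (z0 : R -> W) (a b L rho0 : R)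
    (z : I -> R -> W) (T : I -> R -> Prop) :
  0 <= L -> 2 * (L + 1) * (b - a) <= 1 -> 0 < rho0 ->
  (forall t, a <= t <= b -> is_derive t (1 : R) z0 (F (z0 t))) ->
  (forall t, a <= t <= b -> forall y y', `|z0 t - y| < rho0 ->
    `|z0 t - y'| < rho0 -> `|F y - F y'| <= L * `|y - y'|) ->
  (forall i t, a <= t <= b -> T i t -> is_derive t (1 : R) (z i) (F (z i t))) ->
  (forall i t, a <= t <= b -> T i t -> \forall s \near t, T i s) ->
  (forall i t, a < t <= b ->
    (forall s, a <= s < t -> T i s /\ `|z0 s - z i s| < rho0) -> T i t) ->
  (\forall i \near G, T i a) -> z i a @[i --> G] --> z0 a ->
  forall e, 0 < e -> \forall i \near G, forall t, a <= t <= b ->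
    T i t /\ `|z0 t - z i t| < e.
Proof.
move=> L0 sh r0 dz0 lipF dz oT cT Ta za e e0.
have m0 : 0 < Num.min rho0 e / 4 by rewrite divr_gt0// lt_min r0.
have ler : Num.min rho0 e <= rho0 by rewrite ge_min lexx.
have lee : Num.min rho0 e <= e by rewrite ge_min lexx orbT.
move/cvgrPdist_lt: za => /(_ _ m0) za.
near=> i => t tab.
have za' : `|z0 a - z i a| < Num.min rho0 e / 4 by near: i.
have Ti : T i a by near: i.
have [|Tit zt] := flow_tube L0 sh dz0 r0 (dz i) (oT i) (cT i) lipF Ti _ tab; first lra.
split => //; apply: le_lt_trans zt _; have := normr_ge0 (z0 a - z i a); lra.
Unshelve. all: by end_near. Qed.

(** Differentiable dependence on parameters: if the quotients of two families
    of solutions are Cauchy at time [a], they are at every later time of a short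
    segment. *)
Lemma flow_quotient (W : normedModType R) (F : W -> W) (z0 : R -> W) (a b L rho0 : R)
    (z z' : I -> R -> W) (T T' : I -> R -> Prop) (h : I -> R) :
  0 <= L -> 2 * (L + 1) * (b - a) <= 1 -> 0 < rho0 ->
  (forall t, a <= t <= b -> is_derive t (1 : R) z0 (F (z0 t))) ->
  (forall t, a <= t <= b -> forall y y', `|z0 t - y| < rho0 ->
    `|z0 t - y'| < rho0 -> `|F y - F y'| <= L * `|y - y'|) ->
  (forall eta, 0 < eta -> exists2 rho, 0 < rho &
    forall t, a <= t <= b -> quot_ineq F L eta (z0 t) rho) ->
  (forall i t, a <= t <= b -> T i t -> is_derive t (1 : R) (z i) (F (z i t))) ->
  (forall i t, a <= t <= b -> T' i t -> is_derive t (1 : R) (z' i) (F (z' i t))) ->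
  (forall e, 0 < e -> \forall i \near G, forall t, a <= t <= b ->
    T i t /\ `|z0 t - z i t| < e) ->
  (forall e, 0 < e -> \forall i \near G, forall t, a <= t <= b ->
    T' i t /\ `|z0 t - z' i t| < e) ->
  a <= b ->
  cauchy_fam (fun i => (h i)^-1 *: (z i a - z' i a)) ->
  forall t, a <= t <= b -> cauchy_fam (fun i => (h i)^-1 *: (z i t - z' i t)).
Proof.
move=> L0 sh r0 dz0 lipF qF dz dz' cz cz' ab cQ t tab e e0.
have [C C0 QC] := cauchy_fam_bounded cQ.
pose eta := e / (2 * (2 * C + 2 * C) + 1) / 2.
have K0 : 0 < 2 * (2 * C + 2 * C) + 1 by lra.
have eta0 : 0 < eta by rewrite /eta !divr_gt0.
have [rho1 p1 {}qF] := qF eta eta0.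
pose rho := Num.min rho0 rho1.
have p : 0 < rho by rewrite lt_min r0.
have [rr0 rr1] : rho <= rho0 /\ rho <= rho1 by rewrite /rho !ge_min !lexx orbT.
have e4 : 0 < e / 4 by rewrite divr_gt0.
have [A GA HA] := cQ _ e4.
exists (A `&` [set i | `|(h i)^-1 *: (z i a - z' i a)| <= C] `&`
  ([set i | forall t, a <= t <= b -> T i t /\ `|z0 t - z i t| < rho] `&`
  [set i | forall t, a <= t <= b -> T' i t /\ `|z0 t - z' i t| < rho])).
  by apply: filterI; apply: filterI => //; [exact: cz|exact: cz'].
move=> i j [[Ai Ci] [/= zi zi']] [[Aj Cj] [/= zj zj']].
have S k : (forall t, a <= t <= b -> T k t /\ `|z0 t - z k t| < rho) ->
    forall t r, rho <= r -> a <= t <= b ->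
    is_derive t (1 : R) (z k) (F (z k t)) /\ `|z0 t - z k t| < r.
  move=> H s r rr sab; have [Ts zs] := H s sab.
  by split; [exact: dz|exact: lt_le_trans rr].
have S' k : (forall t, a <= t <= b -> T' k t /\ `|z0 t - z' k t| < rho) ->
    forall t r, rho <= r -> a <= t <= b ->
    is_derive t (1 : R) (z' k) (F (z' k t)) /\ `|z0 t - z' k t| < r.
  move=> H s r rr sab; have [Ts zs] := H s sab.
  by split; [exact: dz'|exact: lt_le_trans rr].
have bnd k : `|(h k)^-1 *: (z k a - z' k a)| <= C ->
    (forall t, a <= t <= b -> T k t /\ `|z0 t - z k t| < rho) ->
    (forall t, a <= t <= b -> T' k t /\ `|z0 t - z' k t| < rho) ->
    forall t, a <= t <= b -> `|(h k)^-1 *: (z k t - z' k t)| <= 2 * C.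
  move=> Ck Hk Hk' s sab.
  apply: le_trans (_ : 2 * `|(h k)^-1 *: (z k a - z' k a)| <= _); last by lra.
  have := @flow_quotient_bound _ _ F z0 a b L L0 sh (z k) (z' k) (h k) rho0 lipF.
  by apply => // s' sab'; [exact: S|exact: S'].
have := @flow_quotient_diff _ _ F z0 a b L L0 sh (z i) (z' i) (z j) (z' j)
  (h i) (h j) rho1 eta (2 * C) (ltW eta0) qF
  (fun t => S _ zi t _ rr1) (fun t => S' _ zi' t _ rr1)
  (fun t => S _ zj t _ rr1) (fun t => S' _ zj' t _ rr1)
  (bnd i Ci zi zi') (bnd j Cj zj zj') t tab.
move=> H; apply: le_trans H _; have := HA i j Ai Aj.
have : 2 * (eta * (2 * C + 2 * C)) <= e / 2.
  have -> : 2 * (eta * (2 * C + 2 * C)) =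
     (e / 2) * (2 * (2 * C + 2 * C) / (2 * (2 * C + 2 * C) + 1)).
    by rewrite /eta; field; rewrite gt_eqF.
  rewrite ler_piMr//; first by rewrite divr_ge0// ltW.
  by rewrite ler_pdivrMr// mul1r lerDl.
lra.
Qed.

End cauchy_families.

(** * Geodesics as integral curves, and changes of charts *)
Section geodesic_field.
Context (R : realType) (n : nat) (M : smoothManifold R n)
  (g : riemannianMetric M).
Implicit Types (a b : chart_index M) (gam : R -> M).

Lemma is_derive_pair (V W : normedModType R) (f : R -> V) (h : R -> W) t df dh :
  is_derive t (1 : R) f df -> is_derive t (1 : R) h dh ->
  is_derive t (1 : R) (fun s => (f s, h s)) (df, dh).
Proof.
move=> [Df Ef] [Dh Eh].
have cf : (fun k : R => k^-1 *: (f (k *: (1 : R) + t) - f t)) @ 0^' --> df.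
  by rewrite -Ef; exact: Df.
have ch : (fun k : R => k^-1 *: (h (k *: (1 : R) + t) - h t)) @ 0^' --> dh.
  by rewrite -Eh; exact: Dh.
have c := cvg_pair cf ch.
have {}c : (fun k : R => k^-1 *: ((f (k *: (1 : R) + t), h (k *: (1 : R) + t)) - (f t, h t)))
    @ 0^' --> (df, dh) by exact: c.
by split; [apply/cvg_ex; exists (df, dh)|apply/cvg_lim].
Qed.

(** Position and velocity in a chart: geodesics become integral curves of a
    first order field. *)
Definition state a gam (t : R) : 'rV[R]_n * 'rV[R]_n :=
  (phi a (gam t), derive1 (phi a \o gam) t).

Definition geodesic_field a (z : 'rV[R]_n * 'rV[R]_n) : 'rV[R]_n * 'rV[R]_n :=
  (z.2, - christoffel g a z.1 z.2 z.2).

Lemma is_derive_derive1 (V : normedModType R) (f : R -> V) t :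
  derivable f t 1 -> is_derive t (1 : R) f (derive1 f t).
Proof. by move=> df; rewrite derive1E; exact: derivableP. Qed.

Lemma geodesic_state D gam t a : is_geodesic g D gam -> D t -> dom a (gam t) ->
  is_derive t (1 : R) (state a gam) (geodesic_field a (state a gam t)).
Proof.
move=> geo Dt at_; have [_ /(_ a at_)[d1 d2]] := geo t Dt.
rewrite /covD => /eqP; rewrite addr_eq0 => /eqP E.
have := is_derive_pair (is_derive_derive1 d1) (is_derive_derive1 d2).
by rewrite E.
Qed.

Lemma dom_near a gam t : {for t, continuous gam} -> dom a (gam t) ->
  \forall s \near t, dom a (gam s).
Proof.
move=> cg at_; apply: cg; apply: open_nbhs_nbhs; split => //; exact: dom_open.
Qed.

Lemma gmx_unit a y : (phi a @` dom a) y -> gmx g a y \in unitmx.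
Proof.
move=> ay; rewrite -row_free_unit -kermx_eq0; apply/rowV0P => v /sub_kermxP vG.
apply/eqP; apply: contraT => v0.
by have := gmx_posdef g ay v0; rewrite vG mul0mx mxE ltxx.
Qed.

Lemma gmx_sdiff a y : (phi a @` dom a) y -> sdiff (gmx g a) y.
Proof.
move=> ay; have [oU CU] := gmx_smooth g a.
exact: (sdiff_C1 oU (CU 1%N)).
Qed.

Lemma gmx_differentiable a y : (phi a @` dom a) y -> differentiable (gmx g a) y.
Proof. by move=> ay; have [oU CU] := gmx_smooth g a; case: (CU 1%N) => + _; apply. Qed.

Lemma gmx_deriv_sdiff a y v : (phi a @` dom a) y -> sdiff ('D_v (gmx g a)) y.
Proof.
move=> ay; have [oU CU] := gmx_smooth g a.
by apply: (sdiff_C1 oU) => //; case: (CU 2%N) => _; apply.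
Qed.

(** The Christoffel symbols are polynomial in the velocity, in the first
    derivatives of the metric and in the inverse of its matrix. *)
Lemma geodesic_field_sdiff a z : (phi a @` dom a) z.1 ->
  sdiff (geodesic_field a) z.
Proof.
move=> az; apply: sdiff_pair; first exact: sdiff_snd.
apply: sdiffN.
have sv : sdiff (fun w : 'rV[R]_n * 'rV[R]_n => w.2) z by exact: sdiff_snd.
have sD v : sdiff (fun w : 'rV[R]_n * 'rV[R]_n => 'D_v (gmx g a) w.1) z.
  exact: (sdiff_comp (sdiff_fst z) (gmx_deriv_sdiff v az)).
have sDu : sdiff (fun w : 'rV[R]_n * 'rV[R]_n => 'D_(w.2) (gmx g a) w.1) z.
  apply: (@sdiff_near _ _ _ (fun w : 'rV[R]_n * 'rV[R]_n =>
     \sum_j w.2 0 j *: 'D_(delta_mx 0 j) (gmx g a) w.1)).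
    have H : nbhs z [set w : 'rV[R]_n * 'rV[R]_n | (phi a @` dom a) w.1].
      apply: (sdiff_continuous (sdiff_fst z)).
      exact: (open_nbhs_nbhs (conj (@phi_open _ _ M a) az)).
    near=> w.
    have aw : (phi a @` dom a) w.1 by near: w; exact: H.
    have dw := gmx_differentiable aw.
    rewrite deriveE// [w.2 in RHS]row_sum_delta linear_sum.
    by apply: eq_bigr => j _; rewrite linearZ deriveE.
  apply: sdiff_sum => j _; apply: sdiffZ; first exact: sdiff_coord.
  exact: sD.
apply: sdiff_mulmx; last first.
  apply: sdiff_invmx; first exact: gmx_unit.
  exact: (sdiff_comp (sdiff_fst z) (gmx_sdiff az)).
apply: sdiff_mx => i l; under eq_fun do rewrite mxE.
apply: sdiffM; first exact: sdiff_cst.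
apply: sdiffD.
  by apply: sdiffD; apply: sdiff_coord; exact: sdiff_mulmx.
apply: sdiffN; apply: sdiff_coord; apply: sdiff_mulmx.
  exact: (sdiff_mulmx sv (sD _)).
apply: sdiff_mx => j k; under eq_fun do rewrite mxE.
exact: sdiff_coord.
Unshelve. all: by end_near. Qed.

End geodesic_field.

(** By [sdiff_quot_ineq] applied to pairs of indices: the error terms are small
    because the quotients are bounded. *)
Lemma sdiff_cauchy_fam (R : realType) (I : Type) (G : set_system I)
    {PG : ProperFilter G} (V W : normedModType R) (F : V -> W) (w : V)
    (z z' : I -> V) (h : I -> R) :
  sdiff F w -> z @ G --> w -> z' @ G --> w ->
  cauchy_fam G (fun i => (h i)^-1 *: (z i - z' i)) ->
  cauchy_fam G (fun i => (h i)^-1 *: (F (z i) - F (z' i))).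
Proof.
move=> sF zw zw' cQ e e0.
have [L [r [L0 r0 lipF]]] := sdiff_lipschitz sF.
have [C C0 QC] := cauchy_fam_bounded cQ.
pose eta := e / 2 / (C + C + 1).
have K0 : 0 < C + C + 1 by lra.
have eta0 : 0 < eta by rewrite /eta !divr_gt0.
have [rho p qF] := sdiff_quot_ineq sF r0 lipF eta0.
have e1 : 0 < e / 2 / (L + 1) by rewrite !divr_gt0// ltr_wpDl.
have [A GA HA] := cQ _ e1.
move/cvgrPdist_lt: zw => /(_ _ p) zw; move/cvgrPdist_lt: zw' => /(_ _ p) zw'.
exists (A `&` [set i | `|(h i)^-1 *: (z i - z' i)| <= C] `&`
  ([set i | `|w - z i| < rho] `&` [set i | `|w - z' i| < rho])).
  by apply: filterI; exact: filterI.
move=> i j [[Ai Ci] [/= zi zi']] [[Aj Cj] [/= zj zj']].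
apply: le_trans (qF _ _ _ _ (h i) (h j) zi zi' zj zj') _.
rewrite (splitr e); apply: lerD.
  apply: le_trans (_ : (L + 1) * (e / 2 / (L + 1)) <= _); last first.
    by rewrite mulrC divfK// gt_eqF// ltr_wpDl.
  by apply: ler_pM => //; [rewrite lerDl|exact: HA].
apply: le_trans (_ : eta * (C + C + 1) <= _); last by rewrite /eta divfK// gt_eqF.
rewrite ler_wpM2l//; first exact: ltW.
by rewrite /= in Ci Cj; lra.
Qed.

Section chart_change.
Context (R : realType) (n : nat) (M : smoothManifold R n).
Implicit Types (a b : chart_index M) (gam : R -> M).

(** The tangent map of a change of charts, on positions and velocities. *)
Definition state_change a b (z : 'rV[R]_n * 'rV[R]_n) : 'rV[R]_n * 'rV[R]_n :=
  (transition a b z.1, 'd (transition a b) (z.1) z.2).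

Lemma transition_C a b k : Ck_on k (phi a @` (dom a `&` dom b)) (@transition _ _ M a b).
Proof. by case: (@transition_smooth _ _ M a b). Qed.

Lemma transition_open a b : open (phi a @` (dom a `&` dom b) : set 'rV[R]_n).
Proof. by case: (@transition_smooth _ _ M a b). Qed.

Lemma transition_differentiable a b (x : M) : dom a x -> dom b x ->
  differentiable (transition a b) (phi a x).
Proof.
move=> ax bx; have [+ _] := transition_C a b 1.
by apply; exists x.
Qed.

Lemma state_change_sdiff a b z : (phi a @` (dom a `&` dom b)) z.1 ->
  sdiff (state_change a b) z.
Proof.
move=> abz; have oU := @transition_open a b.
apply: sdiff_pair.
  have sT : sdiff (transition a b) z.1.
    by apply: (sdiff_C1 oU (transition_C a b 1)).
  exact: (sdiff_comp (sdiff_fst z) sT).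
apply: (@sdiff_near _ _ _ (fun w : 'rV[R]_n * 'rV[R]_n =>
     \sum_j w.2 0 j *: 'D_(delta_mx 0 j) (transition a b) w.1)).
  have H : nbhs z [set w : 'rV[R]_n * 'rV[R]_n | (phi a @` (dom a `&` dom b)) w.1].
    apply: (sdiff_continuous (sdiff_fst z)).
    exact: (open_nbhs_nbhs (conj oU abz)).
  near=> w.
  have aw : (phi a @` (dom a `&` dom b)) w.1 by near: w; exact: H.
  have dw : differentiable (transition a b) w.1.
    by case: aw => x [ax bx] <-; exact: transition_differentiable.
  rewrite [w.2 in RHS]row_sum_delta linear_sum.
  by apply: eq_bigr => j _; rewrite linearZ deriveE.
have sv : sdiff (fun w : 'rV[R]_n * 'rV[R]_n => w.2) z by exact: sdiff_snd.
apply: sdiff_sum => j _; apply: sdiffZ; first exact: sdiff_coord.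
have sD : sdiff ('D_(delta_mx 0 j) (transition a b)) z.1.
  apply: (sdiff_C1 oU) => //; case: (transition_C a b 2) => _; exact.
exact: (sdiff_comp (sdiff_fst z) sD).
Unshelve. all: by end_near. Qed.

Lemma is_derive_diff_comp (V W : normedModType R) (T : V -> W) (x : R -> V) t dx :
  differentiable T (x t) -> is_derive t (1 : R) x dx ->
  is_derive t (1 : R) (T \o x) ('d T (x t) dx).
Proof.
move=> dT [/derivable1_diffP Dx Ex].
have dTx := differentiable_comp Dx dT.
split; first exact: diff_derivable.
by rewrite -Ex deriveE// diff_comp//= deriveE.
Qed.

(** The coordinates of a curve in the chart [b] are the composite of its
    coordinates in [a] with the transition map, near any time at which the curve
    lies in both charts. *)
Lemma velocity_chart_change a b gam t : {for t, continuous gam} ->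
  dom a (gam t) -> dom b (gam t) -> derivable (phi a \o gam) t 1 ->
  is_derive t (1 : R) (phi b \o gam) ('d (transition a b) (phi a (gam t)) (derive1 (phi a \o gam) t)).
Proof.
move=> cg at_ bt dx.
have H := is_derive_diff_comp
  (transition_differentiable at_ bt : differentiable _ ((phi a \o gam) t))
  (is_derive_derive1 dx).
apply: near_eq_is_derive H => //.
by apply: filterS (dom_near cg at_) => s as_ /=; rewrite /transition /= phiK.
Qed.

Lemma state_changeE a b gam t : {for t, continuous gam} ->
  dom a (gam t) -> dom b (gam t) -> derivable (phi a \o gam) t 1 ->
  state b gam t = state_change a b (state a gam t).
Proof.
move=> cg at_ bt dx; have [_ E] := velocity_chart_change cg at_ bt dx.
by rewrite /state /state_change derive1E E /= /transition /= phiK.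
Qed.

End chart_change.

Section propagation.
Context (R : realType) (n : nat) (M : smoothManifold R n)
  (g : riemannianMetric M).
Context (I : Type) (G : set_system I) {PG : ProperFilter G}.
Context (gam0 : R -> M).
Hypothesis geo0 : is_geodesic g `[0, 1] gam0.
Implicit Types (a b : chart_index M).

(** The charts are undefined outside their domains, so the members of the
    family have to be required to lie in the domain eventually. *)
Definition states_cvg a (t : R) (gam : I -> R -> M) : Prop :=
  (\forall i \near G, dom a (gam i t)) /\
  (fun i => state a (gam i) t) @ G --> state a gam0 t.

Lemma mem_unit_itv (t : R) : `[0, 1]%classic t <-> 0 <= t <= 1.
Proof. by rewrite /= in_itv. Qed.

Lemma geodesic_cont (gam' : R -> M) t : is_geodesic g `[0, 1] gam' -> 0 <= t <= 1 ->
  {for t, continuous gam'}.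
Proof. by move=> geo /mem_unit_itv t01; case: (geo t t01). Qed.

Lemma geodesic_derivable (gam' : R -> M) t a : is_geodesic g `[0, 1] gam' -> 0 <= t <= 1 ->
  dom a (gam' t) -> derivable (phi a \o gam') t 1.
Proof. by move=> geo /mem_unit_itv t01 at_; case: (geo t t01) => _ /(_ a at_)[]. Qed.

(** Membership in the new chart comes first: since the positions converge in
    the chart [a], the points themselves converge. *)
Lemma states_cvg_chart a b (t : R) (gam : I -> R -> M) :
  (forall i, is_geodesic g `[0, 1] (gam i)) -> 0 <= t <= 1 ->
  dom a (gam0 t) -> dom b (gam0 t) ->
  states_cvg a t gam -> states_cvg b t gam.
Proof.
move=> geo t01 a0 b0 [da ca].
have cx : (fun i => phi a (gam i t)) @ G --> phi a (gam0 t).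
  exact: (cvg_comp _ _ ca (sdiff_continuous (sdiff_fst (state a gam0 t)))).
have db : \forall i \near G, dom b (gam i t).
  have ay : (phi a @` dom a) (phi a (gam0 t)) by exists (gam0 t).
  have cp := psi_continuous ay.
  have nb : nbhs (psi a (phi a (gam0 t))) (dom b).
    by rewrite phiK//; apply: open_nbhs_nbhs; split => //; exact: dom_open.
  have /= H := cvg_comp _ _ cx cp _ nb.
  by near=> i; rewrite -[gam i t](@phiK _ _ _ a); near: i.
split; first exact: db.
have E0 := state_changeE (geodesic_cont geo0 t01) a0 b0 (geodesic_derivable geo0 t01 a0).
have cS : {for state a gam0 t, continuous (@state_change _ _ M a b)}.
  apply: sdiff_continuous; apply: state_change_sdiff.
  by exists (gam0 t).
rewrite E0; have H := cvg_comp _ _ ca cS.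
apply: cvg_trans H; apply: near_eq_cvg; near=> i => /=.
have ai : dom a (gam i t) by near: i.
have bi : dom b (gam i t) by near: i.
by rewrite (state_changeE (geodesic_cont (geo i) t01) ai bi (geodesic_derivable (geo i) t01 ai)).
Unshelve. all: by end_near. Qed.

Lemma quotient_chart a b (t : R) (gam gam' : I -> R -> M) (h : I -> R) :
  (forall i, is_geodesic g `[0, 1] (gam i)) ->
  (forall i, is_geodesic g `[0, 1] (gam' i)) -> 0 <= t <= 1 ->
  dom a (gam0 t) -> dom b (gam0 t) ->
  states_cvg a t gam -> states_cvg a t gam' ->
  cauchy_fam G (fun i => (h i)^-1 *: (state a (gam i) t - state a (gam' i) t)) ->
  cauchy_fam G (fun i => (h i)^-1 *: (state b (gam i) t - state b (gam' i) t)).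
Proof.
move=> geo geo' t01 a0 b0 ca ca' cQ.
have cb := states_cvg_chart geo t01 a0 b0 ca.
have cb' := states_cvg_chart geo' t01 a0 b0 ca'.
have sS : sdiff (@state_change _ _ M a b) (state a gam0 t).
  by apply: state_change_sdiff; exists (gam0 t).
have H := sdiff_cauchy_fam sS ca.2 ca'.2 cQ.
move=> e e0; have [A GA HA] := H PG e e0.
exists (A `&` ([set i | dom a (gam i t)] `&` [set i | dom a (gam' i t)] `&`
   ([set i | dom b (gam i t)] `&` [set i | dom b (gam' i t)]))); 
  first exact: (filterI GA (filterI (filterI ca.1 ca'.1) (filterI cb.1 cb'.1))).
have E i : dom a (gam i t) -> dom b (gam i t) ->
    state b (gam i) t = state_change a b (state a (gam i) t).
  by move=> ai bi; exact: (state_changeE (geodesic_cont (geo i) t01) ai bi (geodesic_derivable (geo i) t01 ai)).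
have E' i : dom a (gam' i t) -> dom b (gam' i t) ->
    state b (gam' i) t = state_change a b (state a (gam' i) t).
  by move=> ai bi; exact: (state_changeE (geodesic_cont (geo' i) t01) ai bi (geodesic_derivable (geo' i) t01 ai)).
move=> i j [Ai [[ai ai'] [bi bi']]] [Aj [[aj aj'] [bj bj']]].
rewrite !E ?E'//; exact: HA.
Qed.

End propagation.

(** * Propagation along a geodesic that crosses several charts *)

(** A curve cannot leave the domain of a chart while its coordinates stay in
    a compact part of the image: by the Hausdorff property, the corresponding
    part of the manifold is closed. *)
Lemma dom_closed_left (R : realType) (n : nat) (M : smoothManifold R n)
    (a : chart_index M) (gam : R -> M) (K : set 'rV[R]_n) (s u : R) :
  compact K -> K `<=` phi a @` dom a -> {for u, continuous gam} -> s < u ->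
  (forall v, s <= v < u -> dom a (gam v) /\ K (phi a (gam v))) ->
  dom a (gam u).
Proof.
move=> cK Ka cg su H.
have cpsi : compact (psi a @` K).
  apply: continuous_compact => //.
  apply: continuous_in_subspaceT => y /set_mem Ky.
  exact: (psi_continuous (Ka y Ky)).
have clK : closed (psi a @` K).
  by apply: compact_closed cpsi; exact: manifold_hausdorff.
have sub : psi a @` K `<=` dom a.
  by move=> _ [y /Ka[x ax <-] <-]; rewrite phiK.
apply: sub; apply: (@closed_cvg _ _ u^'- _ gam (psi a @` K)) => //.
  near=> v.
  have [av Kv] : dom a (gam v) /\ K (phi a (gam v)).
    apply: H; apply/andP; split; near: v; last exact: nbhs_left_lt.
    exact: nbhs_left_ge.
  by exists (phi a (gam v)) => //; rewrite phiK.
exact: cvg_at_left_filter.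
Unshelve. all: by end_near. Qed.

Lemma closed_ball_compact (R : realType) n (x : 'rV[R]_n) (r : R) :
  compact [set y | `|x - y| <= r].
Proof.
apply: bounded_closed_compact.
  exists (`|x| + r); split; first exact: num_real.
  move=> m lm y /= xy; apply: ltW; apply: le_lt_trans lm.
  rewrite -[y](subKr x); apply: le_trans (ler_normB _ _) _.
  by rewrite lerD2l.
exact: closed_closed_ball_.
Qed.

Section window.
Context (R : realType) (n : nat) (M : smoothManifold R n)
  (g : riemannianMetric M).
Context (I : Type) (G : set_system I) {PG : ProperFilter G}.
Context (gam0 : R -> M) (gam gam' : I -> R -> M) (h : I -> R).
Hypothesis geo0 : is_geodesic g `[0, 1] gam0.
Hypothesis geo : forall i, is_geodesic g `[0, 1] (gam i).
Hypothesis geo' : forall i, is_geodesic g `[0, 1] (gam' i).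

(** The property that is propagated along the reference geodesic [gam0]: both
    families converge to it and their quotients are Cauchy. *)
Definition strict_at (a : chart_index M) (t : R) : Prop :=
  [/\ states_cvg G gam0 a t gam, states_cvg G gam0 a t gam' &
   cauchy_fam G (fun i => (h i)^-1 *: (state a (gam i) t - state a (gam' i) t))].

Lemma strict_at_chart a b t : 0 <= t <= 1 -> dom a (gam0 t) -> dom b (gam0 t) ->
  strict_at a t -> strict_at b t.
Proof.
move=> t01 a0 b0 [c1 c2 c3]; split.
- exact: (states_cvg_chart geo0 geo t01 a0 b0 c1).
- exact: (states_cvg_chart geo0 geo' t01 a0 b0 c2).
- exact: (quotient_chart geo0 geo geo' t01 a0 b0 c1 c2 c3).
Qed.

(** Around each time [tau] there is a window in which a single chart, a single
    Lipschitz constant and a single tube radius can be used, and which is short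
    with respect to that constant. *)
Lemma chart_window tau a : 0 <= tau <= 1 -> dom a (gam0 tau) ->
  exists K r L d, [/\ compact K, K `<=` phi a @` dom a, 0 < r & 0 <= L] /\
  [/\ 0 < d, 4 * (L + 1) * d <= 1 &
    forall t, 0 <= t <= 1 -> `|tau - t| < d ->
    [/\ dom a (gam0 t),
       forall y, `|state a gam0 t - y| < r -> K y.1 &
       forall y y', `|state a gam0 t - y| < r -> `|state a gam0 t - y'| < r ->
         `|geodesic_field g a y - geodesic_field g a y'| <= L * `|y - y'| ]].
Proof.
move=> t01 atau.
pose w := state a gam0 tau.
have aw : (phi a @` dom a) w.1 by exists (gam0 tau).
have [L [r1 [L0 r10 lipF]]] := sdiff_lipschitz (geodesic_field_sdiff g aw).
have [r2 /= r20 Hr2] := (nbhs_ballP _ _).1 (open_nbhs_nbhs (conj (@phi_open _ _ M a) aw)).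
(* Half of the radius is left for the motion of the reference curve during the window,
   half for the tube around it. *)
pose r := Num.min r1 (r2 / 2) / 2.
have r0 : 0 < r by rewrite divr_gt0// lt_min r10 divr_gt0.
have rr1 : r + r <= r1 by rewrite /r -splitr ge_min lexx.
have rr2 : r + r <= r2 / 2 by rewrite /r -splitr ge_min lexx orbT.
have cw : {for tau, continuous (state a gam0)}.
  have H := geodesic_state geo0 ((mem_unit_itv tau).2 t01) atau.
  by case: H => [dx _]; apply/differentiable_continuous/derivable1_diffP.
have ndom := dom_near (geodesic_cont geo0 t01) atau.
have nst : \forall t \near tau, `|w - state a gam0 t| < r.
  by move/cvgrPdist_lt: cw => /(_ _ r0).
have [d1 /= d10 Hd1] := (nbhs_ballP _ _).1 (filterI ndom nst).
pose d := Num.min d1 (4 * (L + 1))^-1.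
have L1 : 0 < 4 * (L + 1) by rewrite mulr_gt0// ltr_wpDl.
have d0 : 0 < d by rewrite lt_min d10 invr_gt0.
exists [set y | `|w.1 - y| <= r2 / 2], r, L, d; split.
  split => //; first exact: closed_ball_compact.
  move=> y /= wy; apply: Hr2; rewrite -ball_normE /=.
  by apply: le_lt_trans wy _; lra.
split => //.
  apply: (@le_trans _ _ (4 * (L + 1) * (4 * (L + 1))^-1)).
    by rewrite ler_wpM2l ?(ltW L1)// /d ge_min lexx orbT.
  by rewrite divff// gt_eqF.
move=> t t01' tt.
have [/= da dw] : dom a (gam0 t) /\ `|w - state a gam0 t| < r.
  by apply: Hd1; apply: lt_le_trans tt _; rewrite /d ge_min lexx.
have tri y : `|state a gam0 t - y| < r -> `|w - y| < r + r.
  move=> ty; rewrite -(subrK (state a gam0 t) w) -addrA.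
  by apply: le_lt_trans (ler_normD _ _) _; exact: ltrD.
split => //.
  move=> y ty /=; apply: (@le_trans _ _ `|w - y|).
    by rewrite [leRHS]prod_normE le_max lexx.
  by apply: le_trans (ltW (tri y ty)) _.
move=> y y' ty ty'; apply: lipF.
  exact: lt_le_trans (tri y ty) _.
exact: lt_le_trans (tri y' ty') _.
Qed.

Lemma strict_window tau a : 0 <= tau <= 1 -> dom a (gam0 tau) ->
  exists2 d, 0 < d & forall s t, 0 <= s -> s <= t -> t <= 1 ->
    `|tau - s| < d -> `|tau - t| < d ->
    [/\ dom a (gam0 s), dom a (gam0 t) & strict_at a s -> strict_at a t].
Proof.
move=> tau01 atau.
have [K [r [L [d [[cK Ka r0 L0] [d0 dL Hd]]]]]] := chart_window tau01 atau.
exists d; first exact: d0.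
  move=> s t s0 st t1 ds dt.
have ins u : s <= u <= t -> 0 <= u <= 1.
  by move=> /andP[su ut]; rewrite (le_trans s0 su) (le_trans ut t1).
have ind u : s <= u <= t -> `|tau - u| < d.
  move=> /andP[su ut]; move: ds dt; rewrite !ltr_distl => /andP[a1 a2] /andP[a3 a4]; apply/andP; split.
    by lra.
  by lra.
have Hd' u : s <= u <= t -> _ := fun h => Hd u (ins u h) (ind u h).
have [das _ _] := Hd' s (ltac:(by rewrite lexx st)).
have [dat _ _] := Hd' t (ltac:(by rewrite lexx st)).
split; [exact: das|exact: dat|case=> cs cs' cQ].
have short : 2 * (L + 1) * (t - s) <= 1.
  have ts2 : t - s <= 2 * d.
    by move: ds dt; rewrite !ltr_distl => /andP[a1 a2] /andP[a3 a4]; lra.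
  apply: le_trans dL; have -> : 4 * (L + 1) * d = 2 * (L + 1) * (2 * d) by ring.
  by rewrite ler_wpM2l// mulr_ge0// addr_ge0.
have dz0 u : s <= u <= t ->
    is_derive u (1 : R) (state a gam0) (geodesic_field g a (state a gam0 u)).
  move=> su; have [da _ _] := Hd' u su.
  exact: (geodesic_state geo0 ((mem_unit_itv u).2 (ins u su)) da).
have lipF u : s <= u <= t -> forall y y', `|state a gam0 u - y| < r ->
    `|state a gam0 u - y'| < r ->
    `|geodesic_field g a y - geodesic_field g a y'| <= L * `|y - y'|.
  by move=> su; have [_ _ ?] := Hd' u su.
have dz gm : (forall i, is_geodesic g `[0, 1] (gm i)) ->
    forall (i : I) u, s <= u <= t -> dom a (gm i u) ->
    is_derive u (1 : R) (state a (gm i)) (geodesic_field g a (state a (gm i) u)).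
  by move=> geom i u su da; exact: (geodesic_state (geom i) ((mem_unit_itv u).2 (ins u su)) da).
have fam gm : (forall i, is_geodesic g `[0, 1] (gm i)) ->
    states_cvg G gam0 a s gm ->
    forall e, 0 < e -> \forall i \near G, forall u, s <= u <= t ->
    dom a (gm i u) /\ `|state a gam0 u - state a (gm i) u| < e.
  move=> geom [c1 c2].
  apply: (flow_family L0 short r0 dz0 lipF (dz _ geom) _ _ c1 c2).
    move=> i u su da; exact: (dom_near (geodesic_cont (geom i) (ins u su)) da).
  move=> i u /andP[su ut] Hi.
  have su' : s <= u <= t by rewrite ut ltW.
  apply: (dom_closed_left cK Ka (geodesic_cont (geom i) (ins u su')) su) => v /andP[sv vu].
  have [dv nv] := Hi v (ltac:(by rewrite sv)).
  have [_ Kv _] := Hd' v (ltac:(by rewrite sv (le_trans (ltW vu)))).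
  by split => //; exact: (Kv _ nv).
have qF eta : 0 < eta -> exists2 rho, 0 < rho & forall u, s <= u <= t ->
    quot_ineq (geodesic_field g a) L eta (state a gam0 u) rho.
  move=> eta0; apply: quot_ineq_uniform => u su.
    by case: (dz0 u su) => [dx _]; apply/differentiable_continuous/derivable1_diffP.
  have [da _ lip] := Hd' u su.
  apply: (sdiff_quot_ineq _ r0 lip eta0).
  by apply: geodesic_field_sdiff; exists (gam0 u).
have tt : s <= t <= t by rewrite st lexx.
have C := fam _ geo cs; have C' := fam _ geo' cs'.
have cvgt gm : (forall e, 0 < e -> \forall i \near G, forall u, s <= u <= t ->
    dom a (gm i u) /\ `|state a gam0 u - state a (gm i) u| < e) ->
    states_cvg G gam0 a t gm.
  move=> H; split.
    by apply: filterS (H 1 ltr01) => i Hi; case: (Hi t tt).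
  by apply/cvgrPdist_lt => e e0; apply: filterS (H e e0) => i Hi; case: (Hi t tt).
split; [exact: cvgt C|exact: cvgt C'|].
exact: (flow_quotient L0 short r0 dz0 lipF qF (dz _ geo) (dz _ geo') C C' st cQ tt).
Qed.

(** The windows of [strict_window], each with its own chart, are chained by
    continuous induction. *)
Lemma strict_propagates a b : dom a (gam0 0) -> dom b (gam0 1) ->
  strict_at a 0 -> strict_at b 1.
Proof.
move=> a0 b1 H0.
pose A t := exists2 c, dom c (gam0 t) & strict_at c t.
have zero1 : 0 <= (0 : R) <= 1 by rewrite lexx ler01.
have one1 : 0 <= (1 : R) <= 1 by rewrite lexx ler01.
suff : forall t : R, 0 <= t <= 1 -> A t.
  by move=> /(_ 1 one1)[c c1 H]; exact: (strict_at_chart one1 c1 b1 H).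
have win tau : 0 <= tau <= 1 -> exists2 d, 0 < d & forall s t, 0 <= s -> s <= t ->
    t <= 1 -> `|tau - s| < d -> `|tau - t| < d -> A s -> A t.
  move=> t01; have [d d0 Hd] := strict_window t01 (chart_at_dom (gam0 tau)).
  exists d; first exact: d0.
  move=> s t s0 st t1 ds dt [c cs Hs].
  have [das dat H] := Hd s t s0 st t1 ds dt.
  exists (chart_at (gam0 tau)); first exact: dat.
  by apply: H; apply: (strict_at_chart _ cs das Hs); rewrite s0 (le_trans st).
apply: real_induction => [|t /andP[t0 t1] At|t /andP[t0 t1] H].
- by exists a.
- have [d d0 Hd] := win t (ltac:(by rewrite t0 ltW)).
  exists d; first exact: d0.
  move=> s /andP[ts sd] s1; apply: (Hd t s) => //; first exact: ltW.
    by rewrite subrr normr0.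
  by rewrite distrC gtr0_norm ?subr_gt0//; lra.
- have [d d0 Hd] := win t (ltac:(by rewrite t1 ltW)).
  pose s := Num.max 0 (t - d / 2).
  have s0 : 0 <= s by rewrite le_max lexx.
  have sd : t - d / 2 <= s by rewrite le_max lexx orbT.
  have st : s < t by rewrite gt_max t0 ltrBlDr ltrDl divr_gt0.
  apply: (Hd s t) => //; first exact: ltW.
    by rewrite gtr0_norm ?subr_gt0//; lra.
    by rewrite subrr normr0.
  by apply: H; rewrite s0.
Qed.

End window.

(** * The exponential map: uniqueness, homogeneity and regularity along curves *)
Section has_deriv.
Context (R : realType) (V : normedModType R).
Implicit Types (D : set R) (x : R -> V).

Lemma has_derivP D x t v : has_deriv D x t v <->
  forall e, 0 < e -> exists2 d, 0 < d & forall s, D s -> s != t -> `|t - s| < d ->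
    `|v - (s - t)^-1 *: (x s - x t)| <= e.
Proof.
split=> [/cvgrPdist_le H e e0|H].
  have := H e e0; rewrite near_withinE near_withinE => /nbhs_ballP[d /= d0 Hd].
  exists d; first exact: d0.
  by move=> s Ds st ts; exact: (Hd s ts st Ds).
apply/cvgrPdist_le => e e0; have [d d0 Hd] := H e e0.
rewrite near_withinE near_withinE; apply/nbhs_ballP; exists d; first exact: d0.
by move=> s ts st Ds; exact: (Hd s Ds st ts).
Qed.

Lemma is_derive_has_deriv D x t v : is_derive t (1 : R) x v -> has_deriv D x t v.
Proof.
move=> dx; apply/has_derivP => e e0.
have [d /= d0 Hd] := (nbhs_ballP _ _).1 (is_derive_near dx e0).
exists d => // s Ds st ts; have /= := Hd s ts.
have st0 : s - t != 0 by rewrite subr_eq0.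
have -> : x s - x t - (s - t) *: v = (s - t) *: ((s - t)^-1 *: (x s - x t) - v).
  by rewrite scalerBr scalerA divff// scale1r.
by rewrite normrZ mulrC ler_pM2r ?normr_gt0// distrC.
Qed.

Lemma has_deriv_is_derive D x t v : nbhs t D -> has_deriv D x t v ->
  is_derive t (1 : R) x v.
Proof.
move=> /nbhs_ballP[r /= r0 Dr] /has_derivP H.
have c : (fun k : R => k^-1 *: (x (k *: (1 : R) + t) - x t)) @ 0^' --> v.
  apply/cvgrPdist_le => e e0; have [d d0 Hd] := H e e0.
  rewrite near_withinE; apply/nbhs_ballP.
  exists (Num.min r d); first by rewrite /= lt_min r0.
  move=> k; rewrite /ball/= sub0r normrN lt_min => /andP[kr kd] k0.
  have E : k *: (1 : R) = k by rewrite /GRing.scale/= mulr1.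
  have := Hd (k + t); rewrite E addrK; apply.
  - by apply: Dr; rewrite /ball/= opprD addrCA subrr addr0 normrN.
  - by rewrite -subr_eq0 addrK.
  - by rewrite opprD addrCA subrr addr0 normrN.
by split; [apply/cvg_ex; exists v|apply/cvg_lim].
Qed.

End has_deriv.

Section Exp_family.
Context (R : realType) (n : nat) (M : smoothManifold R n)
  (g : riemannianMetric M) (q : M).

Lemma exp_rel_state (v : tangent q) y : exp_rel g v y ->
  exists gam : R -> M, [/\ is_geodesic g `[0, 1] gam, gam 0 = q,
    state (chart_at q) gam 0 = (phi (chart_at q) q, v) & gam 1 = y].
Proof.
move=> [gam [e [e0 geo g0 vel g1]]].
exists gam; split => //.
  move=> t; rewrite /= in_itv /= => /andP[t0 t1]; apply: geo.
  rewrite /= in_itv /=; apply/andP; split; first by apply: lt_le_trans t0; rewrite oppr_lt0.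
  by apply: le_lt_trans t1 _; rewrite ltrDl.
case: vel => _; rewrite g0 => vel.
have n0 : nbhs (0 : R) `]- e, 1 + e[%classic.
  apply: open_nbhs_nbhs; split; first exact: interval_open.
  by rewrite /= in_itv /= oppr_lt0 e0 addr_gt0.
have [_ E] := has_deriv_is_derive n0 vel.
by rewrite /state g0 derive1E E.
Qed.

Section family.
Context (I : Type) (G : set_system I) {PG : ProperFilter G}.
Variables (v v' : I -> 'rV[R]_n) (w : 'rV[R]_n) (y y' : I -> M) (y0 : M) (h : I -> R).
Hypotheses (vy : forall i, exp_rel g (v i : tangent q) (y i))
  (vy' : forall i, exp_rel g (v' i : tangent q) (y' i))
  (wy : exp_rel g (w : tangent q) y0).
Hypotheses (vw : v @ G --> w) (vw' : v' @ G --> w)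
  (cQ : cauchy_fam G (fun i => (h i)^-1 *: (v i - v' i))).

(** The exponential map has no smoothness beyond the injectivity radius by
    definition; along a family of vectors on which it is defined, it inherits the
    regularity of the family because geodesics depend strictly differentiably on
    their initial state. *)
Lemma exp_rel_family b : dom b y0 ->
  [/\ \forall i \near G, dom b (y i), (fun i => phi b (y i)) @ G --> phi b y0 &
   cauchy_fam G (fun i => (h i)^-1 *: (phi b (y i) - phi b (y' i)))].
Proof.
move=> b0.
have [gam Hgam] := choice (fun i => exp_rel_state (vy i)).
have [gam' Hgam'] := choice (fun i => exp_rel_state (vy' i)).
have [gam0 [geo0 g00 s0 g01]] := exp_rel_state wy.
have geo i : is_geodesic g `[0, 1] (gam i) by case: (Hgam i).
have geo' i : is_geodesic g `[0, 1] (gam' i) by case: (Hgam' i).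
pose a := chart_at q.
have S i : state a (gam i) 0 = (phi a q, v i) by case: (Hgam i).
have S' i : state a (gam' i) 0 = (phi a q, v' i) by case: (Hgam' i).
have a0 : dom a (gam0 0) by rewrite g00; exact: chart_at_dom.
have b1 : dom b (gam0 1) by rewrite g01.
have P (u : I -> 'rV[R]_n) : u @ G --> w ->
    (fun i => (phi a q, u i)) @ G --> (phi a q, w).
  by move=> uw; have cc : (fun=> phi a q) @ G --> phi a q by [exact: cvg_cst]; exact: (cvg_pair cc uw).
have st : strict_at G gam0 gam gam' h a 0.
  split.
  - split.
      by apply: nearW => i; case: (Hgam i) => _ -> _ _; exact: chart_at_dom.
    rewrite s0 (_ : (fun i => _) = (fun i => (phi a q, v i))); first exact: P.
    by apply/funext => i; rewrite S.
  - split.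
      by apply: nearW => i; case: (Hgam' i) => _ -> _ _; exact: chart_at_dom.
    rewrite s0 (_ : (fun i => _) = (fun i => (phi a q, v' i))); first exact: P.
    by apply/funext => i; rewrite S'.
  - move=> e e0; have [A GA HA] := cQ e0; exists A => // i j Ai Aj.
    rewrite !S !S' prod_normE /= !subrr !scaler0 subrr normr0.
    by rewrite ge_max HA// andbT ltW.
have [[d1 c1] _ cQ1] := strict_propagates geo0 geo geo' a0 b1 st.
have E i : gam i 1 = y i by case: (Hgam i).
have E' i : gam' i 1 = y' i by case: (Hgam' i).
split.
- by apply: filterS d1 => i; rewrite E.
- have := cvg_comp _ _ c1 (sdiff_continuous (sdiff_fst (state b gam0 1))).
  by rewrite /= g01; under [X in X @ _ --> _ -> _]eq_fun do rewrite /= E.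
- move=> e e0; have [A GA HA] := cQ1 e e0; exists A => // i j Ai Aj.
  have := HA i j Ai Aj; rewrite prod_normE /= ge_max => /andP[+ _].
  by rewrite !E !E'.
Qed.

End family.

(** Uniqueness of geodesics is the case of a constant family in
    [exp_rel_family]: a constant that converges to [y1] is equal to [y1]. *)
Lemma exp_rel_unique (v : tangent q) y1 y2 :
  exp_rel g v y1 -> exp_rel g v y2 -> y1 = y2.
Proof.
move=> H1 H2.
have PG : ProperFilter (globally [set: unit]) by apply: (globally_properfilter (a := tt)).
have [||| d c _] := @exp_rel_family unit _ PG (fun=> v) (fun=> v) v
  (fun=> y2) (fun=> y2) y1 (fun=> 1) (fun=> H2) (fun=> H2) H1 _ _ _ (chart_at y1)
  (chart_at_dom y1).
- exact: cvg_cst.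
- exact: cvg_cst.
- move=> e e0; exists setT; first by exact: filterT.
  by move=> i j _ _; rewrite subrr normr0 ltW.
have [_ d2] := filter_ex d.
have E : phi (chart_at y1) y2 = phi (chart_at y1) y1.
  by apply: (cvg_unique _ _ c) => //; exact: cvg_cst.
by rewrite -[y1](phiK (chart_at_dom y1)) -E phiK.
Qed.

Lemma exp_relE (v : tangent q) y : exp_rel g v y -> Exp g q v = y.
Proof.
move=> H; apply: (exp_rel_unique _ H).
exact: (@xgetPex _ q [set y : M | exp_rel g v y] (ex_intro _ y H)).
Qed.

Lemma exp_dom_rel (v : tangent q) : exp_dom g q v -> exp_rel g v (Exp g q v).
Proof. by move=> [y H]; exact: (@xgetPex _ q [set y : M | exp_rel g v y] (ex_intro _ y H)). Qed.

End Exp_family.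

Section homogeneity.
Context (R : realType) (n : nat) (M : smoothManifold R n)
  (g : riemannianMetric M).

(** Homogeneity of degree two, which makes affine changes of time preserve
    geodesics. *)
Lemma christoffelZ a y (k : R) (u : 'rV[R]_n) : (phi a @` dom a) y ->
  christoffel g a y (k *: u) (k *: u) = (k * k) *: christoffel g a y u u.
Proof.
move=> ay; have dg := gmx_differentiable g ay.
pose r (w : 'rV[R]_n) := \row_(l < n) (2^-1 * ((w *m 'D_w (gmx g a) y) 0 l
  + (w *m 'D_w (gmx g a) y) 0 l
  - (w *m 'D_(delta_mx 0 l) (gmx g a) y *m w^T) 0 0)).
have DE : 'D_(k *: u) (gmx g a) y = k *: 'D_u (gmx g a) y.
  by rewrite !deriveE// linearZ.
have E : r (k *: u) = (k * k) *: r u.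
  apply/rowP => l; rewrite [LHS]mxE [RHS]mxE [in RHS]mxE DE.
  have h1 (A : 'M[R]_n) : (k *: u) *m (k *: A) = (k * k) *: (u *m A).
    by rewrite -scalemxAl -scalemxAr scalerA.
  have h2 (A : 'M[R]_n) : (k *: u) *m A *m (k *: u)^T = (k * k) *: (u *m A *m u^T).
    by rewrite [(k *: u)^T]linearZ /= -!scalemxAl -scalemxAr scalerA.
  have mxZ p p' (c : R) (X : 'M[R]_(p, p')) i j : (c *: X) i j = c * X i j.
    by rewrite mxE.
  rewrite h1 h2 !mxZ; ring.
change (r (k *: u) *m invmx (gmx g a y) = (k * k) *: (r u *m invmx (gmx g a y))).
by rewrite E scalemxAl.
Qed.

Lemma is_derive_dilation (V : normedModType R) (x : R -> V) (k s : R) dx :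
  is_derive (k * s) (1 : R) x dx -> is_derive s (1 : R) (fun r => x (k * r)) (k *: dx).
Proof.
move=> [/derivable1_diffP Dx Ex].
have H : is_derive s (1 : R) (fun r : R => k * r) k.
  by apply: is_derive_eq; rewrite /GRing.scale/= mulr1.
have := is_derive_diff_comp Dx H.
by rewrite -[X in 'd _ _ X](mulr1 k) linearZ /= -deriveE// Ex.
Qed.

Lemma geodesic_dilation (D D' : set R) (gam : R -> M) (k : R) :
  open D -> is_geodesic g D gam -> (forall s, D' s -> D (k * s)) ->
  is_geodesic g D' (fun s => gam (k * s)).
Proof.
move=> oD geo DD' s Ds; have Dks := DD' s Ds.
have [cg H] := geo _ Dks.
have ck : {for s, continuous (fun r : R => k * r)} by exact: mulrl_continuous.
split; first exact: (continuous_comp ck cg).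
move=> a da; have [d1 d2 cov] := H a da; move=> x.
pose X := phi a \o gam.
have dX r : D (k * r) -> dom a (gam (k * r)) ->
    is_derive r (1 : R) x (k *: derive1 X (k * r)).
  move=> Dr dr; have [_ /(_ a dr)[h1 _ _]] := geo _ Dr.
  exact: (is_derive_dilation (is_derive_derive1 h1)).
have nD : \forall r \near s, D (k * r) /\ dom a (gam (k * r)).
  have n1 := ck _ (open_nbhs_nbhs (conj oD Dks)).
  have n2 := dom_near (continuous_comp ck cg : {for s, continuous (gam \o (fun r => k * r))}) da.
  near=> r; split; near: r; [exact: n1|exact: n2].
have nx : \forall r \near s, k *: derive1 X (k * r) = derive1 x r.
  by apply: filterS nD => r [Dr dr]; have [_ <-] := dX r Dr dr; rewrite derive1E.
have d2x : is_derive s (1 : R) (derive1 x) (k *: (k *: derive1 (derive1 X) (k * s))).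
  apply: near_eq_is_derive nx _; apply: is_deriveZ.
  exact: (is_derive_dilation (is_derive_derive1 d2)).
have [d1x e1x] := dX s Dks da.
split; [exact: d1x|by case: d2x|].
rewrite /covD !derive1E; case: d2x => _ ->; rewrite -/x e1x.
rewrite christoffelZ; last by exists (gam (k * s)).
move: cov; rewrite /covD -/X => /eqP; rewrite addr_eq0 => /eqP ->.
by rewrite scalerA scalerN addNr.
Unshelve. all: by end_near. Qed.

(** The geodesic with initial velocity [v] is [t |-> Exp (t v)], on a
    neighbourhood of the unit interval. *)
Lemma exp_geodesic (q : M) (v : tangent q) : exp_dom g q v ->
  exists gam e, [/\ 0 < e, is_geodesic g `]- e, 1 + e[ gam, gam 0 = q,
    is_derive (0 : R) (1 : R) (phi (chart_at q) \o gam) v &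
    forall t, - e < t < 1 + e -> exp_rel g (t *: v : tangent q) (gam t)].
Proof.
move=> [y [gam [e [e0 geo g0 vel g1]]]].
have n0 : nbhs (0 : R) `]- e, 1 + e[%classic.
  apply: open_nbhs_nbhs; split; first exact: interval_open.
  by rewrite /= in_itv /= oppr_lt0 e0 addr_gt0.
have dv : is_derive (0 : R) (1 : R) (phi (chart_at q) \o gam) v.
  by case: vel => _; rewrite g0; exact: has_deriv_is_derive.
exists gam, e; split => // t /andP[te t1].
pose m := Num.min e (Num.min (t + e) (1 + e - t)).
have m0 : 0 < m by rewrite !lt_min e0; apply/andP; split => //; apply/andP; split; lra.
have [m1 m2 m3] : [/\ m <= e, m <= t + e & m <= 1 + e - t].
  by rewrite /m !ge_min !lexx !orbT.
(* m is the room left around 0 and t in ]- e, 1 + e[; dividing by |t| + 1 keeps t times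
   the enlarged unit interval inside. *)
pose e' := m / (`|t| + 1).
have t10 : 0 < `|t| + 1 by rewrite ltr_wpDl.
have e'0 : 0 < e' by rewrite divr_gt0.
have te' : `|t| * e' < m.
  have -> : m = (`|t| + 1) * e' by rewrite /e' mulrC divfK// gt_eqF.
  by rewrite mulrDl ltrDl mul1r.
have sub s : `]- e', 1 + e'[%classic s -> `]- e, 1 + e[%classic (t * s).
  rewrite /= !in_itv /= => /andP[s1 s2]; apply/andP.
  have [tp|tn] := leP 0 t.
    move: te'; rewrite ger0_norm// => te'.
    have h1 : t * - e' <= t * s by rewrite ler_wpM2l// ltW.
    have h2 : t * s <= t * (1 + e') by rewrite ler_wpM2l// ltW.
    by split; lra.
  move: te'; rewrite ltr0_norm// => te'.
  have h1 : t * s <= t * - e' by rewrite ler_wnM2l// ltW.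
  have h2 : t * (1 + e') <= t * s by rewrite ler_wnM2l// ltW.
  by split; lra.
exists (fun s => gam (t * s)), e'; split.
- exact: e'0.
- exact: (geodesic_dilation (interval_open _ _) geo sub).
- by rewrite mulr0.
- have d' : is_derive (0 : R) (1 : R) (phi (chart_at q) \o (fun s => gam (t * s))) (t *: v).
    by apply: (@is_derive_dilation _ (phi (chart_at q) \o gam)); rewrite mulr0.
  split; last by rewrite mulr0 g0; exact: is_derive_has_deriv.
  have Ds : `]- e, 1 + e[%classic (t * 0) by apply: sub; rewrite /= in_itv /= oppr_lt0 e'0 addr_gt0.
  have [cg _] := geo _ Ds.
  apply: cvg_within_filter.
  have ck : {for (0 : R), continuous (fun r : R => t * r)} by exact: mulrl_continuous.
  exact: (continuous_comp ck cg).
- by rewrite mulr1.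
Qed.

End homogeneity.

Section off_diagonal.
Context (R : realType).
Implicit Types (D : set R).

(** The filter of pairs of distinct points of [D] tending to [s0].  Convergence
    of the difference quotients along it gives both the derivative at [s0] and
    the continuity of the derivative there. *)
Definition off_diagonal D (s0 : R) : set_system (R * R) :=
  fun P => exists2 d, 0 < d & forall s s', D s -> D s' -> s != s' ->
    `|s0 - s| < d -> `|s0 - s'| < d -> P (s, s').

Lemma off_diagonal_filter D s0 :
  (forall d, 0 < d -> exists s, [/\ D s, s != s0 & `|s0 - s| < d]) -> D s0 ->
  ProperFilter (off_diagonal D s0).
Proof.
move=> lim Ds0; split.
  move=> [d d0 Hd]; have [s [Ds ss0 sd]] := lim d d0.
  by apply: (Hd s s0) => //; rewrite subrr normr0.
split.
- by exists 1.
- move=> P Q [d d0 Hd] [d' d'0 Hd']; exists (Num.min d d'); first by rewrite lt_min d0.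
  move=> s s' Ds Ds' ss'; rewrite !lt_min => /andP[h1 h2] /andP[h3 h4].
  by split; [exact: Hd|exact: Hd'].
- by move=> P Q PQ [d d0 Hd]; exists d => // s s' Ds Ds' ss' h1 h2; apply: PQ; exact: Hd.
Qed.

Lemma off_diagonal_fst D s0 : fst @ off_diagonal D s0 --> s0.
Proof.
move=> P /nbhs_ballP[d /= d0 Hd]; exists d => // s s' _ _ _ h1 _.
exact: Hd.
Qed.

Lemma off_diagonal_snd D s0 : snd @ off_diagonal D s0 --> s0.
Proof.
move=> P /nbhs_ballP[d /= d0 Hd]; exists d => // s s' _ _ _ _ h1.
exact: Hd.
Qed.

Definition strict_deriv (V : normedModType R) D (x : R -> V) (s0 : R) (l : V) : Prop :=
  forall e, 0 < e -> exists2 d, 0 < d & forall s s', D s -> D s' -> s != s' ->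
    `|s0 - s| < d -> `|s0 - s'| < d -> `|(s - s')^-1 *: (x s - x s') - l| <= e.

Lemma strict_deriv_has_deriv (V : normedModType R) D (x : R -> V) s0 l :
  D s0 -> strict_deriv D x s0 l -> has_deriv D x s0 l.
Proof.
move=> Ds0 H; apply/has_derivP => e e0; have [d d0 Hd] := H e e0.
exists d => // s Ds ss0 sd; rewrite distrC; apply: Hd => //.
by rewrite subrr normr0.
Qed.

End off_diagonal.

Section curve.
Context (R : realType) (n : nat) (M : smoothManifold R n)
  (g : riemannianMetric M) (q : M).
Context (t0 t1 : R) (h : R -> 'rV[R]_n).
Hypothesis t01 : t0 < t1.
Hypothesis sh : forall s, sdiff h s.
Hypothesis eh : forall t, t0 <= t <= t1 -> exp_dom g q (h t : tangent q).

Let D := `[t0, t1]%classic.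
Let c (t : R) := Exp g q (h t : tangent q).

Lemma itv_limit_point t : D t -> forall d, 0 < d ->
  exists s, [/\ D s, s != t & `|t - s| < d].
Proof.
rewrite /D /= in_itv /= => /andP[tt0 tt1] d d0.
have [lt|ge] := ltP t t1.
  pose s := Num.min t1 (t + d / 2).
  have s1 : s <= t1 by rewrite ge_min lexx.
  have s2 : s <= t + d / 2 by rewrite ge_min lexx orbT.
  have s3 : t < s by rewrite lt_min lt ltrDl divr_gt0.
  exists s; split; first by rewrite /= in_itv /= s1 (le_trans tt0 (ltW s3)).
    by rewrite gt_eqF.
  by rewrite distrC gtr0_norm ?subr_gt0//; lra.
pose s := Num.max t0 (t - d / 2).
have s1 : t0 <= s by rewrite le_max lexx.
have s2 : t - d / 2 <= s by rewrite le_max lexx orbT.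
have s3 : s < t by rewrite gt_max (lt_le_trans t01 ge) ltrBlDr ltrDl divr_gt0.
exists s; split; first by rewrite /= in_itv /= s1 (le_trans (ltW s3)).
  by rewrite lt_eqF.
by rewrite gtr0_norm ?subr_gt0//; lra.
Qed.

(** The vectors [h s] are modified outside [D], where the exponential may be
    undefined at them, so as to get families indexed by all real numbers. *)
Lemma Exp_curve_local s0 b : D s0 -> dom b (c s0) ->
  [/\ \forall s \near within D (nbhs s0), dom b (c s),
      (fun s => phi b (c s)) @ within D (nbhs s0) --> phi b (c s0) &
      exists l, strict_deriv D (fun s => phi b (c s)) s0 l].
Proof.
move=> Ds0 b0.
pose h' s := if `[< D s >] then h s else h s0.
have hD s : D s -> h' s = h s by move=> Ds; rewrite /h' asboolT.
have e' s : exp_rel g (h' s : tangent q) (Exp g q (h' s : tangent q)).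
  apply: exp_dom_rel; rewrite /h'; case: asboolP => [Ds|_]; apply: eh.
    by move: Ds; rewrite /D /= in_itv.
  by move: Ds0; rewrite /D /= in_itv.
have cD s : D s -> Exp g q (h' s : tangent q) = c s by move=> Ds; rewrite hD.
have e0 : exp_rel g (h s0 : tangent q) (c s0).
  by have := e' s0; rewrite hD.
have ch := sdiff_continuous (sh s0).
have PG := off_diagonal_filter (itv_limit_point Ds0) Ds0.
have PW : ProperFilter (within D (nbhs s0)).
  apply: within_nbhs_proper; exact: subset_closure.
have h1 : h' s @[s --> within D (nbhs s0)] --> h s0.
  have ch' : h @ within D (nbhs s0) --> h s0 by exact: cvg_within_filter ch.
  apply/cvgrPdist_lt => e ee; move/cvgrPdist_lt: ch' => /(_ e ee).
  rewrite !near_withinE; apply: filterS => s Hs Ds.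
  by rewrite hD//; exact: Hs.
have cQ0 : cauchy_fam (within D (nbhs s0)) (fun s => 1^-1 *: (h' s - h' s)).
  move=> e ee; exists setT; first exact: filterT.
  by move=> i j _ _; rewrite !subrr normr0 ltW.
have [d1 c1 _] := exp_rel_family e' e' e0 h1 h1 cQ0 b0.
have hl (f : R * R -> R) : f @ off_diagonal D s0 --> s0 ->
    (\forall p \near off_diagonal D s0, D (f p)) ->
    (fun p => h' (f p)) @ off_diagonal D s0 --> h s0.
  move=> fs fD; apply/cvgrPdist_lt => e ee.
  have fch := cvg_comp _ _ fs ch; move/cvgrPdist_lt: fch => /(_ e ee) fch.
  by near=> p; rewrite hD; near: p.
have D1 : \forall p \near off_diagonal D s0, D p.1 by exists 1.
have D2 : \forall p \near off_diagonal D s0, D p.2 by exists 1.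
have D3 : \forall p \near off_diagonal D s0, p.1 != p.2 by exists 1.
have cQ : cauchy_fam (off_diagonal D s0)
    (fun p => (p.1 - p.2)^-1 *: (h' p.1 - h' p.2)).
  have cc : cauchy_fam (off_diagonal D s0) (fun p => (p.1 - p.2)^-1 *: (p.1 - p.2) : R).
    move=> e ee; exists [set p | p.1 != p.2]; first exact: D3.
    move=> p p' /= pp pp'; rewrite /GRing.scale /= !mulVf ?subr_eq0// subrr normr0.
    exact: ltW.
  have := sdiff_cauchy_fam (sh s0) (@off_diagonal_fst _ D s0) (@off_diagonal_snd _ D s0) cc.
  move=> H e ee; have [A GA HA] := H PG e ee.
  exists (A `&` ([set p | D p.1] `&` [set p | D p.2])).
    exact: (filterI GA (filterI D1 D2)).
  by move=> p p' [Ap [/= ? ?]] [Ap' [/= ? ?]]; rewrite !hD//; exact: HA.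
have [_ _ cE] := @exp_rel_family _ _ _ g q _ _ PG
  (fun p => h' p.1) (fun p => h' p.2) (h s0) _ _ (c s0) (fun p => p.1 - p.2)
  (fun p => e' p.1) (fun p => e' p.2) e0 (hl _ (@off_diagonal_fst _ D s0) D1)
  (hl _ (@off_diagonal_snd _ D s0) D2) cQ b b0.
have [l Hl] := cauchy_fam_mx cE.
split.
- near=> s.
  have Ds : D s by near: s; exact: withinT.
  rewrite -(cD s Ds); near: s; exact: d1.
- apply/cvgrPdist_lt => e ee; move/cvgrPdist_lt: c1 => /(_ e ee) c1.
  near=> s.
  have Ds : D s by near: s; exact: withinT.
  rewrite -(cD s Ds); near: s; exact: c1.
- exists l => e ee; move/cvgrPdist_le: Hl => /(_ e ee)[d d0 Hd].
  exists d => // s s' Ds Ds' ss' a1 a2.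
  by have /= := Hd s s' Ds Ds' ss' a1 a2; rewrite distrC !cD.
Unshelve. all: by end_near. Qed.

(** At each point the quotients converge along pairs of points; the limits
    form the derivative, and comparing the limits at two nearby points shows that
    it is continuous. *)
Lemma Exp_curve_C1 : curve_C1 D c.
Proof.
split.
  move=> t Dt; have ct := chart_at_dom (c t).
  have [d1 c1 _] := Exp_curve_local Dt ct.
  have ay : (phi (chart_at (c t)) @` dom (chart_at (c t))) (phi (chart_at (c t)) (c t)).
    by exists (c t).
  have := cvg_comp _ _ c1 (psi_continuous ay); rewrite /= phiK//.
  apply: cvg_trans; apply: near_eq_cvg; apply: filterS d1 => s ds /=.
  by rewrite phiK.
move=> a.
have : forall t, exists l, D t -> dom a (c t) -> strict_deriv D (fun s => phi a (c s)) t l.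
  move=> t; have [[Dt dt]|no] := pselect (D t /\ dom a (c t)).
    by have [_ _ [l Hl]] := Exp_curve_local Dt dt; exists l.
  by exists 0 => Dt dt; case: no.
move=> /choice[dx Hdx]; exists dx => t Dt dt.
have S := Hdx t Dt dt.
split; first exact: strict_deriv_has_deriv.
apply/cvgrPdist_le => e e0.
have e2 : 0 < e / 2 by rewrite divr_gt0.
have [d d0 Hd] := S _ e2.
rewrite near_withinE; apply/nbhs_ballP; exists (d / 2); first by rewrite /= divr_gt0.
move=> s ts [Ds /= ds]; have [d' d'0 Hd'] := Hdx s Ds ds _ e2.
have m0 : 0 < Num.min d' (d / 2) by rewrite lt_min d'0 divr_gt0.
have [r [Dr rs sr]] := itv_limit_point Ds m0.
move: sr; rewrite lt_min => /andP[sr1 sr2].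
have ss : `|s - s| < d' by rewrite subrr normr0.
have h1 := Hd' r s Dr Ds rs sr1 ss.
have ts' : `|t - s| < d / 2 by exact: ts.
have td : `|t - s| < d by lra.
have tr : `|t - r| < d.
  rewrite -(subrK s t) -addrA; apply: le_lt_trans (ler_normD _ _) _; lra.
have h2 := Hd r s Dr Ds rs tr td.
set Q := (_ *: _) in h1 h2.
rewrite -(subrK Q (dx t)) -addrA; apply: le_trans (ler_normD _ _) _.
by rewrite (splitr e) distrC; apply: lerD.
Qed.

End curve.

(** * Symmetry of second derivatives and derivatives of matrix products *)
Section schwarz.
Context (R : realType) (V W : normedModType R).
Implicit Types (f : V -> W).

Lemma is_sdiff_derive f y A u : is_sdiff f y A -> is_derive y u f (A u).
Proof.
move=> [linA [C C0 AC] H].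
have c : (fun k : R => k^-1 *: (f (k *: u + y) - f y)) @ 0^' --> A u.
  have [->|u0] := eqVneq u 0.
    rewrite (linpred0 linA) (_ : (fun _ => _) = fun=> 0); first exact: cvg_cst.
    by apply/funext => k; rewrite scaler0 add0r subrr scaler0.
  have nu0 : 0 < `|u| by rewrite normr_gt0.
  apply/cvgrPdist_le => e e0.
  have /near_diagP[r r0 {}H] := H (e / `|u|) (divr_gt0 e0 nu0).
  rewrite near_withinE; apply/nbhs_ballP; exists (r / `|u|); first by rewrite /= divr_gt0.
  move=> k; rewrite /ball/= sub0r normrN => kr k0.
  have h1 : `|y - (k *: u + y)| < r.
    by rewrite opprD addrCA subrr addr0 normrN normrZ -ltr_pdivlMr.
  have := H _ y h1 (ltac:(by rewrite subrr normr0)); rewrite /= addrK.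
  rewrite (linpredZ linA) normrZ.
  have -> : f (k *: u + y) - f y - k *: A u =
     k *: (k^-1 *: (f (k *: u + y) - f y) - A u).
    by rewrite scalerBr scalerA divff// scale1r.
  rewrite normrZ mulrCA ler_pM2l ?normr_gt0// divfK ?gt_eqF//.
  by rewrite distrC.
by split; [apply/cvg_ex; exists (A u)|apply/cvg_lim].
Qed.

(** Mean value inequality for [theta |-> f (y + h w + theta v) - f (y + theta v)],
    whose derivative is an increment of ['D_v f]. *)
Lemma second_difference f y v w A : is_sdiff ('D_v f) y A ->
  (\forall z \near y, derivable f z v) -> forall e, 0 < e ->
  exists2 r, 0 < r & forall h, 0 < h < r ->
  `|f (y + h *: w + h *: v) - f (y + h *: v) - (f (y + h *: w) - f y)
    - (h * h) *: A w| <= e * (h * h) * `|w|.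
Proof.
move=> [linA _ H] df e e0; have /near_diagP[r r0 {}H] := H e e0.
have [r' /= r'0 Hr'] := (nbhs_ballP _ _).1 df.
pose s := Num.min r r'.
have s0 : 0 < s by rewrite lt_min r0.
have [sr sr'] : s <= r /\ s <= r' by rewrite /s !ge_min !lexx orbT.
have K0 : 0 < `|v| + `|w| + 1 by rewrite ltr_wpDl// addr_ge0.
exists (s / (`|v| + `|w| + 1)); first by rewrite divr_gt0.
move=> h /andP[h0 hs].
have hs' : h * (`|v| + `|w| + 1) < s by rewrite -ltr_pdivlMr.
have ball1 (a b : R) : 0 <= a <= h -> 0 <= b <= h -> `|y - (y + a *: w + b *: v)| < s.
  move=> /andP[a0 ah] /andP[b0 bh].
  rewrite -addrA opprD addrA subrr sub0r normrN.
  apply: le_lt_trans (ler_normD _ _) _; rewrite !normrZ !ger0_norm//.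
  apply: le_lt_trans hs'; rewrite !mulrDr mulr1.
  have h1 : a * `|w| <= h * `|w| by rewrite ler_wpM2r.
  have h2 : b * `|v| <= h * `|v| by rewrite ler_wpM2r.
  by lra.
have hh : 0 <= h <= h by rewrite lexx ltW.
have zh : 0 <= (0 : R) <= h by rewrite lexx ltW.
have dv (a b : R) : 0 <= a <= h -> 0 <= b <= h ->
    is_derive b (1 : R) (fun t => f (y + a *: w + t *: v)) ('D_v f (y + a *: w + b *: v)).
  move=> ah bh; apply: is_derive_line; apply: Hr'; rewrite -ball_normE /=.
  exact: lt_le_trans (ball1 a b ah bh) sr'.
pose G (t : R) := f (y + h *: w + t *: v) - f (y + (0 : R) *: w + t *: v) - t *: (h *: A w).
have := @mean_value_norm _ _ G
  (fun t => 'D_v f (y + h *: w + t *: v) - 'D_v f (y + (0 : R) *: w + t *: v) - h *: A w)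
  0 h (e * (h * `|w|)) (ltW h0).
have -> : G h - G 0 = f (y + h *: w + h *: v) - f (y + h *: v)
    - (f (y + h *: w) - f y) - (h * h) *: A w.
  by rewrite /G !scale0r !addr0 subr0 scalerA addrAC.
have -> : e * (h * `|w|) * (h - 0) = e * (h * h) * `|w| by ring.
apply.
  move=> t th; apply: is_deriveB; last exact: is_derive_scalel.
  by apply: is_deriveB; exact: dv.
move=> t th; have h1 := lt_le_trans (ball1 h t hh th) sr.
have h2 := lt_le_trans (ball1 0 t zh th) sr.
have := H _ _ h1 h2; rewrite /=.
have -> : y + h *: w + t *: v - (y + (0 : R) *: w + t *: v) = h *: w.
  by rewrite scale0r addr0 opprD addrACA subrr addr0 addrC addKr.
by rewrite (linpredZ linA) normrZ gtr0_norm.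
Qed.

(** The second difference of [f] in the directions [v] and [w] is symmetric in
    [v] and [w], and both mixed derivatives are its limit. *)
Lemma schwarz f y v w :
  (\forall z \near y, derivable f z v) -> (\forall z \near y, derivable f z w) ->
  sdiff ('D_v f) y -> sdiff ('D_w f) y ->
  'D_w ('D_v f) y = 'D_v ('D_w f) y.
Proof.
move=> dv dw [A sA] [A' sA'].
have [_ ->] := is_sdiff_derive w sA; have [_ ->] := is_sdiff_derive v sA'.
apply/eqP; rewrite -subr_eq0 -normr_le0; apply/ler_addgt0Pr => e e0.
have K0 : 0 < `|v| + `|w| + 1 by rewrite ltr_wpDl// addr_ge0.
pose e' := e / (`|v| + `|w| + 1).
have e'0 : 0 < e' by rewrite divr_gt0.
have [r r0 H] := second_difference w sA dv e'0.
have [r' r'0 H'] := second_difference v sA' dw e'0.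
pose h := Num.min r r' / 2.
have m0 : 0 < Num.min r r' by rewrite lt_min r0.
have [m1 m2] : Num.min r r' <= r /\ Num.min r r' <= r' by rewrite !ge_min !lexx orbT.
have h0 : 0 < h by rewrite divr_gt0.
have := H h (ltac:(by rewrite h0 /h; lra)).
have := H' h (ltac:(by rewrite h0 /h; lra)).
set D1 := f _ - _ - _; set D2 := f _ - _ - _.
have <- : D1 = D2.
  rewrite /D1 /D2 [y + h *: v + _]addrAC !opprB.
  by rewrite -!addrA; congr (_ + _); rewrite addrCA [RHS]addrCA; congr (_ + _); rewrite addrC.
move=> b1 b2.
have : `|(h * h) *: (A w - A' v)| <= e' * (h * h) * `|w| + e' * (h * h) * `|v|.
  have -> : (h * h) *: (A w - A' v) = (D1 - (h * h) *: A' v) - (D1 - (h * h) *: A w).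
    by rewrite scalerBr opprB [RHS]addrC addrA subrK.
  by apply: le_trans (ler_normB _ _) _; rewrite addrC; exact: lerD.
have hh : 0 < h * h by rewrite mulr_gt0.
rewrite normrZ (gtr0_norm hh).
have -> : e' * (h * h) * `|w| + e' * (h * h) * `|v| = (h * h) * (e' * (`|v| + `|w|)) by ring.
rewrite ler_pM2l// add0r => le; apply: le_trans le _.
apply: le_trans (_ : e' * (`|v| + `|w| + 1) <= _).
  by apply: ler_wpM2l; [exact: ltW|rewrite lerDl].
by rewrite /e' divfK// gt_eqF.
Qed.

End schwarz.

Section matrix_derivative.
Context (R : realType).

Lemma is_derive_mxP m n (f : R -> 'M[R]_(m, n)) t (df : 'M[R]_(m, n)) :
  (forall i j, is_derive t (1 : R) (fun s => f s i j) (df i j)) <->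
  is_derive t (1 : R) f df.
Proof.
split=> [H|[Df Ef] i j].
  have Df : derivable f t 1 by apply/derivable_mxP => i j; case: (H i j).
  split => //; rewrite derive_mx//; apply/matrixP => i j; rewrite mxE.
  by case: (H i j).
split; first by move/derivable_mxP: Df; exact.
by rewrite -Ef derive_mx// mxE.
Qed.

Lemma is_derive_mulmx m n p (f : R -> 'M[R]_(m, n)) (h : R -> 'M[R]_(n, p)) t
    (df : 'M[R]_(m, n)) (dh : 'M[R]_(n, p)) :
  is_derive t (1 : R) f df -> is_derive t (1 : R) h dh ->
  is_derive t (1 : R) (fun s => f s *m h s) (df *m h t + f t *m dh).
Proof.
move=> /is_derive_mxP Hf /is_derive_mxP Hh; apply/is_derive_mxP => i j.
rewrite (_ : (fun s => _) = \sum_(k < n) (fun s => f s i k * h s k j)); last first.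
  by apply/funext => s; rewrite mxE fct_sumE.
rewrite !mxE -big_split /=; apply: is_derive_sum => k.
have := is_deriveM (Hf i k) (Hh k j) => H; apply: (is_derive_eq H).
by rewrite [LHS]addrC; congr (_ + _); exact: mulrC.
Qed.

Lemma is_derive_trmx m n (f : R -> 'M[R]_(m, n)) t (df : 'M[R]_(m, n)) :
  is_derive t (1 : R) f df -> is_derive t (1 : R) (fun s => (f s)^T) df^T.
Proof.
move=> /is_derive_mxP Hf; apply/is_derive_mxP => i j; rewrite mxE.
by under eq_fun do rewrite mxE.
Qed.

End matrix_derivative.

(** * The metric in charts and the speed of geodesics *)
Section metric_form.
Context (R : realType) (n : nat) (M : smoothManifold R n)
  (g : riemannianMetric M).
Implicit Types (a b : chart_index M) (y u v w : 'rV[R]_n).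

Definition metric_form a y u w : R := (u *m gmx g a y *m w^T) 0 0.

Lemma metric_formDl a y u v w :
  metric_form a y (u + v) w = metric_form a y u w + metric_form a y v w.
Proof. by rewrite /metric_form !mulmxDl mxE. Qed.

Lemma metric_formZl a y k u w :
  metric_form a y (k *: u) w = k * metric_form a y u w.
Proof. by rewrite /metric_form -!scalemxAl mxE. Qed.

Lemma metric_formC a y u w : (phi a @` dom a) y ->
  metric_form a y u w = metric_form a y w u.
Proof.
move=> ay; rewrite /metric_form.
have -> : w *m gmx g a y *m u^T = (u *m gmx g a y *m w^T)^T.
  by rewrite !trmx_mul trmxK (gmx_sym g ay) mulmxA.
by rewrite [RHS]mxE.
Qed.

Lemma metric_formDr a y u v w : (phi a @` dom a) y ->
  metric_form a y u (v + w) = metric_form a y u v + metric_form a y u w.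
Proof. by move=> ay; rewrite !(metric_formC u)// metric_formDl. Qed.

Lemma metric_formZr a y k u w : (phi a @` dom a) y ->
  metric_form a y u (k *: w) = k * metric_form a y u w.
Proof. by move=> ay; rewrite !(metric_formC u)// metric_formZl. Qed.

Lemma metric_form0l a y w : metric_form a y 0 w = 0.
Proof. by rewrite /metric_form !mul0mx mxE. Qed.

Lemma metric_form_ge0 a y u : (phi a @` dom a) y -> 0 <= metric_form a y u u.
Proof.
move=> ay; have [->|u0] := eqVneq u 0; first by rewrite metric_form0l.
exact: ltW (gmx_posdef g ay u0).
Qed.

(** The form is positive at [W u - B w], where [W] and [B] are its values at
    [(w, w)] and [(u, w)]. *)
Lemma metric_form_CS a y u w : (phi a @` dom a) y ->
  metric_form a y u w ^+ 2 <= metric_form a y u u * metric_form a y w w.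
Proof.
move=> ay; have [->|w0] := eqVneq w 0.
  by rewrite metric_formC// !metric_form0l mulr0 expr0n.
have ww := gmx_posdef g ay w0; rewrite -/(metric_form a y w w) in ww.
set W := metric_form a y w w in ww *; set B := metric_form a y u w.
have := metric_form_ge0 (W *: u + (- B) *: w) ay.
rewrite metric_formDl !metric_formDr// !metric_formZl !metric_formZr//.
rewrite (metric_formC w u)// -/B -/W; set U := metric_form a y u u.
have -> : W * (W * U) + W * (- B * B) + (- B * (W * B) + - B * (- B * W))
  = W * (U * W - B ^+ 2) by ring.
by rewrite pmulr_rge0// subr_ge0.
Qed.

Lemma metric_form_chart a b (x : M) u w : dom a x -> dom b x ->
  metric_form a (phi a x) u w =
  metric_form b (phi b x) ('d (transition a b) (phi a x) u) ('d (transition a b) (phi a x) w).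
Proof. by move=> ax bx; rewrite /metric_form (gmx_compat g ax bx). Qed.

Lemma metric_form_derive a (x u w : R -> 'rV[R]_n) t dx du dw :
  (phi a @` dom a) (x t) ->
  is_derive t (1 : R) x dx -> is_derive t (1 : R) u du -> is_derive t (1 : R) w dw ->
  is_derive t (1 : R) (fun s => metric_form a (x s) (u s) (w s))
   (metric_form a (x t) du (w t) + (u t *m 'D_dx (gmx g a) (x t) *m (w t)^T) 0 0
    + metric_form a (x t) (u t) dw).
Proof.
move=> ax hx hu hw; have dG := gmx_differentiable g ax.
have hG : is_derive t (1 : R) (gmx g a \o x) ('D_dx (gmx g a) (x t)).
  by rewrite deriveE//; exact: is_derive_diff_comp.
have H := is_derive_mulmx (is_derive_mulmx hu hG) (is_derive_trmx hw).
have /is_derive_mxP/(_ 0 0) H0 := H.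
apply: (is_derive_eq H0).
have mxD (X Y : 'M[R]_1) : (X + Y) 0 0 = X 0 0 + Y 0 0 by rewrite mxE.
by rewrite mulmxDl !mxD.
Qed.

(** The Koszul formula: pairing with the metric cancels the inverse matrix in
    the Christoffel symbols. *)
Lemma christoffel_form a y u w : (phi a @` dom a) y ->
  metric_form a y (christoffel g a y u u) w =
  (u *m 'D_u (gmx g a) y *m w^T) 0 0
   - 2^-1 * (u *m 'D_w (gmx g a) y *m u^T) 0 0.
Proof.
move=> ay; rewrite /metric_form /christoffel mulmxKV ?gmx_unit//.
have dG := gmx_differentiable g ay.
have -> : 'D_w (gmx g a) y = \sum_l w 0 l *: 'D_(delta_mx 0 l) (gmx g a) y.
  rewrite deriveE// {1}(row_sum_delta w) linear_sum; apply: eq_bigr => l _.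
  by rewrite linearZ deriveE.
rewrite mulmx_sumr mulmx_suml summxE mxE [X in X - _]mxE mulr_sumr -sumrB.
apply: eq_bigr => l _; rewrite -scalemxAr -scalemxAl.
have mxZ p p' (c : R) (X : 'M[R]_(p, p')) i j : (c *: X) i j = c * X i j by rewrite mxE.
rewrite mxZ [X in X * _]mxE [w^T _ _]mxE; by field.
Qed.

End metric_form.

Section speed.
Context (R : realType) (n : nat) (M : smoothManifold R n)
  (g : riemannianMetric M).

Lemma speed_chart_invariant (gam : R -> M) t a b : {for t, continuous gam} ->
  dom a (gam t) -> dom b (gam t) -> derivable (phi a \o gam) t 1 ->
  metric_form g a (phi a (gam t)) (derive1 (phi a \o gam) t) (derive1 (phi a \o gam) t)
  = metric_form g b (phi b (gam t)) (derive1 (phi b \o gam) t) (derive1 (phi b \o gam) t).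
Proof.
move=> cg at_ bt dx; have [_ E] := velocity_chart_change cg at_ bt dx.
by rewrite (metric_form_chart g _ _ at_ bt) [in RHS]derive1E E.
Qed.

(** The geodesic equation and the Koszul formula cancel the derivative of the
    metric along the curve. *)
Lemma geodesic_speed_derive D (gam : R -> M) t a : open D -> is_geodesic g D gam ->
  D t -> dom a (gam t) ->
  is_derive t (1 : R) (fun s => metric_form g a (phi a (gam s))
     (derive1 (phi a \o gam) s) (derive1 (phi a \o gam) s)) 0.
Proof.
move=> oD geo Dt at_; have [cg /(_ a at_)[d1 d2 cov]] := geo t Dt.
have ay : (phi a @` dom a) ((phi a \o gam) t) by exists (gam t).
have h1 := is_derive_derive1 d1; have h2 := is_derive_derive1 d2.
have H := @metric_form_derive _ _ _ g a (phi a \o gam) _ _ t _ _ _ ay h1 h2 h2.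
apply: (is_derive_eq H).
move: cov; rewrite /covD => /eqP; rewrite addr_eq0 => /eqP ->.
set u := derive1 (phi a \o gam) t.
rewrite (metric_formC g u)// -scaleN1r metric_formZl christoffel_form//.
by rewrite /=; field.
Qed.

(** Both sides are values of one function of time, the squared speed read in
    the preferred chart; near each time it agrees with the squared speed in a fixed
    chart, so its derivative vanishes. *)
Lemma geodesic_speed (gam : R -> M) e t a b : 0 < e ->
  is_geodesic g `]- e, 1 + e[ gam -> 0 <= t <= 1 ->
  dom a (gam 0) -> dom b (gam t) ->
  metric_form g b (phi b (gam t)) (derive1 (phi b \o gam) t) (derive1 (phi b \o gam) t)
  = metric_form g a (phi a (gam 0)) (derive1 (phi a \o gam) 0) (derive1 (phi a \o gam) 0).
Proof.
move=> e0 geo /andP[t0 t1] a0 bt.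
have inD s : 0 <= s <= 1 -> `]- e, 1 + e[%classic s.
  by move=> /andP[s0 s1]; rewrite /= in_itv /=; apply/andP; split; lra.
have oD : open `]- e, 1 + e[%classic by exact: interval_open.
pose sp s := let c := chart_at (gam s) in
  metric_form g c (phi c (gam s)) (derive1 (phi c \o gam) s) (derive1 (phi c \o gam) s).
have spE s c : `]- e, 1 + e[%classic s -> dom c (gam s) ->
    metric_form g c (phi c (gam s)) (derive1 (phi c \o gam) s) (derive1 (phi c \o gam) s) = sp s.
  move=> Ds cs; have [cg /(_ c cs)[d1 _ _]] := geo s Ds.
  exact: (speed_chart_invariant cg cs (chart_at_dom (gam s)) d1).
have Dt : `]- e, 1 + e[%classic t by apply: inD; rewrite t0.
have D0 : `]- e, 1 + e[%classic (0 : R) by apply: inD; rewrite lexx ler01.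
rewrite (spE t b Dt bt) (spE 0 a D0 a0).
have dsp s : 0 <= s <= t -> is_derive s (1 : R) sp 0.
  move=> /andP[s0 st]; have Ds : `]- e, 1 + e[%classic s.
    by apply: inD; rewrite s0 (le_trans st).
  have cs := chart_at_dom (gam s); have [cg _] := geo s Ds.
  apply: near_eq_is_derive (geodesic_speed_derive oD geo Ds cs).
  have n1 := dom_near cg cs; have n2 := open_nbhs_nbhs (conj oD Ds).
  near=> r; apply: spE; near: r; [exact: n2|exact: n1].
have : `|sp t - sp 0| <= 0 * (t - 0).
  by apply: (mean_value_norm t0 dsp) => s _; rewrite normr0.
by rewrite mul0r normr_le0 subr_eq0 => /eqP.
Unshelve. all: by end_near. Qed.

End speed.

(** * Gauss's lemma *)

Lemma derive_comp (R : realType) (V W U : normedModType R) (f : V -> W)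
    (T : W -> U) y u : differentiable f y -> differentiable T (f y) ->
  'D_u (T \o f) y = 'd T (f y) ('D_u f y).
Proof.
move=> df dT; rewrite deriveE; last exact: (differentiable_comp df dT).
by rewrite diff_comp//= deriveE.
Qed.

(** The expansion of a quadratic form at [a + s b] with coefficients that
    depend on [s]. *)
Lemma is_derive_quadratic (R : realType) (f1 f2 f3 : R -> R) (d1 d2 d3 m : R) :
  f2 0 = m ->
  is_derive (0 : R) (1 : R) f1 d1 -> is_derive (0 : R) (1 : R) f2 d2 ->
  is_derive (0 : R) (1 : R) f3 d3 ->
  is_derive (0 : R) (1 : R) (fun s => f1 s + s * (2 * f2 s + s * f3 s))
    (d1 + 2 * m).
Proof.
move=> <- h1 h2 h3.
have H3 := is_deriveM (is_derive_id (0 : R) (1 : R)) h3.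
have H2 := is_deriveD (is_deriveZ 2 h2) H3.
have H1 := is_deriveD h1 (is_deriveM (is_derive_id (0 : R) (1 : R)) H2).
apply: (is_derive_eq H1); rewrite /GRing.scale /=.
have -> : (2 \*: f2 + id * f3) 0 = 2 * f2 0 + 0 * f3 0 by [].
by ring.
Qed.

(** The values of the three curves at [t] are named: in the application they
    are iterated directional derivatives. *)
Lemma metric_form_derive_at (R : realType) (n : nat) (M : smoothManifold R n)
    (g : riemannianMetric M) a (x u w : R -> 'rV[R]_n) t x0 u0 w0 dx du dw :
  x t = x0 -> u t = u0 -> w t = w0 -> (phi a @` dom a) x0 ->
  is_derive t (1 : R) x dx -> is_derive t (1 : R) u du -> is_derive t (1 : R) w dw ->
  is_derive t (1 : R) (fun s => metric_form g a (x s) (u s) (w s))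
   (metric_form g a x0 du w0 + (u0 *m 'D_dx (gmx g a) x0 *m w0^T) 0 0
    + metric_form g a x0 u0 dw).
Proof. by move=> <- <- <-; exact: metric_form_derive. Qed.

Lemma near_line (R : realType) (V : normedModType R) (U : set V) (y z : V) :
  open U -> U y -> \forall s \near (0 : R), U (y + s *: z).
Proof.
move=> oU Uy.
have c : {for (0 : R), continuous (fun s : R => y + s *: z)}.
  by apply: cvgD; [exact: cvg_cst|exact: scalel_continuous].
by apply: c; rewrite scale0r addr0; exact: (open_nbhs_nbhs (conj oU Uy)).
Qed.

Lemma gauss_algebra (R : realType) (t m1 m2 m3 m4 m5 m6 : R) :
  t * m1 + t * m5 + t * m1 + 2 * m2 = 0 + 2 * m6 -> m3 = - (m4 - 2^-1 * m5) ->
  t *: (m3 + m4 + m1) + m2 *: (1 : R) = m6.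
Proof. by move=> e2 ->; rewrite /GRing.scale /=; lra. Qed.

Section gauss.
Context (R : realType) (n : nat) (M : smoothManifold R n)
  (g : riemannianMetric M) (q : M) (B : set 'rV[R]_n).

Let E (v : 'rV[R]_n) : M := Exp g q (v : tangent q).
Let X (a : chart_index M) (v : 'rV[R]_n) : 'rV[R]_n := phi a (E v).
Let O a := B `&` E @^-1` dom a.

Hypothesis starB : forall v (t : R), B v -> 0 <= t <= 1 -> B (t *: v).
Hypothesis oB : open B.
Hypothesis domB : forall v, B v -> exp_dom g q (v : tangent q).
Hypothesis smoothB : forall a, smooth_on (O a) (X a).

Definition metric_at_base (u w : 'rV[R]_n) : R :=
  metric_form g (chart_at q) (phi (chart_at q) q) u w.

Definition pullback a (y u w : 'rV[R]_n) : R :=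
  metric_form g a (X a y) ('D_u (X a) y) ('D_w (X a) y).

Lemma Exp_chart_open a : open (O a). Proof. by case: (smoothB a). Qed.

Lemma Exp_chart_differentiable a y : O a y -> differentiable (X a) y.
Proof. by move=> ay; case: (smoothB a) => _ /(_ 1%N)[+ _]; apply. Qed.

Lemma Exp_chart_near a y : O a y -> \forall z \near y, O a z.
Proof. by move=> ay; apply: open_nbhs_nbhs; split; [exact: Exp_chart_open|]. Qed.

Lemma Exp_chart_deriv_C1 a v : Ck_on 1 (O a) ('D_v (X a)).
Proof. by case: (smoothB a) => _ /(_ 2%N)[_]; exact. Qed.

Lemma Exp_chart_deriv_differentiable a y v : O a y -> differentiable ('D_v (X a)) y.
Proof. by move=> ay; have [+ _] := Exp_chart_deriv_C1 a v; apply. Qed.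

Lemma Exp_chart_deriv_sdiff a y v : O a y -> sdiff ('D_v (X a)) y.
Proof. by move=> ay; exact: (sdiff_C1 (@Exp_chart_open a) (Exp_chart_deriv_C1 a v) ay). Qed.

Lemma Exp_chart_schwarz a y v w : O a y -> 'D_w ('D_v (X a)) y = 'D_v ('D_w (X a)) y.
Proof.
move=> ay; have no := Exp_chart_near ay.
apply: schwarz; [| |exact: Exp_chart_deriv_sdiff|exact: Exp_chart_deriv_sdiff].
  by apply: filterS no => z az; apply: diff_derivable; exact: Exp_chart_differentiable.
by apply: filterS no => z az; apply: diff_derivable; exact: Exp_chart_differentiable.
Qed.

Lemma Exp_chart_dom a y : O a y -> (phi a @` dom a) (X a y).
Proof. by move=> [_ ay]; exists (E y). Qed.

Lemma Exp_chart_change a b y u : O a y -> O b y ->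
  'D_u (X b) y = 'd (transition a b) (X a y) ('D_u (X a) y).
Proof.
move=> ay by_.
have dT : differentiable (transition a b) (X a y).
  by apply: transition_differentiable; [case: ay|case: by_].
have dX := Exp_chart_differentiable ay.
have nE : \forall z \near y, (transition a b \o X a) z = X b z.
  by apply: filterS (Exp_chart_near ay) => z [_ az]; rewrite /= /transition /= /X phiK.
rewrite -(near_eq_derive u nE); exact: (derive_comp u dX dT).
Qed.

(** The chain rule for the transition map and the compatibility of the metric
    with it. *)
Lemma pullback_chart a b y u w : O a y -> O b y -> pullback a y u w = pullback b y u w.
Proof.
move=> ay by_; rewrite /pullback (Exp_chart_change u ay by_) (Exp_chart_change w ay by_).
by apply: metric_form_chart; [case: ay|case: by_].
Qed.

Lemma is_derive_ray (V W : normedModType R) (f : V -> W) v (t : R) :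
  derivable f (t *: v) v -> is_derive t (1 : R) (fun s => f (s *: v)) ('D_v f (t *: v)).
Proof.
move=> df; have := @is_derive_line R V W f 0 v t; rewrite add0r => /(_ df).
by under [X in is_derive _ _ X _ -> _]eq_fun do rewrite add0r.
Qed.

Lemma near_ray a v (t : R) : O a (t *: v) -> \forall s \near t, O a (s *: v).
Proof.
move=> atv; have c : {for t, continuous (fun s : R => s *: v)}.
  exact: scalel_continuous.
by apply: c; exact: Exp_chart_near.
Qed.

(** The image of a ray is a geodesic, of squared speed that of [v] at the
    origin; in coordinates the geodesic equation becomes an identity for the second
    radial derivative of the exponential. *)
Lemma ray_geodesic v (t : R) a : B v -> 0 <= t <= 1 -> dom a (E (t *: v)) ->
  pullback a (t *: v) v v = metric_at_base v v /\
  'D_v ('D_v (X a)) (t *: v)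
    = - christoffel g a (X a (t *: v)) ('D_v (X a) (t *: v)) ('D_v (X a) (t *: v)).
Proof.
move=> Bv t01 at_.
have [gam [e [e0 geo g0 dv rel]]] := exp_geodesic (domB Bv).
have EX s : - e < s < 1 + e -> gam s = E (s *: v).
  by move=> se; rewrite /E (exp_relE (rel s se)).
have oD : open `]- e, 1 + e[%classic by exact: interval_open.
have inD s : `]- e, 1 + e[%classic s -> - e < s < 1 + e by rewrite /= in_itv.
have Dt : `]- e, 1 + e[%classic t.
  by rewrite /= in_itv /=; case/andP: t01 => ? ?; apply/andP; split; lra.
have Oa : O a (t *: v) by split => //; exact: starB.
have d1 s : `]- e, 1 + e[%classic s -> O a (s *: v) ->
    is_derive s (1 : R) (phi a \o gam) ('D_v (X a) (s *: v)).
  move=> Ds Os; apply: near_eq_is_derive; last first.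
    by apply: is_derive_ray; apply: diff_derivable; exact: Exp_chart_differentiable.
  have n1 := open_nbhs_nbhs (conj oD Ds).
  by apply: filterS n1 => r /inD r1; rewrite /= EX.
have d2 : is_derive t (1 : R) (derive1 (phi a \o gam)) ('D_v ('D_v (X a)) (t *: v)).
  apply: near_eq_is_derive; last first.
    by apply: is_derive_ray; apply: diff_derivable; exact: Exp_chart_deriv_differentiable.
  have n1 := open_nbhs_nbhs (conj oD Dt); have n2 := near_ray Oa.
  near=> s; have [] := d1 s _ _; [near: s; exact: n1|near: s; exact: n2|].
  by rewrite derive1E => _ ->.
have Et : gam t = E (t *: v) by apply: EX; exact: inD.
have [_ D1] := d1 t Dt Oa; have [_ D2] := d2.
rewrite -derive1E in D1; rewrite -derive1E in D2.
split; last first.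
  have agt : dom a (gam t) by rewrite Et.
  have [_ /(_ a agt)[_ _]] := geo t Dt.
  rewrite /covD D2 D1 Et => /eqP; rewrite addr_eq0 => /eqP ->.
  reflexivity.
have a0 : dom (chart_at q) (gam 0) by rewrite g0; exact: chart_at_dom.
have bt : dom a (gam t) by rewrite Et.
have := geodesic_speed e0 geo t01 a0 bt.
rewrite D1 Et g0; case: dv => _ Edv; rewrite !derive1E Edv => H.
exact: H.
Unshelve. all: by end_near. Qed.

Lemma base_dom : (phi (chart_at q) @` dom (chart_at q)) (phi (chart_at q) q).
Proof. by exists q; [exact: chart_at_dom|reflexivity]. Qed.

Lemma derive_linear_dir a y (k : R) (u w : 'rV[R]_n) : O a y ->
  'D_(u + k *: w) (X a) y = 'D_u (X a) y + k *: 'D_w (X a) y.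
Proof.
move=> Oy; have dX := Exp_chart_differentiable Oy.
by rewrite (deriveE _ dX) (deriveE u dX) (deriveE w dX) linearD linearZ.
Qed.

(** The heart of Gauss's lemma: the derivative of [<d Exp (v), d Exp (s w)>] at
    the point [s v] is constant in [s].  The geodesic equation and the Koszul
    formula reduce it to half of the derivative, with respect to a variation of
    [v] in the direction [w], of the squared speed of the ray; that squared speed
    is known by [ray_geodesic].  The two expressions are matched by the symmetry
    of second derivatives. *)
Lemma gauss_derive v w (t : R) a : B v -> 0 <= t <= 1 -> dom a (E (t *: v)) ->
  is_derive t (1 : R) (fun s => s * pullback a (s *: v) v w) (metric_at_base v w).
Proof.
move=> Bv t01 at_.
have Oa : O a (t *: v) by split => //; exact: starB.
have [_ ode] := ray_geodesic Bv t01 at_.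
have XD := Exp_chart_dom Oa.
pose y : 'rV[R]_n := t *: v.
rewrite -/y in at_ Oa ode XD.
pose u : 'rV[R]_n := 'D_v (X a) y; pose b : 'rV[R]_n := 'D_w (X a) y.
pose c : 'rV[R]_n := 'D_v ('D_w (X a)) y.
have dx : is_derive t (1 : R) (fun s => X a (s *: v)) u.
  by apply: is_derive_ray; apply: diff_derivable; exact: Exp_chart_differentiable.
have du : is_derive t (1 : R) (fun s => 'D_v (X a) (s *: v)) ('D_v ('D_v (X a)) y).
  by apply: is_derive_ray; apply: diff_derivable; exact: Exp_chart_deriv_differentiable.
have dw : is_derive t (1 : R) (fun s => 'D_w (X a) (s *: v)) ('D_v ('D_w (X a)) y).
  by apply: is_derive_ray; apply: diff_derivable; exact: Exp_chart_deriv_differentiable.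
have H := @metric_form_derive_at R n M g a (fun s => X a (s *: v))
  (fun s => 'D_v (X a) (s *: v)) (fun s => 'D_w (X a) (s *: v)) t
  (X a y) u b _ _ _ erefl erefl erefl XD dx du dw.
have H' := is_deriveM (is_derive_id t (1 : R)) H.
apply: (is_derive_eq H') => {H H'}.
rewrite -/y.
(* A second expression for the terms with derivatives along w: the squared speed of
   the ray along v + s w, at the fixed time t, is a known function of s. *)
have wyE s : t *: (v + s *: w) = y + s *: (t *: w).
  by rewrite scalerDr !scalerA mulrC.
have y0 : y + 0 *: (t *: w) = y by rewrite scale0r addr0.
have Dtw (f : 'rV[R]_n -> 'rV[R]_n) : differentiable f y ->
    'D_(t *: w) f y = t *: 'D_w f y.
  by move=> df; rewrite (deriveE _ df) (deriveE w df) linearZ.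
have dX := Exp_chart_differentiable Oa.
have line (f : 'rV[R]_n -> 'rV[R]_n) : differentiable f y ->
    is_derive (0 : R) (1 : R) (fun s => f (y + s *: (t *: w))) (t *: 'D_w f y).
  move=> df; rewrite -(Dtw f df).
  have := @is_derive_line R _ _ f y (t *: w) 0; rewrite y0; apply.
  exact: diff_derivable.
have ex := line _ dX.
have eu1 := line _ (Exp_chart_deriv_differentiable v Oa).
have eu2 := line _ (Exp_chart_deriv_differentiable w Oa).
have eu1' : is_derive (0 : R) (1 : R) (fun s => 'D_v (X a) (y + s *: (t *: w))) (t *: c).
  exact: (is_derive_eq eu1 (congr1 (fun z => t *: z) (Exp_chart_schwarz v w Oa))).
pose x0 := X a y.
have ex0 : X a (y + 0 *: (t *: w)) = x0 := congr1 (X a) y0.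
have ea0 : 'D_v (X a) (y + 0 *: (t *: w)) = u := congr1 (fun z => 'D_v (X a) z) y0.
have eb0 : 'D_w (X a) (y + 0 *: (t *: w)) = b := congr1 (fun z => 'D_w (X a) z) y0.
have faa := metric_form_derive_at g ex0 ea0 ea0 XD ex eu1' eu1'.
have fab := metric_form_derive_at g ex0 ea0 eb0 XD ex eu1' eu2.
have fbb := metric_form_derive_at g ex0 eb0 eb0 XD ex eu2 eu2.
have m0 : metric_form g a (X a (y + 0 *: (t *: w))) ('D_v (X a) (y + 0 *: (t *: w)))
  ('D_w (X a) (y + 0 *: (t *: w))) = metric_form g a x0 u b.
  by rewrite ex0 ea0 eb0.
(* Q1 and Q2 differentiate at s = 0 the two sides of the identity nEq below. *)
have Q1 := is_derive_quadratic m0 faa fab fbb.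
have hcst (k : R) : is_derive (0 : R) (1 : R) (fun=> k) 0 by exact: is_derive_cst.
have Q2 := @is_derive_quadratic _ _ (fun=> metric_at_base v w) _ _ _ _ _ erefl
  (hcst (metric_at_base v v)) (hcst (metric_at_base v w)) (hcst (metric_at_base w w)).
have nB := near_line w oB Bv.
have nO := near_line (t *: w) (@Exp_chart_open a) Oa.
have pD z : O a z -> (phi a @` dom a) (X a z) by exact: Exp_chart_dom.
have nEq : \forall s \near (0 : R),
    metric_form g a (X a (y + s *: (t *: w))) ('D_v (X a) (y + s *: (t *: w)))
      ('D_v (X a) (y + s *: (t *: w))) +
    s * (2 * metric_form g a (X a (y + s *: (t *: w))) ('D_v (X a) (y + s *: (t *: w)))
      ('D_w (X a) (y + s *: (t *: w))) +
    s * metric_form g a (X a (y + s *: (t *: w))) ('D_w (X a) (y + s *: (t *: w)))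
      ('D_w (X a) (y + s *: (t *: w)))) =
    metric_at_base v v + s * (2 * metric_at_base v w +
      s * metric_at_base w w).
  near=> s.
  have Bs : B (v + s *: w) by near: s; exact: nB.
  have Os : O a (y + s *: (t *: w)) by near: s; exact: nO.
  have as_ : dom a (E (t *: (v + s *: w))) by rewrite wyE; case: Os.
  have [HB _] := ray_geodesic Bs t01 as_.
  move: HB; rewrite wyE /pullback (derive_linear_dir s v w Os).
  have XO := pD _ Os.
  move: XO; move: (X a (y + s *: (t *: w))) ('D_v (X a) (y + s *: (t *: w)))
    ('D_w (X a) (y + s *: (t *: w))) => z d1 d2 XO.
  have expand c' z' (x1 x2 : 'rV[R]_n) : (phi c' @` dom c') z' ->
      metric_form g c' z' (x1 + s *: x2) (x1 + s *: x2) =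
      metric_form g c' z' x1 x1 + s * (2 * metric_form g c' z' x1 x2 +
        s * metric_form g c' z' x2 x2).
    move=> c'z'; rewrite metric_formDl (metric_formDr g _ _ _ c'z') (metric_formDr g _ _ _ c'z').
    rewrite metric_formZl metric_formZl !(metric_formZr g _ _ _ c'z').
    by rewrite (metric_formC g x2 x1 c'z'); ring.
  by rewrite /metric_at_base (expand _ _ _ _ XO) (expand _ _ _ _ base_dom).
have [_ e1] := near_eq_is_derive nEq Q1.
have [_ e2] := Q2.
(* The two derivatives of the squared speed at s = 0 are equal. *)
have {e1}{}e2 := etrans (esym e1) e2.
have dG := gmx_differentiable g XD.
have tb : 'D_(t *: b) (gmx g a) x0 = t *: 'D_b (gmx g a) x0.
  by rewrite (deriveE _ dG) (deriveE b dG) linearZ.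
have mxZ p p' (k : R) (Z : 'M[R]_(p, p')) i j : (k *: Z) i j = k * Z i j by rewrite mxE.
have e3 : (u *m 'D_(t *: b) (gmx g a) x0 *m u^T) 0 0
   = t * (u *m 'D_b (gmx g a) x0 *m u^T) 0 0.
  by rewrite tb -scalemxAr -scalemxAl mxZ.
have e4 : metric_form g a x0 (t *: c) u = t * metric_form g a x0 u c.
  exact: (etrans (metric_formZl g a x0 t c u) (congr1 (fun z => t * z) (metric_formC g c u XD))).
have e5 : metric_form g a x0 u (t *: c) = t * metric_form g a x0 u c.
  exact: (metric_formZr g t u c XD).
have e6 : metric_form g a x0 ('D_v ('D_v (X a)) y) b =
    - ((u *m 'D_u (gmx g a) x0 *m b^T) 0 0 - 2^-1 * (u *m 'D_b (gmx g a) x0 *m u^T) 0 0).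
  by rewrite ode -scaleN1r metric_formZl (christoffel_form g u b XD) mulN1r.
rewrite e3 e4 e5 in e2.
exact: (gauss_algebra e2 e6).
Unshelve. all: by end_near. Qed.

End gauss.

Section gauss_lemma.
Context (R : realType) (n : nat) (M : smoothManifold R n)
  (g : riemannianMetric M) (q : M) (B : set 'rV[R]_n).

Let E (v : 'rV[R]_n) : M := Exp g q (v : tangent q).
Let X (a : chart_index M) (v : 'rV[R]_n) : 'rV[R]_n := phi a (E v).
Let O a := B `&` E @^-1` dom a.

Hypothesis starB : forall v (t : R), B v -> 0 <= t <= 1 -> B (t *: v).
Hypothesis oB : open B.
Hypothesis domB : forall v, B v -> exp_dom g q (v : tangent q).
Hypothesis smoothB : forall a, smooth_on (O a) (X a).

(** Gauss's lemma: integrate [gauss_derive] from [0] to [1]. *)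
Lemma gauss_pullback v w a : B v -> dom a (E v) ->
  pullback g q a v v w = metric_at_base g q v w.
Proof.
move=> Bv av.
pose F (s : R) := s * pullback g q (chart_at (E (s *: v))) (s *: v) v w.
have dF (t : R) : 0 <= t <= 1 -> is_derive t (1 : R) F (metric_at_base g q v w).
  move=> t01; have ct := chart_at_dom (E (t *: v)).
  have H := gauss_derive starB oB domB smoothB w Bv t01 ct.
  have Ot : O (chart_at (E (t *: v))) (t *: v) by split; [exact: starB|exact: ct].
  apply: near_eq_is_derive H.
  have nO := near_ray smoothB Ot.
  near=> s.
  have Os : O (chart_at (E (t *: v))) (s *: v) by near: s; exact: nO.
  have Os' : O (chart_at (E (s *: v))) (s *: v).
    by split; [case: Os|exact: chart_at_dom].
  exact: (congr1 (fun z => s * z) (pullback_chart smoothB v w Os Os')).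
have lin (t : R) : is_derive t (1 : R) (fun s : R => s * metric_at_base g q v w) (metric_at_base g q v w).
  exact: (is_derive_scalel (metric_at_base g q v w) t).
have : `|(F 1 - 1 * metric_at_base g q v w) - (F 0 - 0 * metric_at_base g q v w)| <= 0 * (1 - 0).
  apply: (@mean_value_norm _ _ (fun s => F s - s * metric_at_base g q v w)
    (fun _ => metric_at_base g q v w - metric_at_base g q v w) 0 1 0 ler01).
    by move=> t t01; exact: (is_deriveB (dF t t01) (lin t)).
  by move=> t _; rewrite subrr normr0.
rewrite [leRHS]mul0r normr_le0 /F !mul0r !mul1r !subr0 scale1r subr_eq0 => /eqP <-.
have O1 : O (chart_at (E v)) v by split; [exact: Bv|exact: chart_at_dom].
have O2 : O a v by split; [exact: Bv|exact: av].
exact: (pullback_chart smoothB v w O2 O1).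
Unshelve. all: by end_near. Qed.

(** Cauchy-Schwarz in the pulled back metric, the radial terms being replaced
    by their values at the origin: the distance to the origin varies at most as
    fast as the length of a curve. *)
Lemma radial_CS v w a : B v -> dom a (E v) ->
  metric_at_base g q v w ^+ 2 <= metric_at_base g q v v * pullback g q a v w w.
Proof.
move=> Bv av; rewrite -(gauss_pullback w Bv av) -(gauss_pullback v Bv av).
by apply: metric_form_CS; exists (E v).
Qed.

End gauss_lemma.

(** * Lengths of curves and normal balls *)
Section integral_bound.
Context (R : realType).

(** The sum of [rho] and of the integral of [f] up to a variable end point is
    nondecreasing. *)
Lemma integral_bound (f rho drho : R -> R) (s t s' : R) :
  s <= s' -> s' < t -> {within `[s, t], continuous f} ->
  (forall r, s <= r <= t -> 0 <= f r) ->
  (forall r, s' < r < t -> is_derive r (1 : R) rho (drho r)) ->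
  (forall r, s' < r < t -> - f r <= drho r) ->
  {within `[s', t], continuous rho} ->
  rho s' <= rho t + \int[lebesgue_measure]_(r in `[s, t]) f r.
Proof.
move=> ss' st cf f0 dr fr cr.
have sst : s < t by exact: le_lt_trans st.
pose J x := \int[lebesgue_measure]_(r in `[s, x]) f r.
have intf : lebesgue_measure.-integrable `[s, t] (EFin \o f).
  by apply: continuous_compact_integrable => //; exact: segment_compact.
have cJ : {within `[s, t], continuous J}.
  exact: (parameterized_integral_continuous (ltW sst) intf).
have dJ r : s < r < t -> derivable J r 1 /\ derive1 J r = f r.
  move=> /andP[sr rt]; apply: (continuous_FTC1_closed rt intf sr).
  have /(continuous_within_itvP _ sst)[cin _ _] := cf.
  by apply: cin; rewrite in_itv /= sr.
have sub : `[s', t]%classic `<=` `[s, t]%classic.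
  by move=> r /=; rewrite !in_itv /= => /andP[/(le_trans ss') -> ->].
have J0 : 0 <= J s'.
  apply: Rintegral_ge0 => r; rewrite /= in_itv /= => /andP[sr rs']; apply: f0.
  by rewrite sr (le_trans rs' (ltW st)).
have in' r : r \in `]s', t[ -> s' < r < t /\ s < r < t.
  by rewrite in_itv /= => /andP[h1 h2]; rewrite h1 h2 (le_lt_trans ss' h1).
suff : (rho \+ J) s' <= (rho \+ J) t by rewrite /= -/(J t); lra.
apply: (@ger0_derive1_le_cc _ (rho \+ J) s' t).
- move=> r /in'[r1 r2]; have [h1 _] := dJ r r2; have [h2 _] := dr r r1.
  exact: derivableD.
- move=> r /in'[r1 r2]; have [h1 e1] := dJ r r2; have [h2 e2] := dr r r1.
  rewrite derive1E deriveD// e2 -derive1E e1.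
  by have := fr r r1; lra.
- move=> x; apply: continuousD; first exact: cr.
  exact: (continuous_subspaceW sub cJ).
- by rewrite in_itv /= lexx ltW.
- by rewrite in_itv /= lexx ltW.
- exact: ltW.
Qed.

Lemma Rintegral_itv_ge0 (f : R -> R) (s t : R) :
  (forall r, s <= r <= t -> 0 <= f r) ->
  0 <= \int[lebesgue_measure]_(r in `[s, t]) f r.
Proof. by move=> f0; apply: Rintegral_ge0 => r; rewrite /= in_itv /=; exact: f0. Qed.

End integral_bound.

Section has_deriv_calculus.
Context (R : realType).

Lemma has_deriv_unique (V : normedModType R) (D : set R) (x : R -> V) t u v :
  (forall d, 0 < d -> exists s, [/\ D s, s != t & `|t - s| < d]) ->
  has_deriv D x t u -> has_deriv D x t v -> u = v.
Proof.
move=> lim /has_derivP Hu /has_derivP Hv.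
apply/eqP; rewrite -subr_eq0 -normr_le0; apply/ler_addgt0Pr => e e0; rewrite add0r.
have e2 : 0 < e / 2 by rewrite divr_gt0.
have [d d0 Hd] := Hu _ e2; have [d' d'0 Hd'] := Hv _ e2.
have m0 : 0 < Num.min d d' by rewrite lt_min d0.
have [s [Ds st]] := lim _ m0; rewrite lt_min => /andP[h1 h2].
have := Hd s Ds st h1; have := Hd' s Ds st h2; set Q := _ *: _ => a1 a2.
rewrite -(subrK Q u) -addrA; apply: le_trans (ler_normD _ _) _.
by rewrite (splitr e) [X in _ + X]distrC; apply: lerD.
Qed.

Lemma has_deriv_comp (V W : normedModType R) (D : set R) (x : R -> V) (T : V -> W) t u A :
  has_deriv D x t u -> is_sdiff T (x t) A -> has_deriv D (T \o x) t (A u).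
Proof.
move=> /has_derivP Hx sT; have [linA [C C0 AC] H] := sT.
apply/has_derivP => e e0.
pose e1 := e / 2 / (`|u| + 1).
have u1 : 0 < `|u| + 1 by rewrite ltr_wpDl.
have e10 : 0 < e1 by rewrite !divr_gt0.
have /near_diagP[r r0 {}H] := H e1 e10.
pose e2 := Num.min 1 (e / 2 / (C + 1)).
have C1 : 0 < C + 1 by rewrite ltr_wpDl.
have e20 : 0 < e2 by rewrite lt_min ltr01 !divr_gt0.
have [l1 l2] : e2 <= 1 /\ e2 <= e / 2 / (C + 1) by rewrite !ge_min !lexx orbT.
have [d d0 Hd] := Hx e2 e20.
exists (Num.min d (r / (`|u| + 1))); first by rewrite lt_min d0 divr_gt0.
move=> s Ds st; rewrite lt_min => /andP[sd sr].
have {Hd}Q := Hd s Ds st sd.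
have st0 : s - t != 0 by rewrite subr_eq0.
set q := (s - t)^-1 *: (x s - x t) in Q.
have xq : x s - x t = (s - t) *: q by rewrite /q scalerA divff// scale1r.
have qn : `|q| <= `|u| + 1.
  rewrite -[q](subKr u); apply: le_trans (ler_normB _ _) _.
  by rewrite lerD2l; exact: le_trans Q l1.
have xs : `|x t - x s| < r.
  rewrite distrC xq normrZ distrC; apply: le_lt_trans (_ : `|t - s| * (`|u| + 1) < r).
    by rewrite ler_wpM2l.
  by rewrite -ltr_pdivlMr.
have := H (x s) (x t) xs (ltac:(by rewrite subrr normr0)); rewrite /= xq => H1.
have E : A u - (s - t)^-1 *: (T (x s) - T (x t)) =
    A (u - q) - (s - t)^-1 *: (T (x s) - T (x t) - A ((s - t) *: q)).
  rewrite (linpredZ linA) [in RHS]scalerBr scalerA mulVf// scale1r.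
  by rewrite (linpredB linA) opprB addrA subrK.
rewrite /= E; apply: le_trans (ler_normB _ _) _; rewrite (splitr e); apply: lerD.
  apply: le_trans (AC _) _; apply: le_trans (_ : (C + 1) * (e / 2 / (C + 1)) <= _).
    by apply: ler_pM => //; [rewrite lerDl|exact: le_trans Q l2].
  by rewrite mulrC divfK// gt_eqF.
rewrite normrZ normfV.
rewrite ler_pdivrMl ?normr_gt0//; apply: le_trans H1 _; rewrite normrZ mulrCA ler_wpM2l//.
apply: le_trans (_ : e1 * (`|u| + 1) <= _); first by rewrite ler_wpM2l// ltW.
by rewrite /e1 divfK// gt_eqF.
Qed.

Lemma has_deriv_near (V : normedModType R) (D : set R) (x y : R -> V) t u :
  (\forall s \near within D (nbhs t), x s = y s) -> x t = y t ->
  has_deriv D x t u -> has_deriv D y t u.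
Proof.
rewrite near_withinE => /nbhs_ballP[r /= r0 Hr] xy /has_derivP H.
apply/has_derivP => e e0; have [d d0 Hd] := H e e0.
exists (Num.min r d); first by rewrite lt_min r0.
move=> s Ds st; rewrite lt_min => /andP[sr sd].
by rewrite -(Hr s sr Ds) -xy; exact: Hd.
Qed.

End has_deriv_calculus.

Section curve_speed.
Context (R : realType) (n : nat) (M : smoothManifold R n)
  (g : riemannianMetric M) (s t : R) (gam : R -> M) (V : forall r, tangent (gam r)).
Hypothesis st : s < t.
Hypothesis C1 : curve_C1 `[s, t] gam.
Hypothesis vel : forall r, s <= r <= t -> has_velocity `[s, t] gam r (V r).

Lemma gam_within r : s <= r <= t -> gam @ within `[s, t]%classic (nbhs r) --> gam r.
Proof. by move=> rst; case: C1 => + _; apply; rewrite /= in_itv. Qed.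

Lemma dom_near_within r a : s <= r <= t -> dom a (gam r) ->
  \forall x \near within `[s, t]%classic (nbhs r), dom a (gam x).
Proof.
move=> rst ar; apply: (gam_within rst).
by apply: open_nbhs_nbhs; split => //; exact: dom_open.
Qed.

(** The velocity is represented in the preferred chart at the moving point; in a
    fixed chart it is given by the transition map, one-sided derivatives being
    unique. *)
Lemma velocity_chart r a dx : s <= r <= t -> dom a (gam r) ->
  has_deriv `[s, t] (phi a \o gam) r dx ->
  (V r : 'rV[R]_n) = 'd (transition a (chart_at (gam r))) (phi a (gam r)) dx.
Proof.
move=> rst ar hx; pose b := chart_at (gam r).
have br : dom b (gam r) by exact: chart_at_dom.
have [_ hV] := vel rst.
have Dr : `[s, t]%classic r by rewrite /= in_itv.
apply: (has_deriv_unique (itv_limit_point st Dr) hV).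
have dT := transition_differentiable ar br.
have [A sA] : sdiff (transition a b) (phi a (gam r)).
  by apply: (sdiff_C1 (@transition_open _ _ M a b) (transition_C a b 1)); exists (gam r).
have AE u : A u = 'd (transition a b) (phi a (gam r)) u.
  by have [_ <-] := is_sdiff_derive u sA; rewrite deriveE.
have := has_deriv_comp hx sA; rewrite AE.
apply: has_deriv_near; last by rewrite /= /transition /= phiK.
near=> x; rewrite /= /transition /= phiK//; near: x.
exact: dom_near_within.
Unshelve. all: by end_near. Qed.

Lemma gnorm_chart r a dx : s <= r <= t -> dom a (gam r) ->
  has_deriv `[s, t] (phi a \o gam) r dx ->
  Defs.gnorm g (V r) = Num.sqrt (metric_form g a (phi a (gam r)) dx dx).
Proof.
move=> rst ar hx; rewrite /Defs.gnorm -/(metric_form g _ _ (V r) (V r)).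
rewrite (velocity_chart rst ar hx) (metric_form_chart g dx dx ar (chart_at_dom (gam r))).
reflexivity.
Qed.

Lemma metric_form_sdiff a (z : 'rV[R]_n * 'rV[R]_n) : (phi a @` dom a) z.1 ->
  sdiff (fun w : 'rV[R]_n * 'rV[R]_n => metric_form g a w.1 w.2 w.2) z.
Proof.
move=> az.
have sv : sdiff (fun w : 'rV[R]_n * 'rV[R]_n => w.2) z by exact: sdiff_snd.
have sG := sdiff_comp (sdiff_fst z) (gmx_sdiff g az).
have sT : sdiff (fun w : 'rV[R]_n * 'rV[R]_n => w.2^T) z.
  by apply: sdiff_mx => j k; under eq_fun do rewrite mxE; exact: sdiff_coord.
exact: (sdiff_coord 0 0 (sdiff_mulmx (sdiff_mulmx sv sG) sT)).
Qed.

(** The preferred chart at [gam r] jumps with [r], so the continuity of the speed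
    is read in a fixed chart, where [gnorm_chart] expresses it by the derivative
    of the coordinates. *)
Lemma gnorm_continuous : {within `[s, t], continuous (fun r => Defs.gnorm g (V r))}.
Proof.
apply/subspace_continuousP => r Dr.
have rst : s <= r <= t by move: Dr; rewrite /= in_itv.
pose a := chart_at (gam r).
have ar : dom a (gam r) by exact: chart_at_dom.
have [_ /(_ a)[dx Hdx]] := C1.
have [hx cx] := Hdx r Dr ar.
have az : (phi a @` dom a) (phi a (gam r), dx r).1 by exists (gam r).
have cF := sdiff_continuous (metric_form_sdiff az).
have cp : (fun x => phi a (gam x)) @ within `[s, t]%classic (nbhs r) --> phi a (gam r).
  exact: (cvg_comp _ _ (gam_within rst) (phi_continuous ar)).
have nd := dom_near_within rst ar.
have cdx : dx @ within `[s, t]%classic (nbhs r) --> dx r.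
  move=> P /cx; rewrite /= => H.
  have {H} : nbhs r [set x | (`[s, t]%classic x /\ dom a (gam x)) -> P (dx x)] by exact: H.
  move=> H; move: nd; rewrite near_withinE => nd.
  apply: filterS2 H nd => x Hx nx Dx; apply: Hx; split => //; exact: nx.
have cpair : (fun x => (phi a (gam x), dx x)) @ within `[s, t]%classic (nbhs r)
    --> (phi a (gam r), dx r).
  exact: (cvg_pair cp cdx).
have H1 := cvg_comp _ _ cpair cF.
have H2 := cvg_comp _ _ H1 (@sqrt_continuous R _).
suff : (fun x => Defs.gnorm g (V x)) @ within `[s, t]%classic (nbhs r) -->
    Num.sqrt (metric_form g a (phi a (gam r)) (dx r) (dx r)).
  by rewrite -(gnorm_chart rst ar hx).
apply: cvg_trans H2; apply: near_eq_cvg.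
near=> x.
have Dx : `[s, t]%classic x by near: x; exact: withinT.
have ax : dom a (gam x) by near: x; exact: nd.
have [hx' _] := Hdx x Dx ax.
have xst : s <= x <= t by move: Dx; rewrite /= in_itv.
by rewrite (gnorm_chart xst ax hx').
Unshelve. all: by end_near. Qed.

End curve_speed.

(** The estimate for the derivative of [sqrt (N + d^2)], a smooth substitute for
    the norm, which is not differentiable at the origin. *)
Lemma radial_speed_bound (R : realType) (N m G d : R) :
  0 <= N -> 0 < d -> 0 <= G -> m ^+ 2 <= N * G ^+ 2 ->
  - G <= (2 * Num.sqrt (N + d ^+ 2))^-1 * (2 * m).
Proof.
move=> N0 d0 G0 le.
have P0 : 0 < N + d ^+ 2 by rewrite ltr_wpDl// exprn_gt0.
have S0 : 0 < Num.sqrt (N + d ^+ 2) by rewrite sqrtr_gt0.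
set S := Num.sqrt _ in S0 *.
have -> : (2 * S)^-1 * (2 * m) = m / S by field; rewrite gt_eqF.
rewrite ler_pdivlMr// mulNr lerNl.
have SS : S ^+ 2 = N + d ^+ 2 by rewrite sqr_sqrtr// ltW.
have le2 : m ^+ 2 <= (G * S) ^+ 2.
  rewrite exprMn SS mulrC; apply: le_trans le _.
  by rewrite mulrC [leRHS]mulrC ler_wpM2r ?sqr_ge0// lerDl sqr_ge0.
have GS : 0 <= G * S by rewrite mulr_ge0// ltW.
apply: le_trans (ler_norm _) _; rewrite normrN.
by rewrite -(ler_pXn2r (ltn0Sn 1)) ?nnegrE// real_normK ?num_real.
Qed.

Section base_norm.
Context (R : realType) (n : nat) (M : smoothManifold R n)
  (g : riemannianMetric M) (q : M).

Let N (v : 'rV[R]_n) : R := metric_at_base g q v v.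
Let nrm (v : 'rV[R]_n) : R := Num.sqrt (N v).

Lemma base_ge0 v : 0 <= N v.
Proof. exact: (metric_form_ge0 g v (base_dom q)). Qed.

Lemma base_normZ (k : R) v : nrm (k *: v) = `|k| * nrm v.
Proof.
rewrite /nrm /N /metric_at_base metric_formZl (metric_formZr g _ _ _ (base_dom q)).
by rewrite mulrA -expr2 sqrtrM ?sqr_ge0// sqrtr_sqr.
Qed.

Lemma base_continuous : continuous N.
Proof.
move=> v.
have az : (phi (chart_at q) @` dom (chart_at q)) (phi (chart_at q) q, v).1 by exact: base_dom.
have sp := sdiff_pair (sdiff_cst (phi (chart_at q) q) v) (sdiff_id v).
exact: (sdiff_continuous (sdiff_comp sp (metric_form_sdiff g az))).
Qed.

Lemma base_norm_continuous : continuous nrm.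
Proof.
move=> v; apply: (@continuous_comp _ _ _ N Num.sqrt); first exact: base_continuous.
exact: sqrt_continuous.
Qed.

(** The Riemannian norm is bounded below on the compact unit sphere of the
    maximum norm; the sphere is empty in dimension zero. *)
Lemma base_norm_coercive : exists2 c : R, 0 < c & forall v, c * `|v| <= nrm v.
Proof.
pose S := [set v : 'rV[R]_n | `|v| = 1].
have normalize v : v != 0 -> S (`|v|^-1 *: v).
  by move=> v0; rewrite /S /= normrZ normfV normr_id mulVf// normr_eq0.
have [[v1 Sv1]|noS] := pselect (exists v, S v); last first.
  exists 1 => // v; have [->|v0] := eqVneq v 0; first by rewrite normr0 mulr0 sqrtr_ge0.
  by exfalso; apply: noS; exists (`|v|^-1 *: v); exact: normalize.
have cS : compact S.
  apply: bounded_closed_compact.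
    by exists 1; split; [exact: num_real|move=> m m1 v /= ->; exact: ltW].
  rewrite (_ : S = Num.norm @^-1` [set 1 : R]) //.
  apply: preimage_closed; last exact: closed_eq.
  by move=> v _; exact: norm_continuous.
have [v0 Sv0 min0] : exists2 c, c \in S & forall t, t \in S -> nrm c <= nrm t.
  apply: (@compact_EVT_min _ _ nrm S) => //; first by exists v1.
  by apply: continuous_subspaceT; exact: base_norm_continuous.
have v0n : v0 != 0.
  apply/eqP => e; move: Sv0; rewrite inE /S /= e normr0 => /eqP.
  by rewrite eq_sym oner_eq0.
exists (nrm v0); first by rewrite sqrtr_gt0; exact: (gmx_posdef g (base_dom q) v0n).
move=> v; have [->|vn] := eqVneq v 0; first by rewrite normr0 mulr0 sqrtr_ge0.
have := min0 (`|v|^-1 *: v); rewrite inE base_normZ normfV normr_id => /(_ (normalize v vn)).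
by rewrite mulrC ler_pdivlMr ?normr_gt0.
Qed.

Lemma base_ball_compact (r : R) : compact [set v | nrm v <= r].
Proof.
have [c c0 Hc] := base_norm_coercive.
apply: bounded_closed_compact.
  exists (r / c); split; first exact: num_real.
  move=> m rm v /= vr; apply: ltW; apply: le_lt_trans rm.
  by rewrite ler_pdivlMr// mulrC; exact: le_trans (Hc v) vr.
rewrite (_ : [set v | _] = nrm @^-1` [set z | z <= r]) //.
apply: preimage_closed; last exact: closed_le.
by move=> v _; exact: base_norm_continuous.
Qed.

Lemma base_derive (y : R -> 'rV[R]_n) t dy : is_derive t (1 : R) y dy ->
  is_derive t (1 : R) (fun r => N (y r)) (2 * metric_at_base g q (y t) dy).
Proof.
move=> hy.
have hc : is_derive t (1 : R) (fun=> phi (chart_at q) q) 0 by exact: is_derive_cst.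
have H := @metric_form_derive _ _ _ g (chart_at q) (fun=> phi (chart_at q) q) y y t _ _ _
  (base_dom q) hc hy hy.
apply: (is_derive_eq H); rewrite derive0 mulmx0 mul0mx mxE addr0.
rewrite (metric_formC g dy (y t) (base_dom q)) /metric_at_base.
by rewrite -mulr2n mulr_natl.
Qed.

End base_norm.

Section normal_ball.
Context (R : realType) (n : nat) (M : smoothManifold R n)
  (g : riemannianMetric M) (q : M) (rad : R).

Let nrm (v : 'rV[R]_n) : R := Num.sqrt (metric_at_base g q v v).
Let B := [set v : 'rV[R]_n | nrm v < rad].
Let E (v : 'rV[R]_n) : M := Exp g q (v : tangent q).
Let X (a : chart_index M) (v : 'rV[R]_n) : 'rV[R]_n := phi a (E v).
Let O a := B `&` E @^-1` dom a.
Let W := E @` B.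
Variable Linv : M -> 'rV[R]_n.

Hypothesis domB : forall v, B v -> exp_dom g q (v : tangent q).
Hypothesis smoothB : forall a, smooth_on (O a) (X a).
Hypothesis contB : forall v, B v -> {for v, continuous E}.
Hypothesis smoothL : smooth_from W Linv.
Hypothesis LK : forall v, B v -> Linv (E v) = v.

Lemma base_ball_open : open B.
Proof.
rewrite (_ : B = nrm @^-1` [set z | z < rad]) //.
by apply: open_comp; [move=> v _; exact: base_norm_continuous|exact: open_lt].
Qed.

Lemma base_ball_star v (t : R) : B v -> 0 <= t <= 1 -> B (t *: v).
Proof.
move=> Bv /andP[t0 t1]; rewrite /B /= /nrm base_normZ ger0_norm//.
by apply: le_lt_trans Bv; rewrite ler_piMl// sqrtr_ge0.
Qed.

Lemma Exp_lift x : W x -> E (Linv x) = x /\ B (Linv x).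
Proof. by move=> [v Bv <-]; rewrite LK. Qed.

Lemma normal_ball_open : open W. Proof. by case: smoothL. Qed.

Lemma L_chart_differentiable a x : W x -> dom a x ->
  differentiable (Linv \o psi a) (phi a x).
Proof.
move=> Wx ax; have [_ /(_ a)[_ /(_ 1%N)[+ _]]] := smoothL.
by apply; exists x; first by split.
Qed.

(** The image of a compact ball in a Hausdorff space; this is what prevents a
    curve of small length from escaping from the normal ball. *)
Lemma image_ball_closed (r : R) : r < rad -> closed (E @` [set v | nrm v <= r]).
Proof.
move=> rr; apply: compact_closed; first exact: manifold_hausdorff.
apply: continuous_compact; last exact: base_ball_compact.
apply: continuous_in_subspaceT => v /set_mem Kv; apply: contB.
exact: le_lt_trans rr.
Qed.

Section curve_in_ball.
Context (s t : R) (gam : R -> M) (V : forall r, tangent (gam r)).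
Hypothesis st : s < t.
Hypothesis C1 : curve_C1 `[s, t] gam.
Hypothesis vel : forall r, s <= r <= t -> has_velocity `[s, t] gam r (V r).

Let y (r : R) : 'rV[R]_n := Linv (gam r).

Lemma lift_near r : s <= r <= t -> W (gam r) ->
  \forall x \near within `[s, t]%classic (nbhs r), W (gam x).
Proof.
move=> rst Wr; have nW : nbhs (gam r) W by exact: (open_nbhs_nbhs (conj normal_ball_open Wr)).
exact: (gam_within C1 rst nW).
Qed.

Lemma lift_cvg r : s <= r <= t -> W (gam r) ->
  y @ within `[s, t]%classic (nbhs r) --> y r.
Proof.
move=> rst Wr; have ar := chart_at_dom (gam r).
pose a := chart_at (gam r); rewrite -/a in ar.
have cL := differentiable_continuous (L_chart_differentiable Wr ar).
have cp : (fun x => phi a (gam x)) @ within `[s, t]%classic (nbhs r) --> phi a (gam r).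
  exact: (cvg_comp _ _ (gam_within C1 rst) (phi_continuous ar)).
have := cvg_comp _ _ cp cL; rewrite /= phiK//.
apply: cvg_trans; apply: near_eq_cvg.
have nd := dom_near_within C1 rst ar.
by apply: filterS nd => x ax; rewrite /= phiK.
Qed.

(** The lift [y] of a curve through the exponential map satisfies
    [d Exp (y') = V], so that [radial_CS] bounds the radial part of [y'] by the
    speed. *)
Lemma lift_derive r : s < r < t -> W (gam r) ->
  exists2 dy, is_derive r (1 : R) y dy &
   metric_at_base g q (y r) dy ^+ 2
     <= metric_at_base g q (y r) (y r) * Defs.gnorm g (V r) ^+ 2.
Proof.
move=> /andP[sr rt] Wr; have rst : s <= r <= t by rewrite !ltW.
pose a := chart_at (gam r); have ar : dom a (gam r) by exact: chart_at_dom.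
have nI : nbhs r `[s, t]%classic.
  have : nbhs r `]s, t[%classic.
    by apply: open_nbhs_nbhs; split; [exact: interval_open|rewrite /= in_itv /= sr].
  by apply: filterS => x /=; rewrite !in_itv /= => /andP[? ?]; rewrite !ltW.
have [cg hV] := vel rst.
have hx : is_derive r (1 : R) (phi a \o gam) (V r) := has_deriv_is_derive nI hV.
have dL := L_chart_differentiable Wr ar.
pose dy : 'rV[R]_n := 'd (Linv \o psi a) (phi a (gam r)) (V r).
have nW : \forall x \near r, W (gam x).
  have := lift_near rst Wr; rewrite near_withinE => H.
  by apply: filterS2 H nI => x H xI; exact: H.
have na : \forall x \near r, dom a (gam x).
  have := dom_near_within C1 rst ar; rewrite near_withinE => H.
  by apply: filterS2 H nI => x H xI; exact: H.
have hy : is_derive r (1 : R) y dy.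
  apply: near_eq_is_derive (is_derive_diff_comp (dL : differentiable _ ((phi a \o gam) r)) hx).
  by apply: filterS na => x ax; rewrite /= phiK.
exists dy; first exact: hy.
have [Ey By] := Exp_lift Wr.
have Oy : O a (y r) by split; [exact: By|rewrite /preimage /= Ey].
have hXy := is_derive_diff_comp (Exp_chart_differentiable smoothB Oy) hy.
have hXy' : is_derive r (1 : R) (phi a \o gam) ('d (X a) (y r) dy).
  apply: near_eq_is_derive hXy; apply: filterS nW => x Wx.
  exact: (congr1 (phi a) (Exp_lift Wx).1).
have Vr : (V r : 'rV[R]_n) = 'D_dy (X a) (y r).
  by rewrite (deriveE dy (Exp_chart_differentiable smoothB Oy)); case: hx => _ <-; case: hXy' => _ <-.
have -> : Defs.gnorm g (V r) ^+ 2 = pullback g q a (y r) dy dy.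
  rewrite /Defs.gnorm sqr_sqrtr; last by apply: metric_form_ge0; exists (gam r).
  by rewrite /pullback -/(X a (y r)) /X Ey -Vr.
have ay : dom a (E (y r)) by rewrite Ey.
exact: (radial_CS base_ball_star base_ball_open domB smoothB dy By ay).
Qed.

(** Along a curve that stays in the normal ball the distance to the origin of
    its lift grows at most by the length of the curve. *)
Lemma lift_bound s' : s <= s' < t -> (forall r, s' <= r <= t -> W (gam r)) ->
  nrm (y s') <= nrm (y t) +
    \int[lebesgue_measure]_(r in `[s, t]) Defs.gnorm g (V r).
Proof.
move=> /andP[ss' s't] Wr.
have sub r : s' <= r <= t -> s <= r <= t.
  by move=> /andP[/(le_trans ss') -> ->].
have : forall r, exists dy, s' < r < t -> is_derive r (1 : R) y dy /\
   metric_at_base g q (y r) dy ^+ 2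
     <= metric_at_base g q (y r) (y r) * Defs.gnorm g (V r) ^+ 2.
  move=> r; have [/andP[r1 r2]|no] := pselect (s' < r < t); last by exists 0.
  have rr : s < r < t by rewrite (le_lt_trans ss' r1).
  have [dy h1 h2] := lift_derive rr (Wr r (ltac:(by rewrite !ltW))).
  by exists dy.
move=> /choice[dy Hdy].
apply/ler_addgt0Pr => d d0.
pose rho r := Num.sqrt (metric_at_base g q (y r) (y r) + d ^+ 2).
have P0 r : 0 < metric_at_base g q (y r) (y r) + d ^+ 2.
  by rewrite ltr_wpDl ?base_ge0// exprn_gt0.
pose drho r := (2 * Num.sqrt (metric_at_base g q (y r) (y r) + d ^+ 2))^-1
   * (2 * metric_at_base g q (y r) (dy r)).
have H := @integral_bound R (fun r => Defs.gnorm g (V r)) rho drho s t s' ss' s't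
  (gnorm_continuous st C1 vel).
have {}H : rho s' <= rho t + \int[lebesgue_measure]_(r in `[s, t]) Defs.gnorm g (V r).
  apply: H.
  - by move=> r _; exact: sqrtr_ge0.
  - move=> r rst; have [h1 _] := Hdy r rst.
    have h2 := base_derive g q h1.
    have h3 : is_derive r (1 : R) (fun r => metric_at_base g q (y r) (y r) + d ^+ 2)
        (2 * metric_at_base g q (y r) (dy r)).
      rewrite -[X in is_derive _ _ _ X]addr0.
      by apply: is_deriveD.
    exact: (@is_derive1_comp R Num.sqrt (fun r => metric_at_base g q (y r) (y r) + d ^+ 2)
      r _ _ (is_derive1_sqrt (P0 r)) h3).
  - move=> r rst; have [_ h1] := Hdy r rst.
    by apply: radial_speed_bound => //; [exact: base_ge0|exact: sqrtr_ge0].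
  - apply/subspace_continuousP => r; rewrite /= in_itv /= => rst.
    have c1 := lift_cvg (sub r rst) (Wr r rst).
    have c2 : y @ within `[s', t]%classic (nbhs r) --> y r.
      move=> P /c1 H'.
      have {}H' : nbhs r [set x | `[s, t]%classic x -> P (y x)] by exact: H'.
      have H2 : nbhs r [set x | `[s', t]%classic x -> P (y x)].
        apply: filterS H' => x Hx; rewrite /= in_itv /= => xst; apply: Hx.
        by rewrite /= in_itv /=; exact: sub.
      exact: H2.
    have c3 := cvg_comp _ _ c2 (@base_continuous _ _ _ g q (y r)).
    have c4 : (fun x => metric_at_base g q (y x) (y x) + d ^+ 2) @ within `[s', t]%classic (nbhs r)
        --> metric_at_base g q (y r) (y r) + d ^+ 2.
      by apply: cvgD; [exact: c3|exact: cvg_cst].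
    exact: (cvg_comp _ _ c4 (@sqrt_continuous R _)).
have h1 : nrm (y s') <= rho s'.
  by rewrite /rho /nrm; apply: ler_wsqrtr; rewrite lerDl sqr_ge0.
have h2 : rho t <= nrm (y t) + d.
  have hr : rho t \in Num.nneg by rewrite nnegrE sqrtr_ge0.
  have hn : nrm (y t) + d \in Num.nneg by rewrite nnegrE addr_ge0 ?sqrtr_ge0// ltW.
  rewrite -(ler_pXn2r (ltn0Sn 1) hr hn).
  have SR : rho t ^+ 2 = metric_at_base g q (y t) (y t) + d ^+ 2.
    by rewrite /rho sqr_sqrtr// ltW.
  have SN : nrm (y t) ^+ 2 = metric_at_base g q (y t) (y t).
    by rewrite /nrm sqr_sqrtr// base_ge0.
  rewrite sqrrD SR SN lerD2r lerDl mulrn_wge0// mulr_ge0//; last exact: ltW.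
  exact: sqrtr_ge0.
lra.
Qed.

(** The curve is followed backwards from its end point: as long as it stays in
    the normal ball, [lift_bound] keeps it in the closed image of a smaller ball,
    so it cannot reach the boundary. *)
Lemma curve_in_ball v' : gam t = E v' -> B v' ->
  nrm v' + \int[lebesgue_measure]_(r in `[s, t]) Defs.gnorm g (V r) < rad ->
  exists2 v, gam s = E v & nrm v <= nrm v' +
    \int[lebesgue_measure]_(r in `[s, t]) Defs.gnorm g (V r).
Proof.
move=> gt Bv' lt; set l := \int[_]_(_ in _) _ in lt *.
have l0 : 0 <= l by apply: Rintegral_itv_ge0 => r _; exact: sqrtr_ge0.
have yt : y t = v' by rewrite /y gt LK.
have bound s' : s <= s' <= t -> (forall r, s' <= r <= t -> W (gam r)) ->
    nrm (y s') <= nrm v' + l.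
  move=> /andP[ss']; rewrite le_eqVlt => /predU1P[-> _|s't Wr].
    by rewrite yt lerDl.
  by have := lift_bound (ltac:(by rewrite ss') : s <= s' < t) Wr; rewrite yt.
(* sg is the time elapsed when the curve is run backwards from t. *)
suff Wall : forall sg, 0 <= sg <= t - s -> W (gam (t - sg)).
  have Ws r : s <= r <= t -> W (gam r).
    move=> /andP[sr rt]; rewrite -(subKr t r); apply: Wall.
    by apply/andP; split; lra.
  have ss : s <= s <= t by rewrite lexx ltW.
  exists (y s); first by rewrite /y (Exp_lift (Ws s ss)).1.
  exact: bound.
apply: real_induction => [|sg /andP[sg0 sgt] Wsg|sg /andP[sg0 sgt] Wsg].
- by rewrite subr0 gt; exists v'.
- have rst : s <= t - sg <= t by apply/andP; split; lra.
  have := lift_near rst Wsg; rewrite near_withinE => /nbhs_ballP[d /= d0 Hd].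
  exists d => // x /andP[sx xd] xt; apply: Hd; last by rewrite in_itv /=; apply/andP; split; lra.
  by rewrite /ball/= opprB addrC addrA subrK gtr0_norm; lra.
- pose r0 := t - sg.
  have rst : s <= r0 <= t by apply/andP; split; rewrite /r0; lra.
  have sub : E @` [set v | nrm v <= nrm v' + l] `<=` W.
    by move=> _ [v vn <-]; exists v => //; exact: le_lt_trans lt.
  apply: sub; apply: (@closed_cvg _ _ r0^'+ _ gam (E @` [set v | nrm v <= nrm v' + l])).
  + exact: image_ball_closed.
  + near=> x.
    have xr : r0 < x by near: x; exact: nbhs_right_gt.
    have xt : x <= t by near: x; apply: nbhs_right_le; rewrite /r0; lra.
    have Wx r : x <= r <= t -> W (gam r).
      move=> /andP[x1 x2]; rewrite -(subKr t r); apply: Wsg.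
      by apply/andP; split; rewrite /r0 in xr; lra.
    have xst : s <= x <= t.
      by move: (rst) => /andP[? ?]; apply/andP; split; lra.
    exists (y x); first exact: bound.
    by rewrite /y (Exp_lift (Wx x _)).1// lexx.
  + have cg := gam_within C1 rst.
    move=> P /cg H.
    have {}H : nbhs r0 [set x | `[s, t]%classic x -> P (gam x)] by exact: H.
    suff H2 : nbhs r0 [set x | r0 < x -> P (gam x)] by exact: H2.
    apply: filterS2 H (_ : nbhs r0 [set x | x <= t]) => [x Hx xt rx|].
      apply: Hx; rewrite /= in_itv /=; apply/andP; split; last exact: xt.
      by move: (rst) => /andP[? ?]; rewrite /=; lra.
    apply/nbhs_ballP; exists sg => // x; rewrite /ball/= ltr_distl /r0.
    by move=> /andP[? _] /=; lra.
Unshelve. all: by end_near. Qed.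

End curve_in_ball.

(** Induction on concatenations, from the end point backwards; nonnegativity of
    [l] is carried along, so that [nrm v' + l2 < rad] follows from the bound for
    the whole curve. *)
Lemma joined_in_ball x z l : joined g x z l -> 0 <= l /\
  forall v', z = E v' -> nrm v' + l < rad -> exists2 v, x = E v & nrm v <= nrm v' + l.
Proof.
elim=> {x z l} [s t gam V st C1 vel|x z w l1 l2 _ [l10 IH1] _ [l20 IH2]].
  have l0 : 0 <= \int[lebesgue_measure]_(r in `[s, t]) Defs.gnorm g (V r).
    by apply: Rintegral_itv_ge0 => r _; exact: sqrtr_ge0.
  split => // v' gt lt; apply: (curve_in_ball st C1 vel gt _ lt).
  by rewrite /B /=; lra.
split; first exact: addr_ge0.
move=> v' wv lt.
have [v zv vn] := IH2 v' wv (ltac:(lra)).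
have [u xu un] := IH1 v zv (ltac:(lra)).
by exists u => //; lra.
Qed.

End normal_ball.

(** * Hermite coefficients, logarithm and conclusion *)

Lemma near_differentiable (R : realType) (V W : normedModType R) (f h : V -> W) x :
  (\forall z \near x, f z = h z) -> differentiable f x -> differentiable h x.
Proof.
move=> fh df.
have fx : f x = h x by exact: nbhs_singleton fh.
have cdf := diff_continuous df.
have /eqaddoP H := diff_locally df.
have H' : h \o shift x = cst (h x) + 'd f x +o_ 0 id.
  have fh' : \forall z \near 0, f (z + x) = h (z + x).
    by move: fh; rewrite (near_shift 0 x) subr0.
  apply/eqaddoP => e e0; have := H e e0; apply: filterS2 fh' => z fhz.
  rewrite /= -![(_ + _ : _ -> _) _]/(_ + _) -![(- _ : _ -> _) _]/(- _) /= fx.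
  by rewrite /shift /= fhz.
have E := diff_unique cdf H'.
apply/diff_locallyP; rewrite E; split; [exact: cdf|exact: H'].
Qed.

Section hermite_coefficients.
Context (R : realType) (t0 t1 : R).
Hypothesis t01 : t0 < t1.

Let d0 : t1 - t0 != 0. Proof. by rewrite subr_eq0 gt_eqF. Qed.

Lemma hermite_a0_t0 : hermite_a0 t0 t1 t0 = 1.
Proof. by rewrite /hermite_a0; field. Qed.
Lemma hermite_a0_t1 : hermite_a0 t0 t1 t1 = 0.
Proof. by rewrite /hermite_a0; field. Qed.
Lemma hermite_b0_t0 : hermite_b0 t0 t1 t0 = 0.
Proof. by rewrite /hermite_b0; field. Qed.
Lemma hermite_b0_t1 : hermite_b0 t0 t1 t1 = 0.
Proof. by rewrite /hermite_b0; field. Qed.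
Lemma hermite_b1_t0 : hermite_b1 t0 t1 t0 = 0.
Proof. by rewrite /hermite_b1; field. Qed.
Lemma hermite_b1_t1 : hermite_b1 t0 t1 t1 = 0.
Proof. by rewrite /hermite_b1; field. Qed.

Let d1 := t1 - t0.
Lemma hermite_a0_derive t : is_derive t (1 : R) (hermite_a0 t0 t1)
  (- (2 * (t - t0)) / d1 ^+ 2 + (4 * (t - t0) * (t - t1) + 2 * (t - t0) ^+ 2) / d1 ^+ 3).
Proof.
rewrite /hermite_a0; apply: is_derive_eq; rewrite /GRing.scale /= /d1; by field.
Qed.
Lemma hermite_b0_derive t : is_derive t (1 : R) (hermite_b0 t0 t1)
  (1 - 2 * (t - t0) / d1 + (2 * (t - t0) * (t - t1) + (t - t0) ^+ 2) / d1 ^+ 2).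
Proof.
rewrite /hermite_b0; apply: is_derive_eq; rewrite /GRing.scale /= /d1; by field.
Qed.
Lemma hermite_b1_derive t : is_derive t (1 : R) (hermite_b1 t0 t1)
  ((2 * (t - t0) * (t - t1) + (t - t0) ^+ 2) / d1 ^+ 2).
Proof.
rewrite /hermite_b1; apply: is_derive_eq; rewrite /GRing.scale /= /d1; by field.
Qed.

Lemma sdiff_poly (p : {poly R}) (s : R) : sdiff (horner p) s.
Proof.
elim/poly_ind: p => [|p c IH].
  rewrite (_ : horner 0 = fun=> 0); first exact: sdiff_cst.
  by apply/funext => z; rewrite horner0.
rewrite (_ : horner (p * 'X + c%:P) = fun z => p.[z] * z + c); last first.
  by apply/funext => z; rewrite hornerD hornerMX hornerC.
by apply: sdiffD; [apply: sdiffM => //; exact: sdiff_id|exact: sdiff_cst].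
Qed.

Lemma hermite_a0_sdiff s : sdiff (hermite_a0 t0 t1) s.
Proof.
have -> : hermite_a0 t0 t1 = horner (1%:P - (d1 ^- 2) *: (('X - t0%:P) * ('X - t0%:P))
   + (2 * d1 ^- 3) *: ((('X - t0%:P) * ('X - t0%:P)) * ('X - t1%:P))).
  by apply/funext => z; rewrite /hermite_a0 !(hornerD, hornerN, hornerZ, hornerM, hornerX, hornerC) /d1; field.
exact: sdiff_poly.
Qed.
Lemma hermite_b0_sdiff s : sdiff (hermite_b0 t0 t1) s.
Proof.
have -> : hermite_b0 t0 t1 = horner (('X - t0%:P) - d1^-1 *: (('X - t0%:P) * ('X - t0%:P))
   + (d1 ^- 2) *: ((('X - t0%:P) * ('X - t0%:P)) * ('X - t1%:P))).
  by apply/funext => z; rewrite /hermite_b0 !(hornerD, hornerN, hornerZ, hornerM, hornerX, hornerC) /d1; field.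
exact: sdiff_poly.
Qed.
Lemma hermite_b1_sdiff s : sdiff (hermite_b1 t0 t1) s.
Proof.
have -> : hermite_b1 t0 t1 = horner ((d1 ^- 2) *: ((('X - t0%:P) * ('X - t0%:P)) * ('X - t1%:P))).
  by apply/funext => z; rewrite /hermite_b1 !(hornerD, hornerN, hornerZ, hornerM, hornerX, hornerC) /d1; field.
exact: sdiff_poly.
Qed.

End hermite_coefficients.

Lemma is_derive_scaled_vector (R : realType) (V : normedModType R) (k : R -> R) (v : V) t dk :
  is_derive t (1 : R) k dk -> is_derive t (1 : R) (fun s => k s *: v) (dk *: v).
Proof.
move=> hk; have hs := is_derive_scalel v (k t).
have ds : differentiable (fun s : R => s *: v) (k t) by apply/derivable1_diffP; case: hs.
have H := is_derive_diff_comp ds hk.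
apply: (is_derive_eq H).
rewrite -[X in 'd _ _ X = _](mulr1 dk) -[dk * 1]/(dk *: (1 : R)) linearZ /= -deriveE//.
by case: hs => _ ->.
Qed.

Section injectivity.
Context (R : realType) (n : nat) (M : smoothManifold R n)
  (g : riemannianMetric M) (q : M).

Definition exp_ball (r : R) : set 'rV[R]_n :=
  [set v | Num.sqrt (metric_at_base g q v v) < r].

(** The radii over which [inj_radius] is the supremum. *)
Definition normal_radius (r : R) : Prop :=
  [/\ 0 < r, (exp_ball r `<=` (fun v => exp_dom g q (v : tangent q)))
   & diffeo_on (exp_ball r) (fun v => Exp g q (v : tangent q))].

Lemma inj_radius_gt (x : \bar R) : (x < inj_radius g q)%E ->
  exists2 r, normal_radius r & (x < r%:E)%E.
Proof. by move=> /ereal_sup_gt[_ [r Hr <-] xr]; exists r. Qed.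

Lemma normal_radius_le (r : R) : normal_radius r -> (r%:E <= inj_radius g q)%E.
Proof. by move=> Hr; apply: ereal_sup_ubound; exists r. Qed.

Lemma Exp_injective r v w : normal_radius r -> exp_ball r v -> exp_ball r w ->
  Exp g q (v : tangent q) = Exp g q (w : tangent q) -> v = w.
Proof.
move=> [_ _ [_ [L [_ LK]]]] Bv Bw e.
by rewrite -(LK v Bv) -(LK w Bw) e.
Qed.

(** A competitor for the logarithm lies in a ball of another normal radius; the
    larger of the two balls contains both vectors and the exponential is injective
    on it. *)
Lemma Log_Exp r v : normal_radius r -> exp_ball r v ->
  Log g q (Exp g q (v : tangent q)) = v.
Proof.
move=> Hr Bv.
pose P := [set w : tangent q | ((Defs.gnorm g w)%:E < inj_radius g q)%E /\
   Exp g q w = Exp g q (v : tangent q)].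
have Pv : P (v : tangent q).
  split; last by reflexivity.
  by apply: lt_le_trans (normal_radius_le Hr); rewrite lte_fin.
have [w1 w2] : P (Log g q (Exp g q (v : tangent q))).
  exact: (@xgetPex _ (0 : tangent q) P (ex_intro _ _ Pv)).
have [r' Hr' lt] := inj_radius_gt w1.
have Bw : exp_ball r' (Log g q (Exp g q (v : tangent q))) by rewrite lte_fin in lt.
have [rr|rr] := leP r r'.
  by apply: (Exp_injective Hr' Bw _ w2); exact: lt_le_trans rr.
by apply: (Exp_injective Hr _ Bv w2); exact: lt_trans rr.
Qed.

Lemma Exp0 r : normal_radius r -> Exp g q (0 : tangent q) = q.
Proof.
move=> [r0 sub _].
have B0 : exp_ball r 0.
  by rewrite /exp_ball /= /metric_at_base metric_form0l sqrtr0.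
have [gam [e [e0 _ g0 _ rel]]] := exp_geodesic (sub _ B0).
have := rel 0; rewrite scaler0 g0 => H; apply: exp_relE; apply: H.
by rewrite oppr_lt0 e0 addr_gt0.
Qed.

Lemma dist_Log (p : M) : (dist g p q < inj_radius g q)%E ->
  exists r, [/\ normal_radius r, exp_ball r (Log g q p) & Exp g q (Log g q p) = p].
Proof.
move=> /inj_radius_gt[r Hr /ereal_inf_lt[_ [l jl <-]]]; rewrite lte_fin => lr.
have [r0 sub [[oB cB sB] [L [sL LK]]]] := Hr.
have [_ H] := @joined_in_ball R n M g q r L sub sB cB sL LK p q l jl.
have z0 : Num.sqrt (metric_at_base g q 0 0) = 0.
  by rewrite /metric_at_base metric_form0l sqrtr0.
have [|v pv vl] := H 0 (esym (Exp0 Hr)); first by rewrite z0 add0r.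
have Bv : exp_ball r v by apply: le_lt_trans vl _; rewrite z0 add0r.
exists r; rewrite pv (Log_Exp Hr Bv).
by split; [exact: Hr|exact: Bv|reflexivity].
Qed.

Section differentials.
Variable r : R.
Hypothesis Hr : normal_radius r.

Let X (a : chart_index M) (v : 'rV[R]_n) : 'rV[R]_n := phi a (Exp g q (v : tangent q)).

Lemma chart_Exp_differentiable a v : exp_ball r v -> dom a (Exp g q (v : tangent q)) ->
  differentiable (X a) v.
Proof.
move=> Bv av; case: Hr => _ _ [[_ _ sB] _].
by have [_ /(_ 1%N)[+ _]] := sB a; apply.
Qed.

(** Near the image of [v] the logarithm agrees with the smooth inverse given by
    the normal ball, so the differentials of [Exp] and [Log] are inverse to each
    other. *)
Lemma diff_Exp_Log a v u : exp_ball r v -> dom a (Exp g q (v : tangent q)) ->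
  'd (X a) v ('d (Log g q \o psi a) (X a v) u) = u.
Proof.
move=> Bv av; have [_ _ [[_ _ sB] [L [[oW sL] LK]]]] := Hr.
pose W : set M := (fun v => Exp g q (v : tangent q)) @` exp_ball r.
have [oI /(_ 1%N)[dL _]] := sL a.
have Iz : (phi a @` (W `&` dom a)) (X a v).
  by exists (Exp g q (v : tangent q)); first by split; [exists v|].
have nI := open_nbhs_nbhs (conj oI Iz).
have LogL x : W x -> Log g q x = L x.
  by move=> [w Bw <-]; rewrite (Log_Exp Hr Bw) LK.
have nE : \forall z \near X a v, (L \o psi a) z = (Log g q \o psi a) z.
  by apply: filterS nI => _ [x [Wx ax] <-]; rewrite /= phiK// LogL.
have dLog : differentiable (Log g q \o psi a) (X a v).
  by apply: near_differentiable nE _; exact: dL.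
have LX : (Log g q \o psi a) (X a v) = v.
  by rewrite /= /X phiK// (Log_Exp Hr Bv).
have dX : differentiable (X a) ((Log g q \o psi a) (X a v)).
  by rewrite LX; exact: chart_Exp_differentiable.
have nid : \forall z \near X a v, (X a \o (Log g q \o psi a)) z = z.
  apply: filterS nI => _ [x [[w Bw wx] ax] <-] /=.
  by rewrite phiK// -wx (Log_Exp Hr Bw).
have H1 := derive_comp u dLog dX.
rewrite LX (deriveE u dLog) in H1; rewrite -H1.
by rewrite (near_eq_derive u nid) derive_id.
Qed.

(** Along a short ray the exponential is the geodesic itself, whose velocity at
    time zero is the direction of the ray. *)
Lemma diff_Exp0 u : 'd (X (chart_at q)) 0 u = u.
Proof.
have [r0 sub [[oB _ _] _]] := Hr.
have B0 : exp_ball r 0.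
  by rewrite /exp_ball /= /metric_at_base metric_form0l sqrtr0.
have nB := near_line u oB B0.
have [k k0 Bk] : exists2 k : R, 0 < k & exp_ball r (k *: u).
  have /nbhs_ballP[d /= d0 Hd] := nB.
  exists (d / 2); first by rewrite divr_gt0.
  have := Hd (d / 2); rewrite add0r; apply.
  by rewrite /ball/= sub0r normrN gtr0_norm ?divr_gt0//; lra.
have [gam [e [e0 _ g0 dv rel]]] := exp_geodesic (sub _ Bk).
have aq : dom (chart_at q) (Exp g q (0 : tangent q)).
  by rewrite (Exp0 Hr); exact: chart_at_dom.
have dX := chart_Exp_differentiable B0 aq.
have dX0 : differentiable (X (chart_at q)) ((0 : R) *: (k *: u)) by rewrite scale0r.
have h1 := is_derive_ray (diff_derivable dX0 : derivable _ _ (k *: u)).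
have h2 : is_derive (0 : R) (1 : R) (fun s : R => X (chart_at q) (s *: (k *: u))) (k *: u).
  apply: near_eq_is_derive dv.
  have : nbhs (0 : R) `]- e, 1 + e[%classic.
    apply: open_nbhs_nbhs; split; first exact: interval_open.
    by rewrite /= in_itv /= oppr_lt0 e0 addr_gt0.
  apply: filterS => s; rewrite /= in_itv /= => se.
  by rewrite /X (exp_relE (rel s se)).
case: h1 => _ E1; case: h2 => _ E2; rewrite E1 in E2.
rewrite (deriveE _ dX0) scale0r linearZ /= in E2.
by apply: (@scalerI _ _ k); [rewrite gt_eqF|exact: E2].
Qed.

End differentials.
End injectivity.

Theorem theorem2p1 (R : realType) (n : nat) (M : smoothManifold R n)
    (g : riemannianMetric M) (t0 t1 : R) (f : R -> M) (p q : M)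
    (vp : tangent p) (vq : tangent q) :
  t0 < t1 ->
  curve_differentiable `[t0, t1] f ->
  f t0 = p -> f t1 = q ->
  has_velocity `[t0, t1] f t0 vp -> has_velocity `[t0, t1] f t1 vq ->
  (dist g p q < inj_radius g q)%E ->
  ~ conjugate_along g (fun t => Exp g q (t *: Log g q p)) 0 1 ->
  let Dp : tangent q := Log g q p in
  let hvp : tangent q := mdiff (Log g q) p vp in
  let hvq : tangent q := vq in
  let h := fun t : R =>
    hermite_a0 t0 t1 t *: Dp + hermite_b0 t0 t1 t *: hvp
    + hermite_b1 t0 t1 t *: hvq in
  (forall t, t0 <= t <= t1 -> exp_dom g q (h t)) ->
  let c := fun t : R => Exp g q (h t) in
  curve_C1 `[t0, t1] c /\
  [/\ c t0 = p, has_velocity `[t0, t1] c t0 vp,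
      c t1 = q & has_velocity `[t0, t1] c t1 vq].
Proof.
move=> t01 _ _ _ _ _ dpq _ Dp hvp hvq h dom_h c.
have [r [Hr Bp Ep]] := dist_Log dpq.
have sh s : sdiff (h : R -> 'rV[R]_n) s.
  apply: sdiffD; first apply: sdiffD.
  - by apply: sdiffZ; [exact: hermite_a0_sdiff|exact: sdiff_cst].
  - by apply: sdiffZ; [exact: hermite_b0_sdiff|exact: sdiff_cst].
  - by apply: sdiffZ; [exact: hermite_b1_sdiff|exact: sdiff_cst].
have C1 : curve_C1 `[t0, t1] c by exact: (Exp_curve_C1 t01 sh dom_h).
have dh t : is_derive t (1 : R) (h : R -> 'rV[R]_n) _ :=
  is_deriveD (is_deriveD (is_derive_scaled_vector Dp (hermite_a0_derive t01 t))
    (is_derive_scaled_vector hvp (hermite_b0_derive t01 t)))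
    (is_derive_scaled_vector hvq (hermite_b1_derive t01 t)).
have d0 : t1 - t0 != 0 by rewrite subr_eq0 gt_eqF.
have h0 : h t0 = Dp.
  by rewrite /h hermite_a0_t0// hermite_b0_t0// hermite_b1_t0// scale1r !scale0r !addr0.
have h1 : h t1 = 0.
  by rewrite /h hermite_a0_t1// hermite_b0_t1// hermite_b1_t1// !scale0r !addr0.
have dh0 : is_derive t0 (1 : R) (h : R -> 'rV[R]_n) hvp.
  apply: (is_derive_eq (dh t0)).
  rewrite (_ : - (2 * (t0 - t0)) / _ + _ = 0); last by field.
  rewrite (_ : 1 - _ + _ = 1); last by field.
  rewrite (_ : (2 * (t0 - t0) * _ + _) / _ = 0); last by field.
  by rewrite scale1r !scale0r add0r addr0.
have dh1 : is_derive t1 (1 : R) (h : R -> 'rV[R]_n) hvq.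
  apply: (is_derive_eq (dh t1)).
  rewrite (_ : - (2 * (t1 - t0)) / _ + _ = 0); last by field.
  rewrite (_ : 1 - _ + _ = 0); last by field.
  rewrite (_ : (2 * (t1 - t0) * _ + _) / _ = 1); last by field.
  by rewrite scale1r !scale0r !add0r.
have D0 : `[t0, t1]%classic t0 by rewrite /= in_itv /= lexx ltW.
have D1 : `[t0, t1]%classic t1 by rewrite /= in_itv /= lexx ltW.
have c0 : c t0 = p by rewrite /c h0.
have c1 : c t1 = q by rewrite /c h1 (Exp0 Hr).
have [cc _] := C1.
split; first exact: C1.
split; [exact: c0| |exact: c1|].
  split; first exact: (cc t0 D0).
  rewrite c0; apply: is_derive_has_deriv.
  have ap : dom (chart_at p) (Exp g q (Dp : tangent q)) by rewrite Ep; exact: chart_at_dom.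
  have dX : differentiable (fun v : 'rV[R]_n => phi (chart_at p) (Exp g q (v : tangent q)))
      (h t0) by rewrite h0; exact: (chart_Exp_differentiable Hr Bp ap).
  have := is_derive_diff_comp dX dh0; rewrite h0.
  have E := diff_Exp_Log Hr vp Bp ap; rewrite Ep in E.
  by rewrite /hvp /mdiff E.
split; first exact: (cc t1 D1).
rewrite c1; apply: is_derive_has_deriv.
have B0 : exp_ball g q r 0.
  by case: Hr => r0 _ _; rewrite /exp_ball /= /metric_at_base metric_form0l sqrtr0.
have aq : dom (chart_at q) (Exp g q (0 : tangent q)).
  by rewrite (Exp0 Hr); exact: chart_at_dom.
have dX : differentiable (fun v : 'rV[R]_n => phi (chart_at q) (Exp g q (v : tangent q)))
    (h t1) by rewrite h1; exact: (chart_Exp_differentiable Hr B0 aq).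
have := is_derive_diff_comp dX dh1; rewrite h1.
by rewrite (diff_Exp0 Hr).
Qed.
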